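(* Let $T$ be a nonnegative matrix of two-dimensional quasi-birth-and-death type satisfying all the standing assumptions (A1)--(A6) of the context. Let $\mathcal{D}$ be the convergence domain of the generating function $\hat{\boldsymbol\nu}_*(e^{\theta_1},e^{\theta_2})$ of the occupation measure, let $\mathcal{D}^{\{1\}},\mathcal{D}^{\{2\}}$ be those of $\hat{\boldsymbol\nu}_{( *,0)}(e^{\theta_1})$ and $\hat{\boldsymbol\nu}_{(0,* )}(e^{\theta_2})$, and let $\Gamma=[\Gamma^{\{1\}}]^{ex}\cap[\Gamma^{\{2\}}]^{ex}\cap\Gamma^{\{1,2\}}$. Then $$\mathcal{D}=[\mathcal{D}^{\{1\}}\cap\mathcal{D}^{\{2\}}\cap\Gamma^{\{1,2\}}]^{ex}=[\Gamma]^{ex}.$$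
   Context: Notation: $\mathbb{Z}_+=\{0,1,2,\dots\}$, $\mathbb{N}=\{1,2,\dots\}$; $O$ is a zero matrix. For a nonnegative matrix $A$ of finite or countable dimension, $\mathrm{cp}(A)=\sup\{r\ge 0;\ \sum_{n\ge0}r^nA^n<\infty\text{ entry-wise}\}$ (convergence parameter). For a convex set $S\subset\mathbb{R}^2$, $[S]^{ex}=\{\boldsymbol x\in\mathbb{R}^2;\boldsymbol x<\boldsymbol x'\text{ for some }\boldsymbol x'\in S\}$, where $<$ is the strict inequality in each coordinate. The matrix $T$. Let $S_0=\{1,\dots,s_0\}$ be a finite set (phases). Let $\mathbb{B}^\emptyset=\{(0,0)\}$, $\mathbb{B}^{\{1\}}=\mathbb{N}\times\{0\}$, $\mathbb{B}^{\{2\}}=\{0\}\times\mathbb{N}$, $\mathbb{B}^{\{1,2\}}=\mathbb{N}^2$. For $\alpha\in\{\emptyset,\{1\},\{2\},\{1,2\}\}$ and $i_1,i_2\in\{-1,0,1\}$ let $A^\alpha_{i_1,i_2}$ be nonnegative $s_0\times s_0$ matrices, with $A^\emptyset_{i_1,-1}=A^\emptyset_{-1,i_2}=O$, $A^{\{1\}}_{i_1,-1}=O$, $A^{\{2\}}_{-1,i_2}=O$ for all $i_1,i_2$. $T=(T_{\boldsymbol x,\boldsymbol x'};\boldsymbol x,\boldsymbol x'\in\mathbb{Z}_+^2)$ is the block matrix with $T_{\boldsymbol x,\boldsymbol x'}=A^\alpha_{\boldsymbol x'-\boldsymbol x}$ if $\boldsymbol x\in\mathbb{B}^\alpha$ and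 $\boldsymbol x'-\boldsymbol x\in\{-1,0,1\}^2$, and $O$ otherwise. Induced matrices. $T^{\{1\}}$ (blocks indexed by $\mathbb{Z}\times\mathbb{Z}_+$): $T^{\{1\}}_{\boldsymbol x,\boldsymbol x'}=A^{\{1\}}_{\boldsymbol x'-\boldsymbol x}$ if $\boldsymbol x\in\mathbb{Z}\times\{0\}$, $\boldsymbol x'-\boldsymbol x\in\{-1,0,1\}\times\{0,1\}$; $=A^{\{1,2\}}_{\boldsymbol x'-\boldsymbol x}$ if $\boldsymbol x\in\mathbb{Z}\times\mathbb{N}$, $\boldsymbol x'-\boldsymbol x\in\{-1,0,1\}^2$; $=O$ otherwise. $T^{\{2\}}$ (indexed by $\mathbb{Z}_+\times\mathbb{Z}$): $=A^{\{2\}}_{\boldsymbol x'-\boldsymbol x}$ if $\boldsymbol x\in\{0\}\times\mathbb{Z}$, $\boldsymbol x'-\boldsymbol x\in\{0,1\}\times\{-1,0,1\}$; $=A^{\{1,2\}}_{\boldsymbol x'-\boldsymbol x}$ if $\boldsymbol x\in\mathbb{N}\times\mathbb{Z}$, $\boldsymbol x'-\boldsymbol x\in\{-1,0,1\}^2$; $=O$ otherwise. $T^{\{1,2\}}$ (indexed by $\mathbb{Z}^2$): $=A^{\{1,2\}}_{\boldsymbol x'-\boldsymbol x}$ if $\boldsymbol x'-\boldsymbol x\in\{-1,0,1\}^2$, $=O$ otherwise. Let $\check T^{\{1\}},\check T^{\{2\}},\check T^{\{1,2\}}$ be the restrictions (submatrices) of $T^{\{1\}},T^{\{2\}},T^{\{1,2\}}$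 to blocks indexed by $\mathbb{N}\times\mathbb{Z}_+$, $\mathbb{Z}_+\times\mathbb{N}$, $\mathbb{N}^2$, respectively. Regions. For $i\in\{-1,0,1\}$ let $\bar A^{\{1\}}_i$ be the block matrix indexed by $x_2,x_2'\in\mathbb{Z}_+$ with $(x_2,x_2')$-block $A^{\{1\}}_{i,x_2'-x_2}$ if $x_2=0$, $x_2'\in\{0,1\}$; $A^{\{1,2\}}_{i,x_2'-x_2}$ if $x_2\ge1$, $x_2'-x_2\in\{-1,0,1\}$; $O$ otherwise. Let $\bar A^{\{2\}}_i$ be indexed by $x_1,x_1'\in\mathbb{Z}_+$ with block $A^{\{2\}}_{x_1'-x_1,i}$ if $x_1=0$, $x_1'\in\{0,1\}$; $A^{\{1,2\}}_{x_1'-x_1,i}$ if $x_1\ge1$, $x_1'-x_1\in\{-1,0,1\}$; $O$ otherwise. Put $\bar A^{\{k\}}_*(z)=\sum_{i\in\{-1,0,1\}}z^i\bar A^{\{k\}}_i$ ($k=1,2$), $A^{\{1,2\}}_{*,*}(z_1,z_2)=\sum_{i_1,i_2\in\{-1,0,1\}}z_1^{i_1}z_2^{i_2}A^{\{1,2\}}_{i_1,i_2}$, and $\Gamma^{\{k\}}=\{(\theta_1,\theta_2)\in\mathbb{R}^2;\mathrm{cp}(\bar A^{\{k\}}_*(e^{\theta_k}))>1\}$ ($k=1,2$), $\Gamma^{\{1,2\}}=\{(\theta_1,\theta_2)\in\mathbb{R}^2;\mathrm{cp}(A^{\{1,2\}}_{*,*}(e^{\theta_1},e^{\theta_2}))>1\}$.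 Occupation measure. $\hat T=(T_{\boldsymbol x,\boldsymbol x'};\boldsymbol x,\boldsymbol x'\in\mathbb{Z}_+^2\setminus\{(0,0)\})$, $\hat{\boldsymbol t}_{01}=(T_{(0,0),\boldsymbol x'};\boldsymbol x'\in\mathbb{Z}_+^2\setminus\{(0,0)\})$, $\hat\Phi=\sum_{n\ge0}\hat T^n$, and $\hat{\boldsymbol\nu}=(\hat{\boldsymbol\nu}_{\boldsymbol x};\boldsymbol x\in\mathbb{Z}_+^2\setminus\{(0,0)\})=\hat{\boldsymbol t}_{01}\hat\Phi$; each $\hat{\boldsymbol\nu}_{\boldsymbol x}$ is an $s_0\times s_0$ matrix. Put $\hat{\boldsymbol\nu}_*(z,w)=\sum_{(x_1,x_2)\in\mathbb{Z}_+^2\setminus\{(0,0)\}}z^{x_1}w^{x_2}\hat{\boldsymbol\nu}_{(x_1,x_2)}$, $\hat{\boldsymbol\nu}_{( *,0)}(z)=\sum_{x_1\ge1}z^{x_1}\hat{\boldsymbol\nu}_{(x_1,0)}$, $\hat{\boldsymbol\nu}_{(0,* )}(w)=\sum_{x_2\ge1}w^{x_2}\hat{\boldsymbol\nu}_{(0,x_2)}$. Define $\mathcal{D}$ = interior of $\{(\theta_1,\theta_2)\in\mathbb{R}^2;\hat{\boldsymbol\nu}_*(e^{\theta_1},e^{\theta_2})<\infty\text{ entry-wise}\}$, $\mathcal{D}^{\{1\}}$ = interior of $\{(\theta_1,\theta_2)\in\mathbb{R}^2;\hat{\boldsymbol\nu}_{( *,0)}(e^{\theta_1})<\infty\text{ entry-wise}\}$,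 $\mathcal{D}^{\{2\}}$ = interior of $\{(\theta_1,\theta_2)\in\mathbb{R}^2;\hat{\boldsymbol\nu}_{(0,* )}(e^{\theta_2})<\infty\text{ entry-wise}\}$. Standing assumptions: (A1) $T$ is irreducible and aperiodic. (A2) $T^{\{1\}},T^{\{2\}},T^{\{1,2\}}$ are irreducible and aperiodic. (A3) $\hat\Phi$ is entry-wise finite. (A4) $\check T^{\{1\}},\check T^{\{2\}},\check T^{\{1,2\}}$ are irreducible and aperiodic. (A5) $\Gamma^{\{1\}}\cap\Gamma^{\{2\}}\cap\Gamma^{\{1,2\}}\ne\emptyset$. (A6) $\Gamma^{\{1\}}\cap\mathcal{D}^{\{2\}}\cap\Gamma^{\{1,2\}}\ne\emptyset$ and $\mathcal{D}^{\{1\}}\cap\Gamma^{\{2\}}\cap\Gamma^{\{1,2\}}\ne\emptyset$. *)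

(* Defs.v *)
From HB Require Import structures.
From mathcomp Require Import all_boot all_order all_algebra.
From mathcomp Require Import all_classical all_reals all_analysis.
Import Order.TTheory GRing.Theory Num.Theory.
Import numFieldNormedType.Exports.

Set Implicit Arguments.
Unset Strict Implicit.
Unset Printing Implicit Defensive.

Local Open Scope classical_set_scope.
Local Open Scope ring_scope.

(* Nonnegative matrices of finite or countable dimension.  A matrix is a
   function [A : I -> I -> R] together with an index set [D]; a submatrix is
   the same function with a smaller [D], and entries outside [D] are ignored. *)
Section CountableMatrices.
Variables (R : realType) (I : choiceType) (D : set I) (A : I -> I -> R).

(* Sums of nonnegative terms are taken in [\bar R], so powers always exist. *)
Fixpoint mpow (n : nat) (x y : I) : \bar R :=
  if n is m.+1 then (\esum_(z in D) ((A x z)%:E * mpow m z y))%E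
  else ((x == y)%:R)%:E.

Definition irreducible : Prop :=
  forall x y, D x -> D y -> exists2 n, (0 < n)%N & (0 < mpow n x y)%E.

(* Each index has period 1, the period being the gcd of the return times. *)
Definition aperiodic : Prop :=
  forall x, D x -> forall d : nat,
    (forall n, (0 < n)%N -> (0 < mpow n x x)%E -> (d %| n)%N) -> d = 1%N.

Definition potential (x y : I) : \bar R := (\sum_(0 <= n <oo) mpow n x y)%E.

Definition cp : \bar R :=
  ereal_sup [set r%:E | r in [set r : R | 0 <= r /\
    forall x y, D x -> D y ->
      (\sum_(0 <= n <oo) ((r ^+ n)%:E * mpow n x y) < +oo)%E]].

End CountableMatrices.

(* Block matrices with s0 x s0 blocks, flattened to scalar matrices. *)
Definition flat (R : realType) (X : Type) (s0 : nat) (B : X -> X -> 'M[R]_s0)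
    (u v : X * 'I_s0) : R := B u.1 v.1 u.2 v.2.

Definition fibers (X : Type) (s0 : nat) (D : set X) : set (X * 'I_s0) :=
  [set u | D u.1].
Arguments fibers {X} s0 D.

(* [F0], [F1], [F2], [F12] are the subsets {}, {1}, {2}, {1,2} of {1,2}. *)
Inductive face := F0 | F1 | F2 | F12.

(* The alpha such that x (in Z_+^2) lies in B^alpha. *)
Definition face_of (x : int * int) : face :=
  if x.1 == 0 then (if x.2 == 0 then F0 else F2)
  else (if x.2 == 0 then F1 else F12).

Definition steps : seq int := [:: -1; 0; 1].

(* All planar index sets are seen as subsets of Z^2. *)
Definition ZxZ : set (int * int) := setT.
Definition ZxZp : set (int * int) := [set x | 0 <= x.2].
Definition ZpxZ : set (int * int) := [set x | 0 <= x.1].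
Definition ZpxZp : set (int * int) := [set x | 0 <= x.1 /\ 0 <= x.2].
Definition NxZp : set (int * int) := [set x | 0 < x.1 /\ 0 <= x.2].
Definition ZpxN : set (int * int) := [set x | 0 <= x.1 /\ 0 < x.2].
Definition NxN : set (int * int) := [set x | 0 < x.1 /\ 0 < x.2].
Definition ZpxZp0 : set (int * int) := ZpxZp `\ (0, 0).
Definition Zplus : set int := [set x | 0 <= x].

Section QBD.
Variables (R : realType) (s0 : nat).
(* Only the values at increments in {-1,0,1} are used. *)
Variable A : face -> int -> int -> 'M[R]_s0.

Definition qbd_blocks : Prop :=
  (forall al i1 i2, i1 \in steps -> i2 \in steps ->
     forall j k, 0 <= A al i1 i2 j k) /\
  [/\ forall i1, i1 \in steps -> A F0 i1 (-1) = 0,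
      forall i2, i2 \in steps -> A F0 (-1) i2 = 0,
      forall i1, i1 \in steps -> A F1 i1 (-1) = 0 &
      forall i2, i2 \in steps -> A F2 (-1) i2 = 0].

Definition Tqbd (x x' : int * int) : 'M[R]_s0 :=
  let d := x' - x in
  if (d.1 \in steps) && (d.2 \in steps) then A (face_of x) d.1 d.2 else 0.

Definition T12 (x x' : int * int) : 'M[R]_s0 :=
  let d := x' - x in
  if (d.1 \in steps) && (d.2 \in steps) then A F12 d.1 d.2 else 0.

Definition T1 (x x' : int * int) : 'M[R]_s0 :=
  let d := x' - x in
  if x.2 == 0 then
    if (d.1 \in steps) && (d.2 \in [:: 0; 1]) then A F1 d.1 d.2 else 0
  else if (d.1 \in steps) && (d.2 \in steps) then A F12 d.1 d.2 else 0.

Definition T2 (x x' : int * int) : 'M[R]_s0 :=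
  let d := x' - x in
  if x.1 == 0 then
    if (d.1 \in [:: 0; 1]) && (d.2 \in steps) then A F2 d.1 d.2 else 0
  else if (d.1 \in steps) && (d.2 \in steps) then A F12 d.1 d.2 else 0.

Definition irreducible_aperiodic (D : set (int * int))
    (B : int * int -> int * int -> 'M[R]_s0) : Prop :=
  irreducible (fibers s0 D) (flat B) /\ aperiodic (fibers s0 D) (flat B).

Definition barA1 (i x x' : int) : 'M[R]_s0 :=
  let d := x' - x in
  if x == 0 then if d \in [:: 0; 1] then A F1 i d else 0
  else if d \in steps then A F12 i d else 0.

Definition barA2 (i x x' : int) : 'M[R]_s0 :=
  let d := x' - x in
  if x == 0 then if d \in [:: 0; 1] then A F2 d i else 0
  else if d \in steps then A F12 d i else 0.

Definition barA1_star (z : R) (x x' : int) : 'M[R]_s0 :=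
  \sum_(i <- steps) z ^ i *: barA1 i x x'.

Definition barA2_star (z : R) (x x' : int) : 'M[R]_s0 :=
  \sum_(i <- steps) z ^ i *: barA2 i x x'.

Definition A12_star (z1 z2 : R) : 'M[R]_s0 :=
  \sum_(i1 <- steps) \sum_(i2 <- steps) (z1 ^ i1 * z2 ^ i2) *: A F12 i1 i2.

Definition Gamma1 : set (R * R) :=
  [set t | (1 < cp (fibers s0 Zplus) (flat (barA1_star (expR t.1))))%E].

Definition Gamma2 : set (R * R) :=
  [set t | (1 < cp (fibers s0 Zplus) (flat (barA2_star (expR t.2))))%E].

Definition Gamma12 : set (R * R) :=
  [set t | (1 < cp [set: 'I_s0] (fun j k => A12_star (expR t.1) (expR t.2) j k))%E].

Definition hatPhi : (int * int) * 'I_s0 -> (int * int) * 'I_s0 -> \bar R :=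
  potential (fibers s0 ZpxZp0) (flat Tqbd).

(* Entry (j, k) of the block at x of the row vector t_01 * hatPhi. *)
Definition hatnu (x : int * int) (j k : 'I_s0) : \bar R :=
  (\esum_(u in fibers s0 ZpxZp0) ((flat Tqbd ((0, 0), j) u)%:E * hatPhi u (x, k)))%E.

Definition hatnu_star (z w : R) (j k : 'I_s0) : \bar R :=
  (\esum_(x in ZpxZp0) ((z ^ x.1 * w ^ x.2)%:E * hatnu x j k))%E.

Definition hatnu_star0 (z : R) (j k : 'I_s0) : \bar R :=
  (\esum_(x1 in [set n : int | (0 < n)%R]) ((z ^ x1)%:E * hatnu (x1, 0%R) j k))%E.

Definition hatnu_0star (w : R) (j k : 'I_s0) : \bar R :=
  (\esum_(x2 in [set n : int | (0 < n)%R]) ((w ^ x2)%:E * hatnu (0%R, x2) j k))%E.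

Definition Dom : set (R * R) :=
  interior [set t | forall j k,
    (hatnu_star (expR t.1) (expR t.2) j k < +oo)%E].

Definition Dom1 : set (R * R) :=
  interior [set t | forall j k, (hatnu_star0 (expR t.1) j k < +oo)%E].

Definition Dom2 : set (R * R) :=
  interior [set t | forall j k, (hatnu_0star (expR t.2) j k < +oo)%E].

End QBD.

(* [S]^ex *)
Definition ex_set (R : realType) (S : set (R * R)) : set (R * R) :=
  [set t | exists2 t', S t' & t.1 < t'.1 /\ t.2 < t'.2].

Definition Gamma (R : realType) (s0 : nat)
    (A : face -> int -> int -> 'M[R]_s0) : set (R * R) :=
  ex_set (Gamma1 A) `&` ex_set (Gamma2 A) `&` Gamma12 A.

(* Main.v *)
(* For theta = (theta1, theta2), finiteness of nu_*(e^theta) means that the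
   potential of e^(theta.x) is finite for the process killed at the origin.
   Finiteness of potentials is obtained from Lyapunov functions: if u > 0
   satisfies A12_*(e^theta) u <= rho u with rho < 1, then e^(theta.x) u controls
   the interior by the two axes, and a truncation of the corresponding function
   for bar A1_*(e^theta1) controls the first axis by the second.

   Conversely, finite potentials are superharmonic functions on a quadrant or a
   half-plane that grow at least like e^(theta.x).  Geometric means of their
   translates are again superharmonic, and averaging over more and more
   translates yields, through an invariant mean, a superharmonic function of
   product form e^(theta'.x) u with theta' >= theta, so that theta' lies in the
   closure of Gamma1 or Gamma12.  When the axis sum diverges at eta, the
   potential grows at most like e^(eta n) along infinitely many points of that
   axis, which gives in addition theta'_2 <= eta.  Since the regions are convex
   by Hoelder's inequality, elementary plane geometry concludes: Gamma equals
   D1 /\ D2 /\ Gamma12, and every point of D lies strictly below a point of it. *)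
From HB Require Import structures.
Require Import Defs.
From mathcomp Require Import all_boot all_order all_algebra.
From mathcomp Require Import all_classical all_reals all_analysis.
From mathcomp Require Import ring lra zify.
Import Order.TTheory GRing.Theory Num.Theory.
Import numFieldNormedType.Exports.
Local Open Scope classical_set_scope.
Local Open Scope ring_scope.

Set Implicit Arguments.
Unset Strict Implicit.
Unset Printing Implicit Defensive.

(** * Kernels with finitely many branches *)

(** The matrices [barA1_star] and [barA2_star] are infinite, and a positive eigenvector at the
    convergence parameter need not be at hand. Hence only the inequality [kop h <= rho * h] with
    [h > 0] is used: a rate below 1 forces geometric decay of the powers, and conversely such an [h]
    is found as a potential. Averaging a potential gives no more than rate 1, that is, points of the
    closure; a convex combination with any subcritical point makes the rate strict again, and (A6)
    provides such points. A second obstacle is circular: finiteness on one axis is derived from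
    finiteness on the other. (A6) gives a start in each direction, and the ends [d1], [d2] of the
    two half-lines of finiteness are compared with the regions by moving along segments inside the
    convex open region. The bound by [eta] ties the averaged point to these ends; without it the
    point could lie far outside the box below [(d1, d2)]. Each axis yields a point bounded in one
    coordinate only, and convexity merges the two. *)

Section Kernel.
Variables (R : realType) (I : choiceType) (K : finType).
Variables (w : I -> K -> R) (tgt : I -> K -> I).

Definition kop (D : set I) (f : I -> R) (x : I) : R :=
  \sum_(k | tgt x k \in D) w x k * f (tgt x k).

Fixpoint kpsum (D : set I) (n : nat) (f : I -> R) (x : I) : R :=
  if n is m.+1 then f x + kop D (kpsum D m f) x else 0.

(* The potential of [f] is finite on [D]; bounded partial sums keep it in [R]. *)
Definition psummable (D : set I) (f : I -> R) : Prop :=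
  forall x, D x -> exists C, forall n, kpsum D n f x <= C.

Definition superharmonic (D : set I) (rho : R) (h : I -> R) : Prop :=
  (forall x, D x -> 0 < h x) /\ (forall x, D x -> kop D h x <= rho * h x).

Inductive reach (D : set I) : I -> I -> Prop :=
| reach0 x : reach D x x
| reachS x k y : 0 < w x k -> D (tgt x k) -> reach D (tgt x k) y -> reach D x y.

Hypothesis w_ge0 : forall x k, 0 <= w x k.

Lemma kop_ge0 D f x : (forall y, D y -> 0 <= f y) -> 0 <= kop D f x.
Proof. by move=> f0; apply: sumr_ge0 => k /set_mem Dk; rewrite mulr_ge0 ?f0. Qed.

Lemma le_kop D f g x : (forall y, D y -> f y <= g y) -> kop D f x <= kop D g x.
Proof. by move=> fg; apply: ler_sum => k /set_mem Dk; rewrite ler_wpM2l ?fg. Qed.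

Lemma kop_ext D f g x : (forall y, D y -> f y = g y) -> kop D f x = kop D g x.
Proof. by move=> fg; apply: eq_bigr => k /set_mem Dk; rewrite fg. Qed.

Lemma kopD D f g x : kop D (fun y => f y + g y) x = kop D f x + kop D g x.
Proof. by rewrite -big_split; apply: eq_bigr => k _; rewrite mulrDr. Qed.

Lemma kopZ D c f x : kop D (fun y => c * f y) x = c * kop D f x.
Proof. by rewrite mulr_sumr; apply: eq_bigr => k _; rewrite mulrCA. Qed.

Lemma le_kop_sub D D' f x : D `<=` D' -> (forall y, D' y -> 0 <= f y) ->
  kop D f x <= kop D' f x.
Proof.
move=> DD' f0; rewrite /kop !(big_mkcond (fun k => tgt x k \in _)) /=.
apply: ler_sum => k _; case: ifPn => [/set_mem/DD' D'k|_].
  by rewrite mem_set.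
by case: ifPn => // /set_mem D'k; rewrite mulr_ge0 ?f0.
Qed.

Lemma kop_ge_term D f x k : (forall y, D y -> 0 <= f y) -> D (tgt x k) ->
  w x k * f (tgt x k) <= kop D f x.
Proof.
move=> f0 Dk; rewrite /kop (bigD1 k) ?mem_set //= lerDl.
by apply: sumr_ge0 => j /andP[/set_mem Dj _]; rewrite mulr_ge0 ?f0.
Qed.

Lemma kpsum_ge0 D n f x : (forall y, D y -> 0 <= f y) -> D x -> 0 <= kpsum D n f x.
Proof.
move=> f0; elim: n x => [|n IH] x Dx //=.
by rewrite addr_ge0 ?f0// kop_ge0.
Qed.

Lemma le_kpsum D n f g x : (forall y, D y -> f y <= g y) -> D x ->
  kpsum D n f x <= kpsum D n g x.
Proof.
by move=> fg; elim: n x => [|n IH] x Dx //=; rewrite lerD ?fg// le_kop.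
Qed.

Lemma kpsumD D n f g x :
  kpsum D n (fun y => f y + g y) x = kpsum D n f x + kpsum D n g x.
Proof.
elim: n x => [|n IH] x /=; first by rewrite addr0.
by rewrite (kop_ext (g := fun y => kpsum D n f y + kpsum D n g y)) // kopD addrACA.
Qed.

Lemma kpsumZ D n c f x : kpsum D n (fun y => c * f y) x = c * kpsum D n f x.
Proof.
elim: n x => [|n IH] x /=; first by rewrite mulr0.
by rewrite (kop_ext (g := fun y => c * kpsum D n f y)) // kopZ mulrDr.
Qed.

Lemma kpsum_mono D m n f x : (m <= n)%N -> (forall y, D y -> 0 <= f y) -> D x ->
  kpsum D m f x <= kpsum D n f x.
Proof.
move=> + f0; elim: n m x => [|n IH] [|m] x //= mn Dx.
  by apply: addr_ge0; [exact: f0|apply: kop_ge0 => y; exact: kpsum_ge0].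
by rewrite lerD2l; apply: le_kop => y; exact: IH.
Qed.

Lemma le_kpsum_sub D D' n f x : D `<=` D' -> (forall y, D' y -> 0 <= f y) -> D x ->
  kpsum D n f x <= kpsum D' n f x.
Proof.
move=> DD' f0; elim: n x => [|n IH] x Dx //=.
rewrite lerD2l; apply: le_trans (le_kop _ IH) _.
by apply: le_kop_sub => // y; exact: kpsum_ge0.
Qed.

Lemma kpsum_kop D n f x : kpsum D n (kop D f) x + f x = kpsum D n.+1 f x.
Proof.
elim: n x => [|n IH] x; first by rewrite /= /kop addrC big1// => k _; rewrite mulr0.
rewrite -[LHS]/(kop D f x + kop D (kpsum D n (kop D f)) x + f x).
by rewrite -kopD addrC; congr (_ + _); apply: kop_ext => y _; rewrite addrC IH.
Qed.

(* The induction on [n] avoids any remainder term [kop^n G]. *)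
Lemma kpsum_le_Lyapunov D F G E n x :
  (forall y, D y -> 0 <= G y) ->
  (forall y, D y -> F y + kop D G y <= G y + E y) ->
  D x -> kpsum D n F x <= G x + kpsum D n E x.
Proof.
move=> G0 H; elim: n x => [|n IH] x Dx /=; first by rewrite addr0 G0.
apply: (@le_trans _ _ (F x + kop D G x + kop D (kpsum D n E) x)).
  by rewrite -addrA lerD2l -kopD; apply: le_kop.
by rewrite addrA lerD2r H.
Qed.

Lemma psummable_Lyapunov D F G E :
  (forall y, D y -> 0 <= G y) ->
  (forall y, D y -> F y + kop D G y <= G y + E y) ->
  psummable D E -> psummable D F.
Proof.
move=> G0 H sE x Dx; have [C HC] := sE x Dx; exists (G x + C) => n.
by apply: le_trans (kpsum_le_Lyapunov n G0 H Dx) _; rewrite lerD2l.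
Qed.

Lemma psummable_le D f g c : (forall y, D y -> f y <= c * g y) -> 0 <= c ->
  psummable D g -> psummable D f.
Proof.
move=> fg c0 sg x Dx; have [C HC] := sg x Dx; exists (c * C) => n.
by apply: le_trans (le_kpsum n fg Dx) _; rewrite kpsumZ ler_wpM2l.
Qed.

Lemma psummableD D f g : psummable D f -> psummable D g ->
  psummable D (fun x => f x + g x).
Proof.
move=> sf sg x Dx; have [C HC] := sf x Dx; have [C' HC'] := sg x Dx.
by exists (C + C') => n; rewrite kpsumD lerD.
Qed.

Lemma psummable0 D : psummable D (fun=> 0).
Proof.
move=> x _; exists 0 => n; elim: n x => [|n IH] x //=.
by rewrite add0r /kop sumr_le0 // => k _; apply: mulr_ge0_le0.
Qed.

Lemma psummable_sum D (J : Type) (r : seq J) (P : pred J) (f : J -> I -> R) :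
  (forall j, P j -> psummable D (f j)) -> psummable D (fun x => \sum_(j <- r | P j) f j x).
Proof.
move=> sf; elim: r => [|j r IH].
  apply: (@psummable_le _ _ (fun=> 0) 0) => // [y _|]; last exact: psummable0.
  by rewrite big_nil mul0r.
case Pj: (P j); last first.
  apply: (@psummable_le _ _ (fun x => \sum_(j <- r | P j) f j x) 1) => // y _.
  by rewrite big_cons Pj mul1r.
apply: (@psummable_le _ _ (fun x => f j x + \sum_(j <- r | P j) f j x) 1) => // [y _|].
  by rewrite big_cons Pj mul1r.
by apply: psummableD => //; exact: sf.
Qed.

Lemma psummable_kop D f : (forall y, D y -> 0 <= f y) -> psummable D f ->
  psummable D (kop D f).
Proof.
move=> f0 sf x Dx; have [C HC] := sf x Dx; exists C => n.
by apply: le_trans (HC n.+1); rewrite -kpsum_kop lerDl f0.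
Qed.

Lemma psummable_sub D D' f : D `<=` D' -> (forall y, D' y -> 0 <= f y) ->
  psummable D' f -> psummable D f.
Proof.
move=> DD' f0 sf x Dx; have [C HC] := sf x (DD' _ Dx); exists C => n.
exact: le_trans (le_kpsum_sub n DD' f0 Dx) _.
Qed.

(** The constant is the product of the weights along one path, so it is the same for all [h]. This
    uniformity is what later gives bounds independent of the translate and of the exponent. *)
Lemma reach_Harnack D x y : reach D x y -> D x ->
  exists2 c, 0 < c & forall h, (forall z, D z -> 0 <= h z) ->
    (forall z, D z -> kop D h z <= h z) -> c * h y <= h x.
Proof.
elim=> [{}x|{}x k {}y wk Dk _ IH] Dx; first by exists 1 => // h; rewrite mul1r.
have [c c0 Hc] := IH Dk; exists (w x k * c) => [|h h0 hh]; first by rewrite mulr_gt0.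
apply: le_trans (hh _ Dx); apply: le_trans (kop_ge_term h0 Dk).
by rewrite -mulrA ler_wpM2l // Hc.
Qed.

Definition pot (D : set I) (f : I -> R) (x : I) : R :=
  limn (fun n => kpsum D n f x).

Section Potential.
Variables (D : set I) (f : I -> R).
Hypotheses (f_ge0 : forall y, D y -> 0 <= f y) (f_psummable : psummable D f).

Lemma is_cvg_kpsum x : D x -> cvgn (fun n => kpsum D n f x).
Proof.
move=> Dx; apply: nondecreasing_is_cvgn.
  by move=> m n mn; exact: kpsum_mono.
by have [C HC] := f_psummable Dx; exists C => _ [n _ <-].
Qed.

Lemma cvg_kpsum_pot x : D x -> kpsum D n f x @[n --> \oo] --> pot D f x.
Proof. exact: is_cvg_kpsum. Qed.

Lemma kpsum_le_pot n x : D x -> kpsum D n f x <= pot D f x.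
Proof.
move=> Dx; apply: nondecreasing_cvgn_le; last exact: is_cvg_kpsum.
by move=> m k mk; exact: kpsum_mono.
Qed.

Lemma pot_ge0 x : D x -> 0 <= pot D f x.
Proof. by move=> Dx; apply: le_trans (kpsum_le_pot 0 Dx). Qed.

Lemma le_pot x C : D x -> (forall n, kpsum D n f x <= C) -> pot D f x <= C.
Proof. by move=> Dx HC; apply: limr_le; [exact: is_cvg_kpsum|near=> n]. Unshelve. all: by end_near. Qed.

Lemma potE x : D x -> pot D f x = f x + kop D (pot D f) x.
Proof.
move=> Dx; apply/cvg_lim => //; rewrite -(cvg_shiftS (fun n => kpsum D n f x)) /=.
apply: cvgD; first exact: cvg_cst.
apply: cvg_big => [|k /set_mem Dk]; first exact: add_continuous.
by apply: cvgMl_tmp; exact: cvg_kpsum_pot.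
Qed.

Lemma pot_superharmonic_le x : D x -> kop D (pot D f) x <= pot D f x.
Proof. by move=> Dx; rewrite [leRHS]potE // lerDr f_ge0. Qed.

End Potential.

End Kernel.

(** * Powers, potentials and convergence parameters *)

Section EsumExtra.
Local Open Scope ereal_scope.

(** One inequality, proved for every scalar, suffices: applied to [c^-1] it gives the other one. *)
Lemma ge0_esumZl (R : realType) (T : choiceType) (S : set T) (c : R)
    (a : T -> \bar R) : (0 <= c)%R -> (forall i, S i -> 0 <= a i) ->
  \esum_(i in S) (c%:E * a i) = c%:E * \esum_(i in S) a i.
Proof.
have aux (d : R) (b : T -> \bar R) : (0 <= d)%R -> (forall i, S i -> 0 <= b i) ->
    \esum_(i in S) (d%:E * b i) <= d%:E * \esum_(i in S) b i.
  move=> d0 b0; apply: ge_ereal_sup => _ [X [finX XS] <-].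
  rewrite (_ : \sum_(i \in X) _ = d%:E * \sum_(i \in X) b i); last first.
    rewrite !fsbig_finite //= !big_seq ge0_sume_distrr // => i.
    by rewrite in_fset_set // => /set_mem /XS /b0.
  apply: lee_wpmul2l; first by rewrite lee_fin.
  by apply: ereal_sup_ubound; exists X.
rewrite le_eqVlt => /predU1P[<-|c0] a0.
  by rewrite mul0e esum1 // => i _; rewrite mul0e.
apply/eqP; rewrite eq_le aux ?(ltW c0) //=.
have -> : \esum_(i in S) a i = \esum_(i in S) (c^-1%:E * (c%:E * a i)).
  by apply: eq_esum => i _; rewrite muleA -EFinM mulVf ?mul1e // gt_eqF.
apply: (@le_trans _ _ (c%:E * (c^-1%:E * \esum_(i in S) (c%:E * a i)))).
  apply: lee_wpmul2l; first by rewrite lee_fin ltW.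
  apply: aux; first by rewrite invr_ge0 ltW.
  by move=> i Si; rewrite mule_ge0 ?a0 // lee_fin ltW.
by rewrite muleA -EFinM mulfV ?mul1e // gt_eqF.
Qed.

Lemma esum_exchange (R : realType) (T U : choiceType) (S : set T) (V : set U)
    (a : T -> U -> \bar R) : (forall i j, S i -> V j -> 0 <= a i j) ->
  \esum_(i in S) \esum_(j in V) a i j = \esum_(j in V) \esum_(i in S) a i j.
Proof.
move=> a0; rewrite (@esum_esum _ _ _ S (fun=> V)) //.
rewrite (@esum_esum _ _ _ V (fun=> S) (fun j i => a i j)); last first.
  by move=> j i Vj Si; exact: a0.
rewrite (reindex_esum (V `*`` fun=> S) _ (fun x => (x.2, x.1)))//; split=> //=.
- by move=> [i j] [/=].
- by move=> [i1 i2] [j1 j2] /= _ _ [] -> ->.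
- by move=> [i1 i2] [Pi1 Qi2] /=; exists (i2, i1).
Qed.

End EsumExtra.

Section Conversion.
Variables (R : realType) (I : choiceType) (K : finType).
Variables (w : I -> K -> R) (tgt : I -> K -> I).
Hypothesis w_ge0 : forall x k, 0 <= w x k.
Variables (D : set I) (T : I -> I -> R).

(** Distinct branches may share a target, as for the phases, where the increments are forgotten; an
    entry of the matrix is therefore a sum over branches. *)
Definition row_kernel (x : I) : Prop :=
  forall y, D y -> T x y = \sum_(k | tgt x k == y) w x k.

Local Notation op := (kop w tgt D).
Local Notation psum := (kpsum w tgt D).

Lemma esum_kop x f : row_kernel x -> (forall y, D y -> 0 <= f y) ->
  \esum_(z in D) ((T x z)%:E * (f z)%:E)%E = (op f x)%:E.
Proof.
move=> Tx f0.
transitivity (\esum_(z in D) \sum_(k : K)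
    ((if tgt x k == z then w x k * f (tgt x k) else 0)%:E))%E.
  apply: eq_esum => z Dz; rewrite Tx // -EFinM mulr_suml sumEFin; congr EFin.
  by rewrite big_mkcond; apply: eq_bigr => k _; case: eqP => // ->.
rewrite esum_sum; last first.
  by move=> z k Dz _; case: eqP => // ->; rewrite lee_fin mulr_ge0 ?f0.
rewrite /op -sumEFin [RHS]big_mkcond /=; apply: eq_bigr => k _.
rewrite esum_mkcond.
transitivity (\esum_(z in [set tgt x k])
   (if z \in D then (w x k * f (tgt x k))%:E else 0)%E).
  rewrite [RHS]esum_mkcond; apply: eq_esum => z _.
  rewrite classical_sets.in_set1 eq_sym.
  by case: eqVneq => [<-|_] //; case: ifP.
rewrite esum_set1 //; case: ifPn => // /set_mem Dk.
by rewrite lee_fin mulr_ge0 ?f0.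
Qed.

Hypothesis T_kernel : forall x, D x -> row_kernel x.

Lemma iter_kop_ge0 n f x : (forall y, D y -> 0 <= f y) -> D x ->
  0 <= iter n op f x.
Proof.
by move=> f0; elim: n x => [|n IH] x Dx //=; [exact: f0|apply: kop_ge0].
Qed.

Lemma kpsum_iter n f x : D x -> psum n f x = \sum_(0 <= m < n) iter m op f x.
Proof.
elim: n x => [|n IH] x Dx; first by rewrite big_nil.
rewrite /= (kop_ext _ _ _ IH) big_nat_recl //; congr (_ + _).
elim: n {IH} => [|n IH].
  by rewrite big_nil /kop big1 // => k _; rewrite big_nil mulr0.
rewrite big_nat_recr //= -IH -kopD; apply: kop_ext => y _.
by rewrite big_nat_recr.
Qed.

Lemma esum_mpow n (S : set I) (c : I -> R) u : S `<=` D ->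
  (forall v, S v -> 0 <= c v) -> D u ->
  \esum_(v in S) ((c v)%:E * mpow D T n u v)%E =
  (iter n op (fun v => if v \in S then c v else 0) u)%:E.
Proof.
move=> SD c0; elim: n u => [|n IH] u Du /=.
  rewrite esum_mkcond.
  transitivity (\esum_(v in [set u])
     (if v \in S then (c v)%:E else 0)%E).
    rewrite [RHS]esum_mkcond; apply: eq_esum => v _.
    rewrite classical_sets.in_set1 [v == u]eq_sym; case: (eqVneq u v) => [_|_].
      by rewrite mule1.
    by rewrite mule0; case: ifP.
  rewrite esum_set1; last by case: ifPn => // /set_mem /c0; rewrite lee_fin.
  by case: ifP.
have T0 x z : D x -> D z -> 0 <= T x z.
  by move=> Dx Dz; rewrite T_kernel // sumr_ge0.
have m0 m x y : D x -> (0 <= mpow D T m x y)%E.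
  elim: m x => [|m IHm] x Dx /=; first by rewrite lee_fin.
  by apply: esum_ge0 => z Dz; rewrite mule_ge0 ?IHm // lee_fin T0.
transitivity (\esum_(v in S) \esum_(z in D)
    ((T u z)%:E * ((c v)%:E * mpow D T n z v))%E).
  apply: eq_esum => v Sv; rewrite -ge0_esumZl ?c0 //; last first.
    by move=> z Dz; rewrite mule_ge0 ?m0 // lee_fin T0.
  by apply: eq_esum => z Dz; rewrite muleCA.
rewrite esum_exchange; last first.
  by move=> v z Sv Dz; rewrite !mule_ge0 ?m0 // lee_fin ?T0 ?c0.
rewrite -esum_kop; last 2 first.
- exact: T_kernel.
- by move=> y Dy; apply: iter_kop_ge0 => // z _; case: ifPn => // /set_mem /c0.
apply: eq_esum => z Dz; rewrite -IH // ge0_esumZl ?T0 //.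
by move=> v Sv; rewrite mule_ge0 ?m0 // lee_fin c0.
Qed.

Lemma mpow_ge0 n x y : D x -> (0 <= mpow D T n x y)%E.
Proof.
elim: n x => [|n IH] x Dx /=; first by rewrite lee_fin.
apply: esum_ge0 => z Dz; rewrite mule_ge0 ?IH // lee_fin.
by rewrite T_kernel // sumr_ge0.
Qed.

Lemma mpowE n x y : D x -> D y ->
  mpow D T n x y = (iter n op (fun v => (v == y)%:R) x)%:E.
Proof.
move=> Dx Dy.
have y1 v : [set y] v -> 0 <= (fun=> 1 : R) v by [].
have := @esum_mpow n [set y] (fun=> 1) x _ y1 Dx.
rewrite esum_set1 ?mul1e ?mpow_ge0 // => ->; last by move=> _ ->.
congr (iter _ _ _ _)%:E; apply/funext => v; rewrite classical_sets.in_set1.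
by case: eqP.
Qed.

Lemma potential_ge0 x y : D x -> (0 <= potential D T x y)%E.
Proof. by move=> Dx; apply: nneseries_ge0 => n _ _; exact: mpow_ge0. Qed.

Lemma esum_potential (S : set I) (c : I -> R) u : S `<=` D ->
  (forall v, S v -> 0 <= c v) -> D u ->
  \esum_(v in S) ((c v)%:E * potential D T u v)%E =
  (\sum_(0 <= n <oo) (iter n op (fun v => if v \in S then c v else 0) u)%:E)%E.
Proof.
move=> SD c0 Du.
have f0 y : D y -> 0 <= (if y \in S then c y else 0).
  by move=> _; case: ifPn => // /set_mem /c0.
transitivity (\esum_(v in S) \esum_(n in [set: nat])
    ((c v)%:E * mpow D T n u v)%E).
  apply: eq_esum => v Sv; rewrite /potential -nneseriesZl; last first.
    by move=> n _; exact: mpow_ge0.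
  rewrite nneseries_esumT // => n.
  by rewrite mule_ge0 ?mpow_ge0 // lee_fin c0.
rewrite esum_exchange; last first.
  by move=> v n Sv _; rewrite mule_ge0 ?mpow_ge0 // lee_fin c0.
rewrite nneseries_esumT => [|n]; last by rewrite lee_fin iter_kop_ge0.
by apply: eq_esum => n _; rewrite esum_mpow.
Qed.

Lemma nneseries_iter_pot f u : (forall y, D y -> 0 <= f y) ->
  psummable w tgt D f -> D u ->
  (\sum_(0 <= n <oo) (iter n op f u)%:E)%E = (pot w tgt D f u)%:E.
Proof.
move=> f0 sf Du.
transitivity (limn (fun n => (psum n f u)%:E)).
  by apply: congr_lim; apply/funext => n; rewrite kpsum_iter // -sumEFin.
by rewrite EFin_lim //; apply: is_cvg_kpsum.
Qed.

Lemma nneseries_iter_ge f u n : (forall y, D y -> 0 <= f y) -> D u ->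
  ((psum n f u)%:E <= \sum_(0 <= n <oo) (iter n op f u)%:E)%E.
Proof.
move=> f0 Du; rewrite kpsum_iter // -sumEFin; apply: nneseries_lim_ge => m _ _.
by rewrite lee_fin iter_kop_ge0.
Qed.

Lemma irreducible_reach x y : irreducible D T -> D x -> D y -> reach w tgt D x y.
Proof.
move=> irr Dx Dy; have [n _] := irr _ _ Dx Dy; rewrite mpowE // lte_fin.
elim: n x Dx => [|n IH] x Dx /=.
  by case: (eqVneq x y) => [->|_]; [constructor|rewrite ltxx].
rewrite lt_neqAle eq_sym => /andP[/eqP h _]; apply: contrapT => nr; apply: h.
rewrite /kop big1 // => k /set_mem Dk.
have [->|wk] := eqVneq (w x k) 0; first by rewrite mul0r.
rewrite [X in _ * X](_ : _ = 0) ?mulr0 //; apply/eqP; apply: contrapT => /negP it.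
apply: nr; apply: (@reachS _ _ _ _ _ _ x k) => //; first by rewrite lt_neqAle eq_sym wk w_ge0.
apply: IH => //; rewrite lt_neqAle eq_sym it /=.
by apply: iter_kop_ge0 => // z _.
Qed.

(** Harnack inequality for partial sums: the path from [x] to [y] costs a delay [m], its length,
    independent of [f] and [n]. It spreads boundedness from one state to those it reaches. *)
Lemma reach_kpsum x y : reach w tgt D x y -> D x ->
  exists2 c, 0 < c & exists m, forall f n, (forall z, D z -> 0 <= f z) ->
    c * psum n f y <= psum (n + m) f x.
Proof.
elim=> [{}x|{}x k {}y wk Dk _ IH] Dx.
  by exists 1 => //; exists 0%N => f n _; rewrite mul1r addn0.
have [c c0 [m Hc]] := IH Dk.
exists (w x k * c) => [|]; first by rewrite mulr_gt0.
exists m.+1 => f n f0; rewrite addnS /=.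
apply: (@le_trans _ _ (op (psum (n + m) f) x)); last by rewrite lerDr f0.
apply: le_trans (kop_ge_term w_ge0 _ Dk); last by move=> z Dz; exact: kpsum_ge0.
by rewrite -mulrA ler_wpM2l // Hc.
Qed.

Lemma iter_kop_le_superharmonic h rho f c x : superharmonic w tgt D rho h ->
  (forall y, D y -> f y <= c * h y) -> 0 <= rho -> 0 <= c -> D x ->
  forall n, iter n op f x <= c * rho ^+ n * h x.
Proof.
move=> [h0 hh] fh rho0 c0 + n; elim: n x => [|n IH] x Dx /=; first by rewrite mulr1 fh.
apply: (@le_trans _ _ (op (fun y => c * rho ^+ n * h y) x)).
  exact: le_kop.
rewrite kopZ exprSr mulrA -[leRHS]mulrA.
by apply: ler_wpM2l; rewrite ?hh // mulr_ge0 // exprn_ge0.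
Qed.

Lemma superharmonic_cp rho h : superharmonic w tgt D rho h -> 0 < rho -> rho < 1 ->
  (1 < cp D T)%E.
Proof.
(* The square root lies strictly between 1 and [rho^-1]: [r] exceeds 1 while [r * rho < 1] still
   leaves a convergent geometric series. *)
move=> hh rho0 rho1; pose r := Num.sqrt rho^-1.
have q1 : 1 < rho^-1 by rewrite invf_gt1.
have r0 : 0 <= r by exact: sqrtr_ge0.
have rr : r ^+ 2 = rho^-1 by rewrite sqr_sqrtr // invr_ge0 ltW.
have r1 : 1 < r by rewrite -(@ltr_pXn2r _ 2) ?nnegrE // rr expr1n.
have rrho : r * rho < 1.
  rewrite -(@ltr_pM2l _ r) ?(lt_trans ltr01) // mulrA -expr2 rr mulVf ?gt_eqF //.
  by rewrite mulr1.
apply: (@lt_le_trans _ _ r%:E); first by rewrite lte_fin.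
apply: ereal_sup_ubound; exists r => //; split=> // x y Dx Dy.
have hy : 0 < h y by exact: hh.1.
have bnd n : iter n op (fun v => (v == y)%:R) x <= (h y)^-1 * rho ^+ n * h x.
  apply: iter_kop_le_superharmonic => //; rewrite ?ltW ?invr_gt0 // => z Dz.
  have hz : 0 < h z by exact: hh.1.
  case: eqP => [->|_]; first by rewrite mulVf ?gt_eqF.
  by rewrite mulr_ge0 ?invr_ge0 // ltW.
pose a := (h y)^-1 * h x; pose q := r * rho.
have q0 : 0 <= q by rewrite mulr_ge0 // ltW.
apply: (@le_lt_trans _ _ (a / (1 - q))%:E); last exact: ltry.
apply: lime_le; first by apply: is_cvg_nneseries => n _ _; rewrite mule_ge0 ?mpow_ge0 // lee_fin exprn_ge0.
apply: nearW => n.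
apply: (@le_trans _ _ (\sum_(0 <= m < n) (a * q ^+ m)%:E)%E).
  apply: lee_sum => m _; rewrite mpowE // -EFinM lee_fin /a /q exprMn.
  rewrite [leRHS](_ : _ = r ^+ m * ((h y)^-1 * rho ^+ m * h x)); last by ring.
  by rewrite ler_wpM2l ?exprn_ge0.
rewrite sumEFin lee_fin -mulr_sumr; apply: ler_wpM2l.
  by rewrite mulr_ge0 ?invr_ge0 // ltW // hh.1.
rewrite -[leRHS]mul1r ler_pdivlMr ?subr_gt0 // mulrC.
rewrite big_mkord (_ : (1 - q) * _ = 1 - q ^+ n); first by rewrite gerBl exprn_ge0.
by rewrite -[1 - q]opprB mulNr -subrX1 opprB.
Qed.

(** For some [r > 1] the potential of the indicator of [y] under the weights [r * w] is finite. It
    is superharmonic at rate [r^-1] for [w], and positive because every state reaches [y]. *)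
Lemma cp_superharmonic y : (1 < cp D T)%E -> D y ->
  (forall x, D x -> reach w tgt D x y) ->
  exists2 rho, 0 < rho < 1 & exists h, superharmonic w tgt D rho h.
Proof.
move=> /ereal_sup_gt[_ [r [r0 Hr] <-]]; rewrite lte_fin => r1 Dy ry.
have rp : 0 < r := lt_trans ltr01 r1.
have d0 z : D z -> 0 <= ((z == y)%:R : R) by [].
pose wr x k := r * w x k.
have wr0 x k : 0 <= wr x k by rewrite mulr_ge0.
pose f v : R := (v == y)%:R.
have opr g x : kop wr tgt D g x = r * op g x.
  by rewrite /kop mulr_sumr; apply: eq_bigr => k _; rewrite mulrA.
have itr n x : iter n (kop wr tgt D) f x = r ^+ n * iter n op f x.
  elim: n x => [|n IH] x; first by rewrite mul1r.
  rewrite /= opr (kop_ext w tgt _ (fun y _ => IH y)) kopZ exprS; ring.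
have sf : psummable wr tgt D f.
  move=> x Dx; have := Hr x y Dx Dy.
  set s := (\sum_(0 <= n <oo) _)%E => sfin.
  have s0 : (0 <= s)%E.
    by apply: nneseries_ge0 => n _ _; rewrite mule_ge0 ?mpow_ge0 // lee_fin exprn_ge0.
  exists (fine s) => n.
  have -> : kpsum wr tgt D n f x = \sum_(0 <= m < n) r ^+ m * iter m op f x.
    elim: n x {Dx s sfin s0} => [|n IH] x; first by rewrite big_nil.
    rewrite /= (kop_ext wr tgt _ (fun y _ => IH y)) opr big_nat_recl // mul1r; congr (_ + _).
    rewrite -[kop w tgt D _ x]/(op (fun z => \sum_(0 <= m < n) r ^+ m * iter m op f z) x).
    elim: n {IH} => [|n IH].
      by rewrite big_nil /kop big1 ?mulr0 // => k _; rewrite big_nil mulr0.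
    rewrite big_nat_recr //= -IH exprS -[r * r ^+ n * _]mulrA -(kopZ _ _ _ (r ^+ n)) -mulrDr -kopD.
    congr (_ * _).
    by apply: kop_ext => z _; rewrite big_nat_recr.
  rewrite -lee_fin fineK; last by rewrite ge0_fin_numE.
  rewrite -sumEFin; apply: le_trans (nneseries_lim_ge n _); last first.
    by move=> m _ _; rewrite mule_ge0 ?mpow_ge0 // lee_fin exprn_ge0.
  by apply: lee_sum => m _; rewrite mpowE // -EFinM.
exists r^-1; first by rewrite invr_gt0 rp invf_lt1.
have sup := pot_superharmonic_le wr0 d0 sf.
have ge0 := pot_ge0 wr0 d0 sf.
exists (pot wr tgt D f); split=> x Dx; last first.
  by rewrite ler_pdivlMl // -opr; exact: sup.
have r' : reach wr tgt D x y.
  elim: (ry x Dx) => [z|z k v wk Dk _]; first by constructor.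
  by apply: reachS => //; rewrite mulr_gt0.
have [c c0 Hc] := reach_Harnack wr0 r' Dx.
apply: lt_le_trans (Hc _ ge0 sup); rewrite mulr_gt0 //.
rewrite (potE wr0 d0 sf) // eqxx.
by apply: (@lt_le_trans _ _ 1) => //; rewrite lerDl; apply: kop_ge0 => //.
Qed.

End Conversion.

(** * Invariant means and geometric averaging *)

Section Means.
Variable R : realType.
Implicit Types a b : nat -> R.

Definition bounded_seq a : Prop := exists C, forall k, `|a k| <= C.

Lemma bounded_seqD a b : bounded_seq a -> bounded_seq b ->
  bounded_seq (fun k => a k + b k).
Proof.
move=> [C HC] [C' HC']; exists (C + C') => k.
by apply: le_trans (ler_normD _ _) _; rewrite lerD.
Qed.

Lemma bounded_seqZ c a : bounded_seq a -> bounded_seq (fun k => c * a k).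
Proof. by move=> [C HC]; exists (`|c| * C) => k; rewrite normrM ler_wpM2l. Qed.

Lemma bounded_seq_cst c : bounded_seq (fun=> c).
Proof. by exists `|c|. Qed.

Lemma bounded_seqS a : bounded_seq a -> bounded_seq (fun k => a k.+1).
Proof. by move=> [C HC]; exists C. Qed.

Lemma bounded_seq_sum (K : Type) (r : seq K) (P : pred K) (f : K -> nat -> R) :
  (forall k, P k -> bounded_seq (f k)) ->
  bounded_seq (fun n => \sum_(k <- r | P k) f k n).
Proof.
move=> Hf; elim: r => [|k r [C HC]]; first by exists 0 => n; rewrite big_nil normr0.
case Pk: (P k); last by exists C => n; rewrite big_cons Pk.
have [C' HC'] := Hf k Pk; exists (C' + C) => n.
by rewrite big_cons Pk; apply: le_trans (ler_normD _ _) _; rewrite lerD.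
Qed.

(* By [mean_le_freq] a growth bound known only along [N] still bounds the mean. *)
Record mean (N : nat -> nat) (L : (nat -> R) -> R) : Prop := Mean {
  meanD : forall a b, bounded_seq a -> bounded_seq b ->
    L (fun k => a k + b k) = L a + L b;
  meanZ : forall c a, bounded_seq a -> L (fun k => c * a k) = c * L a;
  le_mean : forall a b, bounded_seq a -> bounded_seq b ->
    (forall k, a k <= b k) -> L a <= L b;
  mean_cst : forall c, L (fun=> c) = c;
  meanS : forall a, bounded_seq a -> L (fun k => a k.+1) = L a;
  mean_le_freq : forall a eta C, bounded_seq a ->
    (forall j, \sum_(0 <= k < N j) a k <= eta * (N j)%:R + C) -> L a <= eta }.

Lemma bounded_cvg_ultra (U : set_system nat) (x : nat -> R) C :
  UltraFilter U -> (forall k, `|x k| <= C) -> cvg (x @ U).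
Proof.
move=> UU HC.
have UF : ProperFilter U by exact: ultra_proper.
have xU : U (x @^-1` `[- C, C]%classic).
  by apply: filterE => k; rewrite /= in_itv /= -ler_norml.
have [p [_ clp]] := @segment_compact R (- C) C (x @ U) _ xU.
apply/cvg_ex; exists p => V Vp.
have [//|UV] := in_ultra_setVsetC (x @^-1` V) UU.
by have [y [/= nVy Vy]] := clp (~` V) V UV Vp.
Qed.

Lemma sum_shift a n :
  \sum_(0 <= k < n) a k.+1 = \sum_(0 <= k < n) a k + (a n - a 0%N).
Proof.
elim: n => [|n IH]; first by rewrite !big_nil subrr addr0.
by rewrite !big_nat_recr //= IH; ring.
Qed.

(** The mean is the limit, along an ultrafilter finer than [\oo], of the averages over the first
    [N j] terms. A shift changes such an average by a boundary term of order [1 / N j], which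
    vanishes because [N j > j]. *)
Lemma exists_mean (N : nat -> nat) : (forall j, (j < N j)%N) ->
  exists L, mean N L.
Proof.
move=> HN.
have [U [UU oU]] := @ultraFilterLemma _ (\oo : set_system nat) _.
have UF : ProperFilter U by exact: ultra_proper.
pose ces a j : R := (\sum_(0 <= k < N j) a k) / (N j)%:R.
have N0 j : 0 < (N j)%:R :> R by rewrite ltr0n (leq_ltn_trans _ (HN j)).
have ces_bnd a C : (forall k, `|a k| <= C) -> forall j, `|ces a j| <= C.
  move=> HC j; rewrite /ces normrM normfV (gtr0_norm (N0 j)) ler_pdivrMr //.
  apply: le_trans (ler_norm_sum _ _ _) _.
  apply: le_trans (ler_sum _ (fun k _ => HC k)) _.
  by rewrite sumr_const_nat subn0 mulr_natr.
have ccvg a : bounded_seq a -> cvg (ces a @ U).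
  by move=> [C HC]; apply: bounded_cvg_ultra (ces_bnd _ _ HC).
have lim_bnd a l : (ces a @ U --> l) -> lim (ces a @ U) = l.
  by move=> h; apply: cvg_lim h.
have Nlim : (fun j => (N j)%:R^-1 : R) @ U --> (0 : R).
  apply: cvg_trans (_ : (fun j => (N j)%:R^-1 : R) @ \oo --> 0); first exact: cvg_app oU.
  apply: (@squeeze_cvgr _ _ _ _ (fun=> 0) (@harmonic R)).
  - apply: nearW => j; rewrite invr_ge0 ler0n /= /harmonic.
    by rewrite lef_pV2 ?posrE ?ler_nat.
  - exact: cvg_cst.
  - exact: cvg_harmonic.
exists (fun a => lim (ces a @ U)); split.
- move=> a b ba bb; apply: lim_bnd.
  rewrite (_ : ces _ = (fun j => ces a j + ces b j)); last first.
    by apply/funext => j; rewrite /ces big_split mulrDl.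
  by apply: cvgD; exact: ccvg.
- move=> c a ba; apply: lim_bnd.
  rewrite (_ : ces _ = (fun j => c * ces a j)); last first.
    by apply/funext => j; rewrite /ces -mulr_sumr mulrA.
  by apply: cvgMl_tmp; exact: ccvg.
- move=> a b ba bb ab; apply: ler_lim; [exact: ccvg|exact: ccvg|].
  apply: filterE => j; rewrite /ces ler_pM2r ?invr_gt0 //.
  exact: ler_sum.
- move=> c; apply: lim_bnd.
  rewrite (_ : ces _ = fun=> c); first exact: cvg_cst.
  apply/funext => j; rewrite /ces sumr_const_nat subn0 -[c *+ _]mulr_natr mulfK //.
  by rewrite gt_eqF.
- move=> a [C HC]; apply: lim_bnd.
  have e : ces (fun k => a k.+1) = fun j => ces a j + (a (N j) - a 0%N) / (N j)%:R.
    apply/funext => j; rewrite /ces -mulrDl; congr (_ / _).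
    by rewrite sum_shift.
  rewrite e -[lim (ces a @ U)]addr0; apply: cvgD; first by apply: ccvg; exists C.
  have bd k : `|a k - a 0%N| <= C + C.
    by apply: le_trans (ler_normB _ _) _; rewrite lerD.
  have C0 : (fun j => (C + C) * (N j)%:R^-1) @ U --> (0 : R).
    rewrite -[X in _ --> X](mulr0 (C + C)); exact: cvgMl_tmp Nlim.
  apply: (@squeeze_cvgr _ _ _ _ (fun j => - ((C + C) * (N j)%:R^-1))
      (fun j => (C + C) * (N j)%:R^-1)) => //.
    apply: filterE => j; rewrite -mulNr !ler_pM2r ?invr_gt0 // -ler_norml.
    exact: bd.
  by rewrite -oppr0; apply: cvgN.
- move=> a eta C ba H.
  have ec : (fun j => eta + C * (N j)%:R^-1) @ U --> eta.
    rewrite -[X in _ --> X]addr0 -(mulr0 C); apply: cvgD; first exact: cvg_cst.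
    exact: cvgMl_tmp Nlim.
  rewrite -(cvg_lim _ ec) //; apply: ler_lim; [exact: ccvg|by apply/cvg_ex; exists eta|].
  apply: filterE => j; rewrite /ces ler_pdivrMr // mulrDl -mulrA mulVf ?gt_eqF //.
  by rewrite mulr1.
Qed.

Lemma mean_sum N L (K : Type) (r : seq K) (P : pred K) (f : K -> nat -> R) :
  mean N L -> (forall k, P k -> bounded_seq (f k)) ->
  L (fun n => \sum_(k <- r | P k) f k n) = \sum_(k <- r | P k) L (f k).
Proof.
move=> mL Hf; elim: r => [|k r IH].
  by rewrite big_nil -[RHS](mean_cst mL); congr L; apply/funext => n; rewrite big_nil.
rewrite big_cons -IH; case: ifPn => Pk; last first.
  by congr L; apply/funext => n; rewrite big_cons (negbTE Pk).
rewrite -(meanD mL); [|exact: Hf|exact: bounded_seq_sum].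
by congr L; apply/funext => n; rewrite big_cons Pk.
Qed.

Lemma mean_addn N L a m : mean N L -> bounded_seq a ->
  L (fun n => a (n + m)%N) = L a.
Proof.
move=> mL ba; elim: m => [|m IH]; first by congr L; apply/funext => n; rewrite addn0.
rewrite -IH -[RHS](meanS mL); last by have [C HC] := ba; exists C.
by congr L; apply/funext => n; rewrite addSnnS.
Qed.

End Means.

Section Averaging.
Variables (R : realType) (Y : choiceType) (K : finType).
Variables (w : Y -> K -> R) (sh : K -> nat) (tgt : Y -> K -> Y) (D : set Y).
Hypothesis w_ge0 : forall y k, 0 <= w y k.
Hypothesis sh_le2 : forall k, (sh k <= 2)%N.

(** Exponential change of weights along the level: [sh k] codes the increments -1, 0, 1 as 0, 1, 2,
    so the increment is [sh k - 1]. *)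
Definition tilt (th : R) (y : Y) (k : K) : R :=
  w y k * expR (th * ((sh k)%:R - 1)).

(* [g] is the geometric mean over the levels [n] of [h n / h n y0]: by Jensen's
   inequality geometric means of superharmonic functions are superharmonic, and
   averaging over more and more levels makes the ratio of consecutive levels
   constant. *)
Lemma geometric_mean_superharmonic (h : nat -> Y -> R) (th eta C : R) (y0 : Y) :
  D y0 -> (forall n y, D y -> 0 < h n y) ->
  (forall n y, D y ->
     \sum_(k | tgt y k \in D) w y k * h (n + sh k)%N (tgt y k) <= h n.+1 y) ->
  (forall y y', D y -> D y' -> exists c, forall n, h n y' <= c * h n y) ->
  (exists c, forall n, h n.+1 y0 <= c * h n y0) ->
  (forall n, expR th * h n y0 <= h n.+1 y0) ->
  (forall n, exists2 m, (n < m)%N & h m y0 <= C * expR (eta * m%:R)) ->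
  exists th' g, [/\ th <= th', th' <= eta,
    superharmonic (tilt th') tgt D 1 g &
    forall y y' c, D y -> D y' -> 0 < c ->
      (forall n, c * h n y <= h n y') -> c * g y <= g y'].
Proof.
move=> Dy0 h0 super harn [cs step] mono freq.
have [N HN] := choice (fun j => let: ex_intro2 m jm hm := freq j in
  ex_intro (fun m => (j < m)%N /\ h m y0 <= C * expR (eta * m%:R)) m (conj jm hm)).
have [L mL] := exists_mean R (fun j => (HN j).1).
have h00 n : 0 < h n y0 by exact: h0.
have cs0 : 0 < cs.
  by rewrite -(pmulr_lgt0 _ (h00 0%N)); apply: lt_le_trans (step 0%N).
pose del n := ln (h n.+1 y0) - ln (h n y0).
pose psi y n := ln (h n y) - ln (h n y0).
have del_ge n : th <= del n.
  rewrite /del lerBrDr -[X in X + _]expRK -lnM ?posrE ?expR_gt0 //.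
  by rewrite ler_ln ?posrE ?mulr_gt0 ?expR_gt0.
have bdel : bounded_seq del.
  have del_le n : del n <= ln cs.
    by rewrite /del lerBlDr -lnM ?posrE // ler_ln ?posrE ?mulr_gt0.
  exists (`|th| + `|ln cs|) => n; rewrite ler_norml.
  have := ler_norm (- th); have := ler_norm (ln cs); rewrite normrN.
  have := normr_ge0 th; have := normr_ge0 (ln cs).
  by have := del_ge n; have := del_le n; lra.
have bpsi y : D y -> bounded_seq (psi y).
  move=> Dy; have [c Hc] := harn _ _ Dy0 Dy; have [c' Hc'] := harn _ _ Dy Dy0.
  have c0 : 0 < c.
    by rewrite -(pmulr_lgt0 _ (h00 0%N)); apply: lt_le_trans (Hc 0%N); exact: h0.
  have c'0 : 0 < c'.
    by rewrite -(pmulr_lgt0 _ (h0 0%N _ Dy)); apply: lt_le_trans (Hc' 0%N); exact: h0.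
  exists (`|ln c| + `|ln c'|) => n; rewrite ler_norml.
  have : psi y n <= ln c.
    by rewrite /psi lerBlDr -lnM ?posrE // ler_ln ?posrE ?mulr_gt0 ?h0.
  have : - ln c' <= psi y n.
    rewrite /psi lerBrDr addrC lerBlDr addrC -lnM ?posrE ?h0 //.
    by rewrite ler_ln ?posrE ?mulr_gt0 ?h0.
  have := ler_norm (ln c); have := ler_norm (ln c').
  by have := normr_ge0 (ln c); have := normr_ge0 (ln c'); lra.
pose th' := L del; pose g y := expR (L (psi y)).
exists th', g; split.
- by rewrite -(mean_cst mL th); apply: (le_mean mL) => //; exact: bounded_seq_cst.
(* The increments [del] telescope, so their sum up to [N j] only involves [h (N j) y0], which the
   choice of [N] bounds. *)
- apply: (mean_le_freq mL (C := ln C - ln (h 0%N y0))) => // j.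
  have C0 : 0 < C.
    rewrite -(pmulr_lgt0 _ (expR_gt0 (eta * (N j)%:R))).
    by apply: lt_le_trans (HN j).2.
  rewrite /del telescope_sumr // addrA lerB // addrC.
  rewrite -[X in _ + X]expRK -lnM ?posrE ?expR_gt0 //.
  by rewrite ler_ln ?posrE ?mulr_gt0 ?expR_gt0 // (HN j).2.
- split=> y Dy; first exact: expR_gt0.
  rewrite mul1r.
  (* The superharmonic inequality is centred at level [n.+1]. The term [del' s] corrects the
     reference value at [y0] from level [n + s] to that level, and its mean is [th'] times the
     increment [s - 1]. *)
  pose del' s n := ln (h (n + s)%N y0) - ln (h n.+1 y0).
  have del'P s : (s <= 2)%N -> bounded_seq (del' s) /\ L (del' s) = th' * (s%:R - 1).
    case: s => [|[|[|//]]] _.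
    + rewrite (_ : del' 0%N = fun n => - 1 * del n); last first.
        by apply/funext => n; rewrite /del' /del addn0; lra.
      by rewrite (meanZ mL) //; split; [exact: bounded_seqZ|rewrite -/th'; lra].
    + rewrite (_ : del' 1%N = fun=> 0); last first.
        by apply/funext => n; rewrite /del' addn1 subrr.
      by rewrite (mean_cst mL) subrr mulr0; split => //; exact: bounded_seq_cst.
    + rewrite (_ : del' 2 = fun n => del n.+1); last first.
        by apply/funext => n; rewrite /del' /del addn2.
      by rewrite (meanS mL) //; split; [exact: bounded_seqS|rewrite -/th'; lra].
  pose a k n := ln (h (n + sh k)%N (tgt y k)) - ln (h n.+1 y).
  have aP k : D (tgt y k) -> bounded_seq (a k) /\
      L (a k) = L (psi (tgt y k)) + th' * ((sh k)%:R - 1) - L (psi y).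
    move=> Dk; have [b1 e1] := del'P _ (sh_le2 k).
    have b2 : bounded_seq (fun n => psi (tgt y k) (n + sh k)%N).
      by have [c Hc] := bpsi _ Dk; exists c.
    have b3 : bounded_seq (fun n => -1 * psi y n.+1).
      by apply/bounded_seqZ/bounded_seqS/bpsi.
    have -> : a k = fun n => (psi (tgt y k) (n + sh k)%N + del' (sh k) n) + -1 * psi y n.+1.
      by apply/funext => n; rewrite /a /psi /del'; lra.
    split; first by do 2 apply: bounded_seqD => //.
    rewrite (meanD mL (bounded_seqD b2 b1) b3) (meanD mL b2 b1).
    rewrite (meanZ mL); last exact/bounded_seqS/bpsi.
    rewrite e1 (mean_addn _ mL) ?(meanS mL) //; [by lra|exact: bpsi|exact: bpsi].
  have key : \sum_(k | tgt y k \in D) w y k * expR (L (a k)) <= 1.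
    (* Jensen's inequality through tangents, which needs no countable additivity of [L]: [f k n] is
       the tangent of the exponential at [L (a k)], evaluated at [a k n]. It lies below the
       exponential, and its mean is the value at the point of contact. *)
    pose f k n := w y k * expR (L (a k)) * (1 - L (a k) + a k n).
    have bf0 k : D (tgt y k) -> bounded_seq (fun n => 1 - L (a k) + a k n).
      by move=> Dk; apply: bounded_seqD; [exact: bounded_seq_cst|exact: (aP k Dk).1].
    have bf k : tgt y k \in D -> bounded_seq (f k).
      by move=> /set_mem Dk; apply: bounded_seqZ; exact: bf0.
    have <- : L (fun n => \sum_(k | tgt y k \in D) f k n) =
              \sum_(k | tgt y k \in D) w y k * expR (L (a k)).
      rewrite (mean_sum _ mL) //; apply: eq_bigr => k Dk.
      rewrite (meanZ mL); last exact/bf0/set_mem.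
      rewrite (meanD mL (bounded_seq_cst (1 - L (a k))) (aP k (set_mem Dk)).1).
      by rewrite (mean_cst mL) subrK mulr1.
    rewrite -(mean_cst mL 1); apply: (le_mean mL) => [||n].
    + exact: bounded_seq_sum.
    + exact: bounded_seq_cst.
    apply: (@le_trans _ _ (\sum_(k | tgt y k \in D)
        w y k * h (n + sh k)%N (tgt y k) / h n.+1 y)).
      apply: ler_sum => k /set_mem Dk; rewrite /f -!mulrA; apply: ler_wpM2l => //.
      rewrite -[h _ (tgt y k)]lnK ?posrE ?h0 // -[(h n.+1 y)^-1]lnK ?posrE ?invr_gt0 ?h0 //.
      rewrite lnV ?posrE ?h0 // -expRD -/(a k n).
      rewrite -[X in _ <= expR X](subrK (L (a k))) addrC expRD.
      rewrite [leRHS]mulrC ler_wpM2l ?expR_ge0 //.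
      by apply: le_trans (expR_ge1Dx _); lra.
    by rewrite -mulr_suml ler_pdivrMr ?h0 // mul1r super.
  rewrite /g -[leRHS]mul1r -ler_pdivrMr ?expR_gt0 //; apply: le_trans key.
  rewrite /kop mulr_suml; apply: ler_sum => k /set_mem Dk.
  rewrite /tilt -!mulrA -expRN -!expRD (aP k Dk).2.
  by apply: ler_wpM2l => //; rewrite ler_expR; lra.
- move=> y y' c Dy Dy' c0 H.
  rewrite /g -[c]lnK ?posrE // -expRD ler_expR -(mean_cst mL (ln c)).
  rewrite -(meanD mL (bounded_seq_cst (ln c)) (bpsi _ Dy)).
  apply: (le_mean mL); [|exact: bpsi|].
    by apply: bounded_seqD; [exact: bounded_seq_cst|exact: bpsi].
  move=> n; rewrite /psi addrA lerD2r -lnM ?posrE ?h0 //.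
  by rewrite ler_ln ?posrE ?mulr_gt0 ?h0.
Qed.

End Averaging.

(** Supplies the last hypothesis of [geometric_mean_superharmonic], with [eta := ln c], where no
    upper bound on the resulting exponent is wanted. *)
Lemma geometric_growth (R : realType) (h : nat -> R) (c : R) : 0 < c ->
  (forall n, h n.+1 <= c * h n) ->
  forall n, exists2 m, (n < m)%N & h m <= h 0%N * expR (ln c * m%:R).
Proof.
move=> c0 step n; exists n.+1 => //.
elim: n.+1 => [|m IH]; first by rewrite mulr0 expR0 mulr1.
apply: le_trans (step m) _; rewrite -natr1 mulrDr mulr1 expRD lnK ?posrE //.
by rewrite mulrA [leRHS]mulrC ler_wpM2l // ltW.
Qed.

(** * The kernels of the quasi-birth-and-death process *)

(* ['I_3] codes the increments -1, 0, 1. *)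
Definition dv (i : 'I_3) : int := (i : nat)%:Z - 1.

Lemma dv_steps i : dv i \in steps.
Proof. by case: i => [[|[|[|//]]]]. Qed.

Lemma stepsP d : reflect (exists i, d = dv i) (d \in steps).
Proof.
apply: (iffP idP) => [|[i ->]]; last exact: dv_steps.
rewrite !inE => /or3P[] /eqP ->.
- by exists (inord 0); rewrite /dv inordK.
- by exists (inord 1); rewrite /dv inordK.
- by exists (inord 2); rewrite /dv inordK.
Qed.

Lemma dv_inj : injective dv.
Proof. by move=> i j; rewrite /dv => h; apply: val_inj => /=; lia. Qed.

Lemma sum_steps (V : nmodType) (F : int -> V) :
  \sum_(i <- steps) F i = \sum_(i < 3) F (dv i).
Proof. by rewrite !big_cons big_nil !big_ord_recl big_ord0. Qed.

Section QBDKernels.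
Variables (R : realType) (s0 : nat) (A : face -> int -> int -> 'M[R]_s0).

Definition branch : finType := ('I_3 * 'I_3 * 'I_s0)%type.
Definition state := ((int * int) * 'I_s0)%type.

Definition qbd_w (u : state) (k : branch) : R :=
  A (face_of u.1) (dv k.1.1) (dv k.1.2) u.2 k.2.
Definition qbd_tgt (u : state) (k : branch) : state :=
  ((u.1.1 + dv k.1.1, u.1.2 + dv k.1.2), k.2).

Definition sh1 (k : branch) : nat := k.1.1.
Definition sh2 (k : branch) : nat := k.1.2.

Definition face1 (x : int) : face := if x == 0 then F1 else F12.
(** The half-plane kernel modulo translations along the first axis: the horizontal increment no
    longer moves the state and survives only in [sh1], through which [tilt] weighs it. *)
Definition level_w (u : int * 'I_s0) (k : branch) : R :=
  A (face1 u.1) (dv k.1.1) (dv k.1.2) u.2 k.2.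
Definition level_tgt (u : int * 'I_s0) (k : branch) : int * 'I_s0 :=
  (u.1 + dv k.1.2, k.2).

Definition phase_w (l : 'I_s0) (k : branch) : R := A F12 (dv k.1.1) (dv k.1.2) l k.2.
Definition phase_tgt (l : 'I_s0) (k : branch) : 'I_s0 := k.2.

(* A rate [rho < 1] means that [cp > 1], i.e. that [th] is in [Gamma1]; the rate 1
   is what averaging a potential produces. *)
Definition SH1 (th rho : R) : Prop :=
  exists g, superharmonic (tilt level_w sh1 th) level_tgt (fibers s0 Zplus) rho g.
Definition SH12 (th1 th2 rho : R) : Prop :=
  exists g, superharmonic (tilt (tilt phase_w sh2 th2) sh1 th1) phase_tgt setT rho g.

Definition expo (th1 th2 : R) (u : state) : R :=
  expR (th1 * u.1.1%:~R + th2 * u.1.2%:~R).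

Definition occ_fin (th1 th2 : R) : Prop :=
  psummable qbd_w qbd_tgt (fibers s0 ZpxZp0) (expo th1 th2).
Definition occ_fin1 (th : R) : Prop :=
  psummable qbd_w qbd_tgt (fibers s0 ZpxZp0) (fun u => if u.1.2 == 0 then expo th 0 u else 0).
Definition occ_fin2 (th : R) : Prop :=
  psummable qbd_w qbd_tgt (fibers s0 ZpxZp0) (fun u => if u.1.1 == 0 then expo 0 th u else 0).

Hypothesis hA : qbd_blocks A.

Lemma A_ge0 al (i j : 'I_3) l m : 0 <= A al (dv i) (dv j) l m.
Proof. by apply: hA.1; exact: dv_steps. Qed.

Lemma qbd_w_ge0 u k : 0 <= qbd_w u k. Proof. exact: A_ge0. Qed.
Lemma level_w_ge0 u k : 0 <= level_w u k. Proof. exact: A_ge0. Qed.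
Lemma phase_w_ge0 u k : 0 <= phase_w u k. Proof. exact: A_ge0. Qed.

Lemma sh1_le2 k : (sh1 k <= 2)%N. Proof. exact: (ltn_ord k.1.1). Qed.
Lemma sh2_le2 k : (sh2 k <= 2)%N. Proof. exact: (ltn_ord k.1.2). Qed.

Lemma tilt_ge0 (Y : choiceType) (w : Y -> branch -> R) sh th :
  (forall y k, 0 <= w y k) -> forall y k, 0 <= tilt w sh th y k.
Proof. by move=> w0 y k; rewrite /tilt mulr_ge0 ?expR_ge0. Qed.

Lemma sum_branch_qt (u v : state) (F : int -> int -> 'I_s0 -> R) :
  \sum_(k : branch | qbd_tgt u k == v) F (dv k.1.1) (dv k.1.2) k.2 =
  let d := v.1 - u.1 in
  if (d.1 \in steps) && (d.2 \in steps) then F d.1 d.2 v.2 else 0.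
Proof.
case: u v => [[x1 x2] l] [[y1 y2] m] /=.
case: ifPn => [/andP[/stepsP[i ei] /stepsP[j ej]]|H].
  rewrite (big_pred1 (i, j, m)) => [|[[i' j'] m']]; first by rewrite /= -ei -ej.
  apply/eqP/eqP => [[h1 h2 ->]|[-> -> ->]]; last first.
    by rewrite /qbd_tgt /= -ei -ej; congr (_, _, _); lia.
  by congr (_, _, _); apply: dv_inj; lia.
rewrite big_pred0 // => [[[i j] l']]; apply/eqP => -[h1 h2 _]; move/negP: H; apply.
rewrite -h1 -h2 /= (_ : x1 + dv i - x1 = dv i); last by lia.
by rewrite (_ : x2 + dv j - x2 = dv j) ?dv_steps //; lia.
Qed.

Lemma Tqbd_kernel D u : row_kernel qbd_w qbd_tgt (fibers s0 D) (flat (Tqbd A)) u.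
Proof.
move=> v _; rewrite /flat /Tqbd.
rewrite [RHS](sum_branch_qt u v (fun i j l => A (face_of u.1) i j u.2 l)) /=.
by case: ifP => //; rewrite mxE.
Qed.

Lemma T1_kernel u : fibers s0 NxZp u ->
  row_kernel qbd_w qbd_tgt (fibers s0 NxZp) (flat (T1 A)) u.
Proof.
move=> [/= u1 u2] v _; rewrite /flat /T1.
rewrite [RHS](sum_branch_qt u v (fun i j l => A (face_of u.1) i j u.2 l)) /=.
rewrite /face_of (gt_eqF u1) /=; case: (u.1.2 == 0); last by case: ifP => //; rewrite mxE.
have [d1|_] /= := boolP ((v.1.1 - u.1.1) \in steps); last by rewrite mxE.
(* [T1] lists no downward step from the axis, whereas the kernel keeps that branch; its weight
   vanishes by [qbd_blocks]. *)
rewrite !inE; have [->|] /= := eqVneq (v.1.2 - u.1.2) (-1); last by case: ifP => //; rewrite mxE.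
have [_ [_ _ h _]] := hA.
by rewrite h ?mxE.
Qed.

Lemma T2_kernel u : fibers s0 ZpxN u ->
  row_kernel qbd_w qbd_tgt (fibers s0 ZpxN) (flat (T2 A)) u.
Proof.
move=> [/= u1 u2] v _; rewrite /flat /T2.
rewrite [RHS](sum_branch_qt u v (fun i j l => A (face_of u.1) i j u.2 l)) /=.
rewrite /face_of (gt_eqF u2); case: (u.1.1 == 0); last by case: ifP => //; rewrite mxE.
have [d2|_] /= := boolP ((v.1.2 - u.1.2) \in steps); last by rewrite !andbF mxE.
rewrite !inE !andbT; have [->|] /= := eqVneq (v.1.1 - u.1.1) (-1); last by case: ifP => //; rewrite mxE.
have [_ [_ _ _ h]] := hA.
by rewrite h ?mxE.
Qed.

Lemma T12_kernel u : fibers s0 NxN u ->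
  row_kernel qbd_w qbd_tgt (fibers s0 NxN) (flat (T12 A)) u.
Proof.
move=> [/= u1 u2] v _; rewrite /flat /T12.
rewrite [RHS](sum_branch_qt u v (fun i j l => A (face_of u.1) i j u.2 l)) /=.
rewrite /face_of (gt_eqF u2) (gt_eqF u1).
by case: ifP => //; rewrite mxE.
Qed.

Lemma expR_exprz (th : R) (i : 'I_3) :
  expR th ^ (dv i) = expR (th * (i%:R - 1)).
Proof.
case: i => -[|[|[|i]]] hi //; rewrite /dv /=.
- by rewrite sub0r sub0r mulrN1 expRN -exprN1.
- by rewrite (_ : 1%:Z - 1 = 0) // expr0z (_ : 1%:R - 1 = 0 :> R) ?mulr0 ?expR0 //; lra.
- by rewrite (_ : 2%:Z - 1 = 1) // expr1z (_ : 2%:R - 1 = 1 :> R) ?mulr1 //; lra.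
Qed.

Lemma sum_branch (F : 'I_3 -> 'I_3 -> 'I_s0 -> R) (P : pred branch) :
  \sum_(k : branch | P k) F k.1.1 k.1.2 k.2 =
  \sum_i \sum_j \sum_(l | P (i, j, l)) F i j l.
Proof.
rewrite pair_bigA /= (eq_bigr (fun p : 'I_3 * 'I_3 =>
  \sum_l if P (p, l) then F p.1 p.2 l else 0)) => [|[i j] _]; last first.
  by rewrite big_mkcond.
by rewrite pair_bigA /= big_mkcond; apply: eq_bigr => -[[i j] l] _.
Qed.

Lemma barA1_kernel th u : row_kernel (tilt level_w sh1 th) level_tgt (fibers s0 Zplus)
  (flat (barA1_star A (expR th))) u.
Proof.
move=> v _; rewrite /flat /barA1_star summxE sum_steps.
rewrite [RHS](sum_branch (fun i j l => A (face1 u.1) (dv i) (dv j) u.2 l *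
  expR (th * (i%:R - 1)))); apply: eq_bigr => i _.
rewrite !mxE expR_exprz mulrC.
transitivity (\sum_j if u.1 + dv j == v.1 then
    A (face1 u.1) (dv i) (dv j) u.2 v.2 * expR (th * (i%:R - 1)) else 0); last first.
  apply: eq_bigr => j _; rewrite /level_tgt /=.
  case: eqP => e.
    rewrite (big_pred1 v.2) // => l /=.
    by rewrite [v in LHS]surjective_pairing xpair_eqE e eqxx.
  rewrite big_pred0 // => l; apply/eqP => h; apply: e.
  by rewrite -h.
rewrite -big_mkcond /=.
have [/stepsP[j ej]|d] := boolP (v.1 - u.1 \in steps); last first.
  rewrite big_pred0; last first.
    move=> j; apply/eqP => e; move/negP: d; apply.
    by rewrite -e addrAC subrr add0r dv_steps.
  rewrite /barA1; case: ifP; last by rewrite (negbTE d) mxE mul0r.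
  case: ifP; last by rewrite mxE mul0r.
  by move=> h; move: d; rewrite !inE in h *; rewrite h orbT.
rewrite (big_pred1 j); last first.
  move=> j' /=; apply/eqP/eqP => [e|->]; last by rewrite -ej addrC subrK.
  by apply: dv_inj; rewrite -ej -e addrAC subrr add0r.
congr (_ * _); rewrite /barA1 /face1 ej dv_steps; case: ifP => // _.
case: ifP => // h.
have := dv_steps j; rewrite !inE in h *; rewrite h orbF => /eqP ->.
have [_ [_ _ h' _]] := hA.
by rewrite h' ?mxE // dv_steps.
Qed.

Lemma A12_kernel th1 th2 l :
  row_kernel (tilt (tilt phase_w sh2 th2) sh1 th1) phase_tgt setT
    (fun j k => A12_star A (expR th1) (expR th2) j k) l.
Proof.
move=> m _; rewrite /A12_star summxE sum_steps.
rewrite [RHS](sum_branch (fun i j m => A F12 (dv i) (dv j) l m *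
  expR (th2 * (j%:R - 1)) * expR (th1 * (i%:R - 1)))); apply: eq_bigr => i _.
rewrite summxE sum_steps; apply: eq_bigr => j _.
rewrite (big_pred1 m) => [|k]; last by rewrite /phase_tgt.
by rewrite !mxE !expR_exprz; ring.
Qed.

End QBDKernels.

(** * Convexity, translations and last entries *)

Lemma expR_convex (R : realType) (s a b : R) : 0 <= s <= 1 ->
  expR ((1 - s) * a + s * b) <= (1 - s) * expR a + s * expR b.
Proof.
have tangent m x : expR m * (1 + (x - m)) <= expR x.
  rewrite -[X in _ <= expR X](subrK m) [X in _ <= expR X]addrC expRD.
  by rewrite ler_wpM2l ?expR_ge0 // expR_ge1Dx.
move=> /andP[s0 s1]; set m := _ + _.
apply: (@le_trans _ _ ((1 - s) * (expR m * (1 + (a - m))) + s * (expR m * (1 + (b - m))))).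
  by rewrite /m; lra.
by apply: lerD; apply: ler_wpM2l; rewrite ?subr_ge0 ?tangent.
Qed.

Lemma finite_lower_bound (R : realType) (T : finType) (g : T -> R) :
  (forall l, 0 < g l) -> exists2 m, 0 < m & forall l, m <= g l.
Proof.
move=> g0; have S0 : 0 <= \sum_l (g l)^-1.
  by apply: sumr_ge0 => l _; rewrite invr_ge0 ltW.
(* The reciprocal of a sum of reciprocals lies below every [g l]; the summand 1 keeps it positive
   when the type is empty. *)
exists (1 + \sum_l (g l)^-1)^-1; first by rewrite invr_gt0; lra.
move=> l; rewrite invf_ple ?posrE //; last by lra.
rewrite (bigD1 l) //= addrCA lerDl addr_ge0 //.
by apply: sumr_ge0 => j _; rewrite invr_ge0 ltW.
Qed.

Section KernelMore.
Variables (R : realType) (I : choiceType) (K : finType).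
Variables (w : I -> K -> R) (tgt : I -> K -> I).
Hypothesis w_ge0 : forall x k, 0 <= w x k.

Lemma superharmonic_le D rho rho' h : rho <= rho' ->
  superharmonic w tgt D rho h -> superharmonic w tgt D rho' h.
Proof.
move=> rr [h0 hh]; split=> // x Dx; apply: le_trans (hh x Dx) _.
by rewrite ler_wpM2r // ltW // h0.
Qed.

(** After division by the values at [x] each branch contributes an exponential, and convexity of
    [expR] applies branch by branch. The rate comes out as the arithmetic mean of the two rates. *)
Lemma superharmonic_convex D (e0 e1 : I -> K -> R) s r0 r1 g0 g1 : 0 <= s <= 1 ->
  superharmonic (fun x k => w x k * expR (e0 x k)) tgt D r0 g0 ->
  superharmonic (fun x k => w x k * expR (e1 x k)) tgt D r1 g1 ->
  superharmonic (fun x k => w x k * expR ((1 - s) * e0 x k + s * e1 x k)) tgt D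
    ((1 - s) * r0 + s * r1) (fun x => expR ((1 - s) * ln (g0 x) + s * ln (g1 x))).
Proof.
move=> s01 [p0 h0] [p1 h1]; split=> x Dx; first exact: expR_gt0.
rewrite -ler_pdivrMr ?expR_gt0 //.
have s0 : 0 <= s by case/andP: s01.
have s1 : 0 <= 1 - s by case/andP: s01; lra.
apply: (@le_trans _ _ ((1 - s) * (kop (fun x k => w x k * expR (e0 x k)) tgt D g0 x / g0 x) +
   s * (kop (fun x k => w x k * expR (e1 x k)) tgt D g1 x / g1 x))); last first.
  by rewrite lerD // ler_wpM2l // ler_pdivrMr ?p0 ?p1 // ?h0 ?h1.
rewrite /kop !mulr_suml !mulr_sumr -big_split /=; apply: ler_sum => k /set_mem Dk.
have e a g : (forall x, D x -> 0 < g x) ->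
    w x k * expR a * g (tgt x k) / g x = w x k * expR (a + ln (g (tgt x k)) - ln (g x)).
  by move=> g0'; rewrite !expRD expRN !lnK ?posrE ?g0' // !mulrA.
rewrite !e // -!mulrA -expRN -!expRD [X in _ <= X + _]mulrCA [X in _ <= _ + X]mulrCA -mulrDr.
apply: ler_wpM2l => //; apply: le_trans (expR_convex _ _ s01).
by rewrite ler_expR; lra.
Qed.

Definition translation (D : set I) (S : I -> I) : Prop :=
  forall x, D x -> [/\ D (S x), forall k, w (S x) k = w x k &
                       forall k, tgt (S x) k = S (tgt x k)].

(** Only an inequality holds: [S] maps [D] into itself but not onto, so a branch killed at [x] may
    survive at [S x]. *)
Lemma kop_translation D S f x : translation D S -> (forall y, D y -> 0 <= f y) ->
  D x -> kop w tgt D (fun y => f (S y)) x <= kop w tgt D f (S x).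
Proof.
move=> tS f0 Dx; have [DSx wS tgtS] := tS x Dx.
rewrite /kop !(big_mkcond (fun k => _ \in D)) /=; apply: ler_sum => k _.
case: ifPn => [/set_mem Dk|_].
  by have [DS _ _] := tS _ Dk; rewrite tgtS mem_set // wS.
by case: ifPn => // /set_mem Dk; rewrite mulr_ge0 ?f0.
Qed.

Lemma kpsum_translation D S f z n x : translation D S -> (forall y, D y -> 0 <= f y) ->
  0 <= z -> (forall y, D y -> z * f y <= f (S y)) -> D x ->
  z * kpsum w tgt D n f x <= kpsum w tgt D n f (S x).
Proof.
move=> tS f0 z0 fS; elim: n x => [|n IH] x Dx /=; first by rewrite mulr0.
rewrite mulrDr lerD ?fS // -kopZ.
apply: le_trans (kop_translation tS _ Dx); last first.
  by move=> y Dy; exact: kpsum_ge0.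
by apply: le_kop => // y; exact: IH.
Qed.

Lemma pot_translation D S f z x : translation D S -> (forall y, D y -> 0 <= f y) ->
  psummable w tgt D f ->
  0 <= z -> (forall y, D y -> z * f y <= f (S y)) -> D x ->
  z * pot w tgt D f x <= pot w tgt D f (S x).
Proof.
move=> tS f0 sf z0 fS Dx; have [DSx _ _] := tS x Dx.
rewrite le_eqVlt in z0; case/predU1P: z0 => [<-|z0].
  by rewrite mul0r pot_ge0.
rewrite -ler_pdivlMl //; apply: le_pot => // n; rewrite ler_pdivlMl //.
apply: le_trans (kpsum_translation n tS f0 (ltW z0) fS Dx) _.
exact: kpsum_le_pot.
Qed.

(** By [kop_translation] the composite of [h] with [S] is again superharmonic, so the constant of
    the path from [x] to [y] serves every translate. *)
Lemma translation_Harnack D x y : reach w tgt D x y -> D x ->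
  exists2 c, 0 < c & forall h, (forall z, D z -> 0 <= h z) ->
    (forall z, D z -> kop w tgt D h z <= h z) ->
    forall S, translation D S -> c * h (S y) <= h (S x).
Proof.
move=> rxy Dx; have [c c0 Hc] := reach_Harnack w_ge0 rxy Dx.
exists c => // h h0 hh S tS; apply: (Hc (fun z => h (S z))) => z Dz.
  by have [DS _ _] := tS z Dz; exact: h0.
by have [DS _ _] := tS z Dz; apply: le_trans (kop_translation tS h0 Dz) (hh _ DS).
Qed.

Lemma cvg_kpsum D n (f : nat -> I -> R) g x : D x ->
  (forall y, D y -> f m y @[m --> \oo] --> g y) ->
  kpsum w tgt D n (f m) x @[m --> \oo] --> kpsum w tgt D n g x.
Proof.
move=> + fg; elim: n x => [|n IH] x Dx /=; first exact: cvg_cst.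
apply: cvgD; first exact: fg.
apply: cvg_big => [|k /set_mem Dk]; first exact: add_continuous.
by apply: cvgMl_tmp; exact: IH.
Qed.

(* Decompose paths in [D] at their last entry into [D']. *)
Lemma psummable_entry D D' f : D' `<=` D -> (forall y, D y -> 0 <= f y) ->
  psummable w tgt D f ->
  psummable w tgt D (fun x => if x \in D' then 0 else kop w tgt D' (pot w tgt D' f) x).
Proof.
move=> DD' f0 sf; have f0' y : D' y -> 0 <= f y by move/DD'; exact: f0.
have sf' : psummable w tgt D' f by exact: psummable_sub sf.
pose ent N x := if x \in D' then 0 else kop w tgt D' (kpsum w tgt D' N f) x.
pose ext N x := if x \in D' then kpsum w tgt D' N f x else 0.
have ps0 N y : D' y -> 0 <= kpsum w tgt D' N f y by exact: kpsum_ge0.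
have opext N x : kop w tgt D' (kpsum w tgt D' N f) x = kop w tgt D (ext N) x.
  rewrite /kop !(big_mkcond (fun k => _ \in _)) /=; apply: eq_bigr => k _.
  rewrite /ext; case: ifPn => [/set_mem D'k|_]; last by rewrite mulr0; case: ifP.
  by rewrite mem_set //; exact: DD'.
(* Finite version, with at most [N] steps counted after the entry. [ent N] accounts for paths
   entering [D'] later, [ext] for those that stay in [D'] from the start; keeping the second term
   lets the induction on [M] close. Then [N] tends to infinity. *)
have key N M x : D x -> kpsum w tgt D M (ent N) x + ext N.+1 x <= kpsum w tgt D (N.+1 + M) f x.
  elim: M x => [|M IH] x Dx.
    rewrite [kpsum _ _ _ 0 _ _]/= add0r addn0 /ext; case: ifPn => [/set_mem D'x|_].
      exact: le_kpsum_sub.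
    exact: kpsum_ge0.
  rewrite addnS /=.
  apply: (@le_trans _ _ (f x + kop w tgt D (ext N.+1) x + kop w tgt D (kpsum w tgt D M (ent N)) x)).
    rewrite addrAC lerD2r.
    apply: (@le_trans _ _ (f x + kop w tgt D' (kpsum w tgt D' N f) x)).
      by rewrite /ent /ext; case: ifP => _ /=; rewrite ?add0r // addr0 lerDr f0.
    rewrite lerD2l -opext; apply: le_kop => // y Dy.
    exact: kpsum_mono.
  rewrite -addrA lerD2l -kopD; apply: le_kop => // y Dy.
  by rewrite addrC; exact: IH.
move=> x Dx; have [C HC] := sf x Dx; exists C => M.
have cv : kpsum w tgt D M (ent N) x @[N --> \oo] --> kpsum w tgt D M
    (fun x => if x \in D' then 0 else kop w tgt D' (pot w tgt D' f) x) x.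
  apply: cvg_kpsum => // y Dy; rewrite /ent; case: ifP => _; first exact: cvg_cst.
  apply: cvg_big => [|k /set_mem Dk]; first exact: add_continuous.
  by apply: cvgMl_tmp; exact: cvg_kpsum_pot.
rewrite -(cvg_lim _ cv) //; apply: limr_le; first by apply/cvg_ex; eexists; exact: cv.
apply: nearW => N; apply: le_trans (HC (N.+1 + M)%N); apply: le_trans (key N M x Dx).
by rewrite lerDl /ext; case: ifPn => // /set_mem; exact: kpsum_ge0.
Qed.

End KernelMore.

(** * Convergence domains *)

Section Domains.
Variables (R : realType) (s0 : nat) (A : face -> int -> int -> 'M[R]_s0).
Hypothesis hA : qbd_blocks A.

Local Notation DD := (fibers s0 ZpxZp0).
Local Notation D1 := (fibers s0 NxZp).
Local Notation D2 := (fibers s0 ZpxN).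
Local Notation D12 := (fibers s0 NxN).
Local Notation D := (fibers s0).
Local Notation qbd_w := (qbd_w A).
Local Notation qbd_tgt := (@qbd_tgt s0).
Let qw0 := qbd_w_ge0 hA.

Lemma NxZp_sub : D NxZp `<=` DD.
Proof.
move=> [[x1 x2] l] [/= h1 h2]; split; first by split => //=; exact: ltW.
by move=> -[e _]; rewrite e ltxx in h1.
Qed.

Lemma NxN_sub : D NxN `<=` DD.
Proof. by move=> u [/= h1 h2]; apply: NxZp_sub; split => //; exact: ltW. Qed.

Lemma DDP (u : state s0) : DD u <-> [/\ 0 <= u.1.1, 0 <= u.1.2 & (u.1.1 != 0) || (u.1.2 != 0)].
Proof.
case: u => [[x1 x2] l]; split=> [[[/= h1 h2] h]|[/= h1 h2 h]].
  split => //; rewrite -negb_and; apply/negP => /andP[/eqP e1 /eqP e2]; apply: h.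
  by rewrite /= e1 e2.
by split=> //= -[e1 e2]; rewrite e1 e2 !eqxx in h.
Qed.

Lemma expo_gt0 th1 th2 u : 0 < @expo R s0 th1 th2 u.
Proof. exact: expR_gt0. Qed.

Lemma expo_ge0 th1 th2 u : 0 <= @expo R s0 th1 th2 u.
Proof. exact: expR_ge0. Qed.

Lemma dvE (i : 'I_3) : (dv i)%:~R = i%:R - 1 :> R.
Proof. by rewrite /dv rmorphB. Qed.

Lemma expo_qbd_tgt (th1 th2 : R) (u : state s0) k : expo th1 th2 (qbd_tgt u k) =
  expo th1 th2 u * (expR (th1 * ((sh1 k)%:R - 1)) * expR (th2 * ((sh2 k)%:R - 1))).
Proof. by rewrite /expo /= -!expRD !(intrD _ _ (dv _)) !dvE; congr expR; rewrite /sh1 /sh2; ring. Qed.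

Definition translate (a1 a2 : nat) (u : state s0) : state s0 :=
  ((u.1.1 + a1%:Z, u.1.2 + a2%:Z), u.2).

Lemma expo_translate (th1 th2 : R) a1 a2 (u : state s0) :
  expo th1 th2 (translate a1 a2 u) = expR (th1 * a1%:R + th2 * a2%:R) * expo th1 th2 u.
Proof. by rewrite /expo /= -!expRD !intrD; congr expR; ring. Qed.

Lemma translate_qbd_tgt a1 a2 u k : qbd_tgt (translate a1 a2 u) k = translate a1 a2 (qbd_tgt u k).
Proof. by rewrite /qbd_tgt /translate /= !(addrAC _ (_%:Z)). Qed.

Lemma translate_D1 a : translation qbd_w qbd_tgt D1 (translate a 0).
Proof.
move=> [[x1 x2] l] [/= h1 h2]; split; last by move=> k; rewrite translate_qbd_tgt.
  by split=> /=; lia.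
move=> k; rewrite /qbd_w /face_of /=.
have h3 : 0 < x1 + a%:Z by lia.
by rewrite (gt_eqF h1) (gt_eqF h3) addr0.
Qed.

Lemma translate_D12 a1 a2 : translation qbd_w qbd_tgt D12 (translate a1 a2).
Proof.
move=> [[x1 x2] l] [/= h1 h2]; split; last by move=> k; rewrite translate_qbd_tgt.
  by split=> /=; lia.
by move=> k; rewrite /qbd_w /face_of /= !gt_eqF //; lia.
Qed.

Lemma qbd_w_D12 u k : D12 u -> qbd_w u k = phase_w A u.2 k.
Proof. by move=> [/= h1 h2]; rewrite /qbd_w /face_of !gt_eqF. Qed.

Lemma qbd_w_D1 u k : 0 < u.1.1 -> qbd_w u k = level_w A (u.1.2, u.2) k.
Proof. by move=> h1; rewrite /qbd_w /face_of (gt_eqF h1). Qed.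

Lemma occ_fin_mono th1 th2 th1' th2' : th1' <= th1 -> th2' <= th2 ->
  occ_fin A th1 th2 -> occ_fin A th1' th2'.
Proof.
move=> h1 h2; apply: (psummable_le qw0 (c := 1)) => // -[[x1 x2] l] /DDP[/= x10 x20 _].
by rewrite mul1r ler_expR lerD // ler_wpM2r // ler0z.
Qed.

Lemma occ_fin1_mono th th' : th' <= th -> occ_fin1 A th -> occ_fin1 A th'.
Proof.
move=> h; apply: (psummable_le qw0 (c := 1)) => // -[[x1 x2] l] /DDP[/= x10 x20 _].
by rewrite mul1r; case: ifP => // _; rewrite ler_expR lerD // ler_wpM2r // ler0z.
Qed.

Lemma occ_fin_occ_fin1 th1 th2 : occ_fin A th1 th2 -> occ_fin1 A th1.
Proof.
apply: (psummable_le qw0 (c := 1)) => // -[[x1 x2] l] _ /=; rewrite mul1r.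
case: eqP => [->|_]; last exact: expo_ge0.
by rewrite /expo /= !mulr0.
Qed.

Lemma occ_fin_occ_fin2 th1 th2 : occ_fin A th1 th2 -> occ_fin2 A th2.
Proof.
apply: (psummable_le qw0 (c := 1)) => // -[[x1 x2] l] _ /=; rewrite mul1r.
case: eqP => [->|_]; last exact: expo_ge0.
by rewrite /expo /= !mulr0.
Qed.

(** Entry [l] of the block generating function of face [al] at [(e^th1, e^th2)], applied to the
    vector [g], with no branch killed. *)
Definition face_mass (al : face) (th1 th2 : R) (g : 'I_s0 -> R) (l : 'I_s0) : R :=
  \sum_(k : branch s0) A al (dv k.1.1) (dv k.1.2) l k.2 *
    (expR (th1 * ((sh1 k)%:R - 1)) * expR (th2 * ((sh2 k)%:R - 1)) * g k.2).

Lemma kop_expo_le S (g : 'I_s0 -> R) th1 th2 u : (forall l, 0 <= g l) ->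
  kop qbd_w qbd_tgt S (fun v => expo th1 th2 v * g v.2) u <=
  expo th1 th2 u * face_mass (face_of u.1) th1 th2 g u.2.
Proof.
move=> g0; rewrite /kop /face_mass mulr_sumr big_mkcond /=; apply: ler_sum => k _.
rewrite expo_qbd_tgt; case: ifP => _; last first.
  by rewrite !mulr_ge0 ?expR_ge0 ?expo_ge0 ?(A_ge0 hA).
by rewrite /qbd_w le_eqVlt; apply/orP; left; apply/eqP; ring.
Qed.

Lemma face_mass_ge0 al th1 th2 g l : (forall l, 0 <= g l) -> 0 <= face_mass al th1 th2 g l.
Proof.
by move=> g0; apply: sumr_ge0 => k _; rewrite !mulr_ge0 ?expR_ge0 ?(A_ge0 hA).
Qed.

Lemma face_massE th1 th2 g l :
  face_mass F12 th1 th2 g l = kop (tilt (tilt (phase_w A) (@sh2 s0) th2) (@sh1 s0) th1) (@phase_tgt s0) setT g l.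
Proof.
rewrite /kop /face_mass; apply: eq_big => [k|k _]; first by rewrite in_setT.
by rewrite /tilt /phase_w /phase_tgt; ring.
Qed.

Lemma face_mass_bound al th1 th2 g : (forall l, 0 <= g l) ->
  exists2 C, 0 <= C & forall l, face_mass al th1 th2 g l <= C.
Proof.
move=> g0; exists (\sum_l face_mass al th1 th2 g l).
  by apply: sumr_ge0 => l _; exact: face_mass_ge0.
move=> l; rewrite (bigD1 l) //= lerDl; apply: sumr_ge0 => m _; exact: face_mass_ge0.
Qed.

Lemma occ_fin1_occ_fin2_occ_fin th1 th2 rho : rho < 1 -> SH12 A th1 th2 rho ->
  occ_fin1 A th1 -> occ_fin2 A th2 -> occ_fin A th1 th2.
Proof.
move=> rho1 [g [g0 hg]] fE1 fE2.
have {}g0 l : 0 < g l by exact: g0.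
have g0' l : 0 <= g l by exact: ltW.
have [C1 C10 HC1] := face_mass_bound F1 th1 th2 g0'.
have [C2 C20 HC2] := face_mass_bound F2 th1 th2 g0'.
have [m m0 Hm] := finite_lower_bound g0.
pose ax1 (u : state s0) := if u.1.2 == 0 then expo th1 0 u else 0.
pose ax2 (u : state s0) := if u.1.1 == 0 then expo 0 th2 u else 0.
pose EE u := C1 * ax1 u + C2 * ax2 u.
have sE : psummable qbd_w qbd_tgt DD EE.
  by apply: psummableD; [apply: (psummable_le qw0 (c := C1) _ _ fE1)|
    apply: (psummable_le qw0 (c := C2) _ _ fE2)].
have ax10 u : 0 <= ax1 u by rewrite /ax1; case: ifP => // _; exact: expo_ge0.
have ax20 u : 0 <= ax2 u by rewrite /ax2; case: ifP => // _; exact: expo_ge0.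
have EE0 u : 0 <= EE u by rewrite addr_ge0 ?mulr_ge0.
pose G (u : state s0) := expo th1 th2 u * g u.2.
(* The drift of [G] gains [(1 - rho) * G] in the interior only. On the axes it may lose, and the
   loss is charged to [EE], which is summable by hypothesis. *)
pose F u := if (u.1.1 != 0) && (u.1.2 != 0) then (1 - rho) * G u else 0.
have sF : psummable qbd_w qbd_tgt DD F.
  apply: (@psummable_Lyapunov _ _ _ _ _ qw0 _ _ G EE) => //.
    by move=> u _; rewrite mulr_ge0 ?expo_ge0.
  move=> u /DDP[u1 u2 u12].
  have := @kop_expo_le DD g th1 th2 u g0'; rewrite -/G /F => opG.
  have [e1|n1] /= := eqVneq u.1.1 0.
    rewrite add0r; apply: le_trans opG _.
    apply: (@le_trans _ _ (EE u)); last by rewrite lerDr mulr_ge0 ?expo_ge0.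
    rewrite e1 eqxx /= in u12; rewrite /face_of e1 eqxx (negbTE u12).
    have -> : expo th1 th2 u = ax2 u by rewrite /ax2 /expo e1 !mulr0 eqxx.
    by rewrite mulrC ler_wpDl ?mulr_ge0 // ler_wpM2r.
  have [e2|n2] /= := eqVneq u.1.2 0.
    rewrite add0r; apply: le_trans opG _.
    apply: (@le_trans _ _ (EE u)); last by rewrite lerDr mulr_ge0 ?expo_ge0.
    rewrite /face_of (negbTE n1) e2 eqxx.
    have -> : expo th1 th2 u = ax1 u by rewrite /ax1 /expo e2 !mulr0 eqxx.
    by rewrite mulrC ler_wpDr ?mulr_ge0 // ler_wpM2r.
  apply: (@le_trans _ _ (G u)); last by rewrite lerDl.
  rewrite -lerBrDl; apply: le_trans opG _.
  rewrite /face_of (negbTE n1) (negbTE n2) face_massE.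
  apply: (@le_trans _ _ (expo th1 th2 u * (rho * g u.2))).
    by rewrite ler_wpM2l ?expo_ge0 // hg.
  by rewrite /G le_eqVlt; apply/orP; left; apply/eqP; ring.
(* Since [g >= m], these factors recover [expo] from [F] in the interior; the axis terms cover the
   rest of the quadrant. *)
have sAx : psummable qbd_w qbd_tgt DD (fun u => (1 - rho)^-1 * m^-1 * F u + (ax1 u + ax2 u)).
  apply: psummableD; last exact: psummableD.
  apply: (psummable_le qw0 (c := (1 - rho)^-1 * m^-1) _ _ sF) => //.
  by rewrite mulr_ge0 ?invr_ge0 ?(ltW m0) // subr_ge0 ltW.
apply: (psummable_le qw0 (c := 1) _ _ sAx) => // u _; rewrite mul1r /F.
have [e1|n1] /= := eqVneq u.1.1 0.
  have -> : expo th1 th2 u = ax2 u by rewrite /ax2 /expo e1 !mulr0 eqxx.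
  by rewrite mulr0 add0r lerDr.
have [e2|n2] /= := eqVneq u.1.2 0.
  have -> : expo th1 th2 u = ax1 u by rewrite /ax1 /expo e2 !mulr0 eqxx.
  by rewrite mulr0 add0r lerDl.
apply: ler_wpDr; first exact: addr_ge0.
rewrite -mulrA [m^-1 * _]mulrCA mulKf; last by rewrite subr_eq0 gt_eqF.
by rewrite mulrC /G -mulrA ler_peMr ?expo_ge0 // ler_pdivlMr // mul1r.
Qed.

End Domains.

(** * The half-plane along the first axis *)

Section Axis1.
Variables (R : realType) (s0 : nat) (A : face -> int -> int -> 'M[R]_s0).
Hypotheses (s0_gt0 : (0 < s0)%N) (hA : qbd_blocks A).

Local Notation DD := (fibers s0 ZpxZp0).
Local Notation D1 := (fibers s0 NxZp).
Local Notation qbd_w := (qbd_w A).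
Local Notation qbd_tgt := (@qbd_tgt s0).
Let qw0 := qbd_w_ge0 hA.

Hypothesis reach1 : forall u v, D1 u -> D1 v -> reach qbd_w qbd_tgt D1 u v.

Let axis1 (th : R) (u : state s0) : R := if u.1.2 == 0 then expo th 0 u else 0.

Let axis1_ge0 th u : 0 <= axis1 th u.
Proof. by rewrite /axis1; case: ifP => // _; exact: expo_ge0. Qed.

Let l0 : 'I_s0 := Ordinal s0_gt0.

Section AxisPotential.
Variable th : R.
Hypothesis fin1 : occ_fin1 A th.

Let H := pot qbd_w qbd_tgt D1 (axis1 th).

Let sumD1 : psummable qbd_w qbd_tgt D1 (axis1 th).
Proof. by apply: (psummable_sub qw0 (@NxZp_sub s0) _ fin1) => u _; exact: axis1_ge0. Qed.

Lemma axis_pot_superharmonic u : D1 u -> kop qbd_w qbd_tgt D1 H u <= H u.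
Proof. by apply: pot_superharmonic_le => // y _; exact: axis1_ge0. Qed.

Lemma axis_pot_ge0 u : D1 u -> 0 <= H u.
Proof. by apply: pot_ge0 => // y _; exact: axis1_ge0. Qed.

Lemma axis_pot_gt0 u : D1 u -> 0 < H u.
Proof.
move=> Du; pose v : state s0 := ((1, 0), l0).
have Dv : D1 v by split.
have [c c0 Hc] := reach_Harnack qw0 (reach1 Du Dv) Du.
apply: lt_le_trans (Hc H axis_pot_ge0 axis_pot_superharmonic).
rewrite mulr_gt0 // /H (potE qw0 (fun y _ => axis1_ge0 th y) sumD1) //.
apply: ltr_wpDr; first by apply: kop_ge0 => // y; exact: axis_pot_ge0.
by rewrite /axis1 eqxx expo_gt0.
Qed.

Lemma axis_pot_translate u : D1 u -> expR th * H u <= H (translate 1 0 u).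
Proof.
move=> Du; apply: (pot_translation qw0 (translate_D1 A 1) (fun y _ => axis1_ge0 th y) sumD1) => //.
move=> y Dy; rewrite /axis1 /= addr0; case: ifP => _; last by rewrite mulr0.
by rewrite expo_translate mul0r addr0 mulr1.
Qed.

End AxisPotential.

(** For the potential [H] and neighbours [u], [v] along the axis, translation gives
    [e^th H(u) <= H(v)], and Harnack gives [c H(v) <= H(u)] with [c] independent of [th]. Hence
    [e^th <= c^-1]. *)
Lemma occ_fin1_bounded : exists B, forall th, occ_fin1 A th -> th <= B.
Proof.
pose u : state s0 := ((1, 0), l0); pose v : state s0 := ((2, 0), l0).
have Du : D1 u by split.
have Dv : D1 v by split.
have [c c0 Hc] := translation_Harnack qw0 (reach1 Du Dv) Du.
exists (ln c^-1) => th fin1.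
have p0 := axis_pot_ge0 fin1; have ps := axis_pot_superharmonic fin1.
have := axis_pot_translate fin1 Du.
have tid : translation qbd_w qbd_tgt D1 (translate 0 0) by exact: translate_D1.
have := Hc _ p0 ps _ tid.
have sid x : translate 0 0 x = x by case: x => [[x1 x2] l]; rewrite /translate /= !addr0.
rewrite !sid => h1 h2; have Hu := axis_pot_gt0 fin1 Du.
have {h2} : expR th * pot qbd_w qbd_tgt D1 (axis1 th) u <= c^-1 * pot qbd_w qbd_tgt D1 (axis1 th) u.
  by apply: le_trans h2 _; rewrite ler_pdivlMl.
rewrite ler_pM2r // => h2.
by rewrite -[th]expRK ler_ln ?posrE ?expR_gt0 ?invr_gt0.
Qed.

Lemma occ_fin1_SH1 th : occ_fin1 A th -> exists2 th', th <= th' & SH1 A th' 1.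
Proof.
move=> fin1; pose H := pot qbd_w qbd_tgt D1 (axis1 th).
have p0 := axis_pot_ge0 fin1; have ps := axis_pot_superharmonic fin1.
have pp := axis_pot_gt0 fin1; have sh := axis_pot_translate fin1.
(* Level [n] is column [n + 1], because [D1] starts at column 1. *)
pose h (n : nat) (y : int * 'I_s0) := H ((n.+1%:Z, y.1), y.2).
have hE n y : h n y = H (translate n 0 ((1, y.1), y.2)).
  by rewrite /h /translate /= addr0; congr (H (_, _, _)); lia.
have Dh n (y : int * 'I_s0) : fibers s0 Zplus y -> D1 ((n.+1%:Z, y.1), y.2) by [].
pose y0 : int * 'I_s0 := (0, l0).
have Dy0 : fibers s0 Zplus y0 by [].
have [c c0 Hc] := translation_Harnack qw0 (reach1 (Dh 0%N _ Dy0) (Dh 1%N _ Dy0)) (Dh 0%N _ Dy0).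
have step n : h n.+1 y0 <= c^-1 * h n y0.
  have e m : H (translate n 0 ((m.+1%:Z, y0.1), y0.2)) = h (m + n)%N y0.
    by rewrite /h /translate /= addr0 -PoszD addSn.
  by rewrite ler_pdivlMl //; have := Hc _ p0 ps _ (translate_D1 A n); rewrite -/H !e.
have super n y : fibers s0 Zplus y ->
    \sum_(k | level_tgt y k \in fibers s0 Zplus) level_w A y k * h (n + sh1 k)%N (level_tgt y k) <= h n.+1 y.
  move=> Dy; apply: le_trans (ps _ (Dh n.+1 y Dy)).
  have e (k : branch s0) : n.+2%:Z + dv k.1.1 = (n + sh1 k).+1%:Z by rewrite /dv /sh1; lia.
  rewrite /kop le_eqVlt; apply/orP; left; apply/eqP; apply: eq_big => [k|k _].
    apply/idP/idP => /set_mem; last by move=> [_ Dk]; exact: mem_set.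
    by move=> Dk; apply: mem_set; split => //=; rewrite e.
  by rewrite qbd_w_D1 // /qbd_tgt /= e.
have harn y y' : fibers s0 Zplus y -> fibers s0 Zplus y' ->
    exists c, forall n, h n y' <= c * h n y.
  move=> Dy Dy'.
  have [c' c'0 Hc'] := translation_Harnack qw0 (reach1 (Dh 0%N _ Dy) (Dh 0%N _ Dy')) (Dh 0%N _ Dy).
  exists c'^-1 => n; rewrite ler_pdivlMl //.
  by rewrite !hE; exact: Hc' _ p0 ps _ (translate_D1 A n).
have mono n : expR th * h n y0 <= h n.+1 y0.
  have := sh _ (Dh n _ Dy0); rewrite -/H /h /translate /= addr0.
  by rewrite (_ : n.+1%:Z + 1%:Z = n.+2%:Z) //; lia.
have c'0 : 0 < c^-1 by rewrite invr_gt0.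
have [th' [g [le1 _ sg _]]] := geometric_mean_superharmonic (level_w_ge0 hA) (@sh1_le2 s0)
  Dy0 (fun n y Dy => pp _ (Dh n y Dy)) super harn (ex_intro _ _ step) mono
  (geometric_growth (h := fun n => h n y0) c'0 step).
by exists th' => //; exists g.
Qed.

End Axis1.

(** A superharmonic [g] for the level kernel may grow arbitrarily fast in [x2], beyond what the
    finite sum on the second axis can absorb. Capping it by a multiple of [e^(th2 x2) u] cures this.
    Rate 1 is enough for [u], since a strict gain is required only on the first axis. *)
Lemma SH1_occ_fin2_occ_fin1 (R : realType) (s0 : nat) (A : face -> int -> int -> 'M[R]_s0)
    (th1 th2 rho : R) : qbd_blocks A ->
  rho < 1 -> SH1 A th1 rho -> SH12 A th1 th2 1 -> occ_fin2 A th2 -> occ_fin1 A th1.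
Proof.
move=> hA rho1 [g [g0 hg]] [u [u0 hu]] fE2.
have qw0 := qbd_w_ge0 hA.
have {}u0 l : 0 < u l by exact: u0.
have u0' l : 0 <= u l by exact: ltW.
have g00 l : 0 < g (0, l) by exact: g0.
have {}hu l : face_mass A F12 th1 th2 u l <= u l.
  by rewrite face_massE -[leRHS]mul1r; exact: hu.
pose C := \sum_l g (0, l) / u l.
have C0 : 0 <= C by apply: sumr_ge0 => l _; rewrite divr_ge0 // ltW.
have Cu l : g (0, l) <= C * u l.
  rewrite -ler_pdivrMr // /C (bigD1 l) //= lerDl; apply: sumr_ge0 => j _.
  by rewrite divr_ge0 // ltW.
have [m m0 Hm] := finite_lower_bound g00.
have [C2 C20 HC2] := face_mass_bound hA F2 th1 th2 u0'.
pose e2 (x : int) := expR (th2 * x%:~R).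
pose f (y : int * 'I_s0) := Num.min (g y) (C * (e2 y.1 * u y.2)).
have f0 y : fibers s0 Zplus y -> 0 <= f y.
  move=> Dy; rewrite /f le_min ltW ?g0 //=.
  by rewrite !mulr_ge0 ?expR_ge0.
(* The minimum with [C e^(th2 x2) u] makes [G] small enough on the second axis,
   and equals [g] on the first one, where the strict inequality is needed. *)
pose G (v : state s0) := if v.1.1 == 0 then 0 else
  expR (th1 * v.1.1%:~R) * f (v.1.2, v.2).
pose G' (v : state s0) := expo th1 th2 v * u v.2.
have GG' v : fibers s0 ZpxZp0 v -> G v <= C * G' v.
  move=> /DDP[v1 v2 _]; rewrite /G; case: ifP => _.
    by rewrite !mulr_ge0 ?expR_ge0.
  rewrite /G' /expo expRD -!mulrA mulrCA ler_wpM2l ?expR_ge0 //.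
  by rewrite ge_min lexx orbT.
have G0 v : fibers s0 ZpxZp0 v -> 0 <= G v.
  move=> /DDP[v1 v2 _]; rewrite /G; case: ifP => // _.
  by rewrite mulr_ge0 ?expR_ge0 ?f0.
(* As [G] vanishes on the second axis, all of [kop G] there counts as loss; [C * C2] bounds it
   through [G <= C * G'] and the mass of that face. *)
pose EE (v : state s0) := C * C2 * (if v.1.1 == 0 then expo 0 th2 v else 0).
have EE0 v : 0 <= EE v by rewrite !mulr_ge0 //; case: ifP => // _; exact: expo_ge0.
pose F (v : state s0) := (1 - rho) * m * (if v.1.2 == 0 then expo th1 0 v else 0).
suff sF : psummable (qbd_w A) (@qbd_tgt s0) (fibers s0 ZpxZp0) F.
  apply: (psummable_le qw0 (c := ((1 - rho) * m)^-1) _ _ sF).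
    move=> v _; rewrite /F mulKf // mulf_neq0 ?gt_eqF //.
    by rewrite subr_gt0.
  by rewrite invr_ge0 mulr_ge0 ?(ltW m0) // subr_ge0 ltW.
apply: (psummable_Lyapunov qw0 G0 (E := EE)); last first.
  apply: (psummable_le qw0 (c := C * C2) _ _ fE2) => //.
  by rewrite mulr_ge0.
move=> v Dv; have /DDP[v1 v2 v12] := Dv.
have opG' : kop (qbd_w A) (@qbd_tgt s0) (fibers s0 ZpxZp0) G v <=
    C * (expo th1 th2 v * face_mass A (face_of v.1) th1 th2 u v.2).
  apply: (@le_trans _ _ (C * kop (qbd_w A) (@qbd_tgt s0) (fibers s0 ZpxZp0) G' v)).
    by rewrite -kopZ; apply: le_kop.
  by rewrite ler_wpM2l // kop_expo_le.
have [e1|n1] := eqVneq v.1.1 0.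
  have n2 : v.1.2 != 0 by move: v12; rewrite e1 eqxx.
  rewrite /F (negbTE n2) mulr0 add0r; apply: le_trans opG' _.
  rewrite /G e1 eqxx add0r /EE e1 eqxx -mulrA ler_wpM2l //.
  rewrite /face_of e1 eqxx (negbTE n2) mulrC.
  have -> : expo th1 th2 v = expo 0 th2 v by rewrite /expo e1 !mulr0.
  by rewrite ler_wpM2r ?expo_ge0.
have {}v1 : 0 < v.1.1 by rewrite lt_neqAle eq_sym n1.
apply: (@le_trans _ _ (G v)); last by rewrite lerDl.
pose y : int * 'I_s0 := (v.1.2, v.2).
have Dy : fibers s0 Zplus y by [].
pose X := expR (th1 * v.1.1%:~R).
have X0 : 0 <= X by exact: expR_ge0.
have opG : kop (qbd_w A) (@qbd_tgt s0) (fibers s0 ZpxZp0) G v <=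
    X * kop (tilt (level_w A) (@sh1 s0) th1) (@level_tgt s0) (fibers s0 Zplus) f y.
  rewrite /kop mulr_sumr !(big_mkcond (fun k => _ \in _)) /=; apply: ler_sum => k _.
  case: ifPn => [/set_mem /DDP[/= t1 t2 t12]|_]; last first.
    case: ifPn => // /set_mem Dk.
    by rewrite !mulr_ge0 ?f0 ?expR_ge0 ?(level_w_ge0 hA).
  rewrite mem_set // qbd_w_D1 // /G /=; case: ifP => _.
    by rewrite mulr0 !mulr_ge0 ?f0 ?expR_ge0 ?(level_w_ge0 hA).
  rewrite (intrD _ _ (dv _)) mulrDr dvE expRD /tilt /X.
  rewrite le_eqVlt; apply/orP; left; apply/eqP; rewrite /level_tgt /y /sh1 /=; ring.
have opf : kop (tilt (level_w A) (@sh1 s0) th1) (@level_tgt s0) (fibers s0 Zplus) f y <= rho * g y.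
  apply: le_trans (hg y Dy); apply: le_kop => // [z k|z _]; last by rewrite /f ge_min lexx.
  by rewrite mulr_ge0 ?expR_ge0 ?(level_w_ge0 hA).
have [z2|n2] := eqVneq v.1.2 0.
  have fy : f y = g y.
    by rewrite /f min_l // /y z2 /e2 mulr0 expR0 mul1r Cu.
  rewrite /F /G z2 eqxx (negbTE n1) -[in leRHS]z2 -/y fy.
  apply: (@le_trans _ _ ((1 - rho) * g y * X + X * (rho * g y))); last first.
    by rewrite /X le_eqVlt; apply/orP; left; apply/eqP; ring.
  apply: lerD; last by apply: le_trans opG _; rewrite ler_wpM2l.
  have -> : expo th1 0 v = X by rewrite /expo z2 !mulr0 addr0.
  rewrite ler_wpM2r // ler_wpM2l ?subr_ge0 ?(ltW rho1) //.
  by rewrite /y z2 Hm.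
rewrite /F (negbTE n2) mulr0 add0r /G (negbTE n1) -/X -/y /f.
(* A minimum of two superharmonic functions is superharmonic: use the inequality of whichever term
   is active at [y]. *)
have [gC|Cg] := leP (g y) (C * (e2 y.1 * u y.2)).
  apply: le_trans opG _; rewrite ler_wpM2l //; apply: le_trans opf _.
  by rewrite ler_piMl // ltW // g0.
apply: le_trans opG' _; rewrite /face_of (negbTE n1) (negbTE n2).
rewrite /expo expRD -/X -mulrA mulrCA; apply: ler_wpM2l => //.
by rewrite /e2 /= !ler_wpM2l ?expR_ge0.
Qed.

(** * The interior quadrant *)

Section Interior.
Variables (R : realType) (s0 : nat) (A : face -> int -> int -> 'M[R]_s0).
Hypotheses (s0_gt0 : (0 < s0)%N) (hA : qbd_blocks A).

Local Notation DD := (fibers s0 ZpxZp0).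
Local Notation D2 := (fibers s0 ZpxN).
Local Notation D12 := (fibers s0 NxN).
Local Notation qbd_w := (qbd_w A).
Local Notation qbd_tgt := (@qbd_tgt s0).
Let qw0 := qbd_w_ge0 hA.

Hypothesis reach2 : forall u v, D2 u -> D2 v -> reach qbd_w qbd_tgt D2 u v.
Hypothesis reach12 : forall u v, D12 u -> D12 v -> reach qbd_w qbd_tgt D12 u v.
Hypothesis Phi_fin : forall v, DD v -> psummable qbd_w qbd_tgt DD (fun u => (u == v)%:R).

Let l0 : 'I_s0 := Ordinal s0_gt0.

Variables th1 th2 eta : R.
Hypotheses (fE : occ_fin A th1 th2) (nfE2 : ~ occ_fin2 A eta).

Let H := pot qbd_w qbd_tgt D12 (expo th1 th2).

Let sumD12 : psummable qbd_w qbd_tgt D12 (expo th1 th2).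
Proof. by apply: (psummable_sub qw0 (@NxN_sub s0) _ fE) => u _; exact: expo_ge0. Qed.

Let Hsup u : D12 u -> kop qbd_w qbd_tgt D12 H u <= H u.
Proof. by apply: pot_superharmonic_le => // y _; exact: expo_ge0. Qed.

Let H_ge0 u : D12 u -> 0 <= H u.
Proof. by apply: pot_ge0 => // y _; exact: expo_ge0. Qed.

Let H_gt0 u : D12 u -> 0 < H u.
Proof.
move=> Du; rewrite /H (potE qw0 (fun y _ => expo_ge0 th1 th2 y) sumD12) //.
by apply: ltr_wpDr; [apply: kop_ge0 => // y; exact: H_ge0|exact: expo_gt0].
Qed.

Let H_shift a1 a2 u : D12 u -> expR (th1 * a1%:R + th2 * a2%:R) * H u <= H (translate a1 a2 u).
Proof.
move=> Du.
apply: (pot_translation qw0 (translate_D12 A a1 a2) (fun y _ => expo_ge0 th1 th2 y) sumD12) => //.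
by move=> y Dy; rewrite expo_translate.
Qed.

Let Harnack u v : D12 u -> D12 v ->
  exists2 c, 0 < c & forall a1 a2, c * H (translate a1 a2 v) <= H (translate a1 a2 u).
Proof.
move=> Du Dv; have [c c0 Hc] := translation_Harnack qw0 (reach12 Du Dv) Du.
by exists c => // a1 a2; exact: Hc _ H_ge0 Hsup _ (translate_D12 A a1 a2).
Qed.

(** Level [m] is row [m + 1]. Rows come first because the growth to be bounded by [eta] is the one
    along the second axis. *)
Let h (m : nat) (y : int * 'I_s0) := H ((y.1, m.+1%:Z), y.2).
Let y0 : int * 'I_s0 := (1, l0).

(** The axis sum is split by phase and cut far out: a path into the interior starts from one phase,
    and its vertical translates remain admissible only above some height. *)
Let axis2_tail (n : nat) (k : 'I_s0) (x : state s0) : R :=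
  if [&& x.1.1 == 0, n%:Z <= x.1.2 & x.2 == k] then expR (eta * x.1.2%:~R) else 0.

Let tail_ge0 n k x : 0 <= axis2_tail n k x.
Proof. by rewrite /axis2_tail; case: ifP => // _; exact: expR_ge0. Qed.

(* If [h] grew faster than [e^(eta m)] along the second axis, entries from that
   axis into the interior would already make the axis sums at [eta] finite. *)
Lemma tail_psummable n c0 u v : 0 < c0 ->
  (forall l m, (n < m)%N -> c0 * expR (eta * m%:R) <= h m (1, l)) ->
  reach qbd_w qbd_tgt D2 u v -> D2 u -> u.1.1 = 0 -> v.1.1 != 0 ->
  exists n1, psummable qbd_w qbd_tgt DD (axis2_tail n1 u.2).
Proof.
move=> c00 big; elim=> [{}u _ ->|{}u k {}v wk Dk _ IH] //; rewrite ?eqxx //.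
case: u k wk Dk IH => [[u1 u2] ul] [[i j] l] wk Dk IH [/= _ u20] u10 v1.
rewrite {u1}u10 in wk Dk IH.
have ij := ltn_ord j; have ii := ltn_ord i.
have wE x2 : 0 < x2 -> qbd_w ((0, x2), ul) (i, j, l) = qbd_w ((0, u2), ul) (i, j, l).
  by move=> x20; rewrite /qbd_w /face_of /= (gt_eqF u20) (gt_eqF x20).
(* First case: the branch stays on the axis. The tail at phase [ul] is then dominated by [kop] of
   the tail at phase [l]; starting at [n1 + 2] keeps both ends positive and the target at height at
   least [n1]. *)
have [/= t1|/= t1] := eqVneq (qbd_tgt ((0, u2), ul) (i, j, l)).1.1 0.
  have [n1 Hn1] := IH Dk t1 v1; exists n1.+2.
  rewrite add0r in t1.
  have aux (a : int) : n1.+2%:Z <= a -> [/\ 0 < a, 0 < a + dv j & n1%:Z <= a + dv j].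
    by rewrite /dv => h1; split; lia.
  pose c := qbd_w ((0, u2), ul) (i, j, l) * expR (eta * (dv j)%:~R).
  have c1 : 0 < c by rewrite mulr_gt0 ?expR_gt0.
  have s1 : psummable qbd_w qbd_tgt DD (kop qbd_w qbd_tgt DD (axis2_tail n1 l)).
    by apply: psummable_kop => // y _; exact: tail_ge0.
  apply: (psummable_le qw0 (c := c^-1) _ _ s1); last by rewrite invr_ge0 ltW.
  move=> [[x1 x2] xl] Dx; rewrite [X in X <= _]/axis2_tail /=.
  case: ifPn => [/and3P[/eqP -> {}x20 /eqP ->]|_]; last first.
    rewrite mulr_ge0 ?invr_ge0 ?(ltW c1) //.
    by apply: kop_ge0 => // y _; exact: tail_ge0.
  have [p1 p2 p3] := aux x2 x20.
  have Dt : DD (qbd_tgt ((0, x2), ul) (i, j, l)).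
    by apply/DDP; rewrite /= t1 (gt_eqF p2); split=> //; exact: ltW.
  rewrite ler_pdivlMl //; apply: le_trans (kop_ge_term qw0 _ Dt); last first.
    by move=> y _; exact: tail_ge0.
  rewrite wE // /axis2_tail /= t1 !eqxx p3 /=.
  rewrite (intrD _ _ (dv _)) mulrDr expRD /c.
  by rewrite le_eqVlt; apply/orP; left; apply/eqP; ring.
have di : dv i = 1 by case: Dk => /= + _; move: t1; rewrite !add0r /dv; lia.
(* Second case: the branch enters column 1, at row [a + dv j], which is level [m = a + dv j - 1].
   Starting at [n + 3] ensures [m > n], the range of [big]. *)
have aux (a : int) : n.+3%:Z <= a ->
    [/\ 0 < a, 0 < a + dv j & exists2 m : nat, m%:Z = a + dv j - 1 & (n < m)%N].
  rewrite /dv => h1; split; [lia|lia|exists `|(a + (j%:Z - 1) - 1)%R|%N; lia].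
exists n.+3; pose c := qbd_w ((0, u2), ul) (i, j, l) * c0 * expR (eta * ((dv j)%:~R - 1)).
have c1 : 0 < c by rewrite !mulr_gt0 ?expR_gt0.
have ent := psummable_entry qw0 (@NxN_sub s0) (fun y _ => expo_ge0 th1 th2 y) fE.
apply: (psummable_le qw0 (c := c^-1) _ _ ent); last by rewrite invr_ge0 ltW.
move=> [[x1 x2] xl] Dx; rewrite /axis2_tail /=.
case: ifPn => [/and3P[/eqP -> {}x20 /eqP ->]|_]; last first.
  rewrite mulr_ge0 ?invr_ge0 ?(ltW c1) //; case: ifP => // _.
  by apply: kop_ge0 => // y; exact: H_ge0.
rewrite ifF; last by apply/negP => /set_mem [/=]; rewrite ltxx.
have [p1 p2 [m mE nm]] := aux x2 x20.
have Dt : D12 (qbd_tgt ((0, x2), ul) (i, j, l)).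
  by split; rewrite /= ?di.
rewrite ler_pdivlMl //; apply: le_trans (kop_ge_term qw0 H_ge0 Dt).
rewrite wE //.
have -> : qbd_tgt ((0, x2), ul) (i, j, l) = ((1, m.+1%:Z), l).
  by rewrite /qbd_tgt /= di; congr (_, _, _); rewrite -addn1 PoszD mE subrK.
rewrite /c -!mulrA ler_wpM2l ?(ltW wk) //.
apply: le_trans (big l m nm).
rewrite ler_wpM2l ?(ltW c00) // -expRD ler_expR -mulrDr.
have -> : (m%:R : R) = m%:Z%:~R by [].
by rewrite mE !intrD addrC addrA.
Qed.

Let Npos : set int := [set x | 0 < x].

Let Dh m (y : int * 'I_s0) : fibers s0 Npos y -> D12 ((y.1, m.+1%:Z), y.2).
Proof. by []. Qed.

Let hE n m (y : int * 'I_s0) : h (m + n) y = H (translate 0 n ((y.1, m.+1%:Z), y.2)).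
Proof. by rewrite /h /translate /= addr0 -PoszD addSn. Qed.

(** Otherwise [h] exceeds [e^(eta m)] at all large levels, first at phase [l0] and by Harnack at
    every phase. Then [tail_psummable] makes the axis sum at [eta] finite, against [nfE2]. *)
Let h_frequently n : exists2 m, (n < m)%N & h m y0 <= 1 * expR (eta * m%:R).
Proof.
apply: contrapT => no; apply: nfE2.
have big m : (n < m)%N -> expR (eta * m%:R) <= h m y0.
  move=> nm; apply: ltW; rewrite ltNge; apply/negP => hm; apply: no.
  by exists m => //; rewrite mul1r.
have /choice[cf Hcf] : forall l : 'I_s0, exists c, 0 < c /\ forall m, c * h m y0 <= h m (1, l).
  move=> l; have [c c0 Hc] := @Harnack ((1, 1), l) ((1, 1), l0) (conj isT isT) (conj isT isT).
  exists c; split=> // m; rewrite -[m]add0n !hE; exact: Hc.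
have [c0 c00 Hc0] := finite_lower_bound (fun l => (Hcf l).1).
have {}big l m : (n < m)%N -> c0 * expR (eta * m%:R) <= h m (1, l).
  move=> nm; apply: le_trans ((Hcf l).2 m); apply: ler_pM.
  - exact: ltW.
  - exact: expR_ge0.
  - exact: Hc0.
  - exact: big.
have /choice[n1 Hn1] : forall k : 'I_s0, exists n1, psummable qbd_w qbd_tgt DD (axis2_tail n1 k).
  move=> k; have Du : D2 ((0, 1), k) by split.
  have Dv : D2 ((1, 1), k) by split.
  exact: (tail_psummable c00 big (reach2 Du Dv)).
(* [fin1] collects the tails; [fin2] covers the finitely many axis points below them, whose
   potentials are finite by [Phi_fin]. *)
pose fin1 (x : state s0) : R := \sum_k axis2_tail (n1 k) k x.
pose fin2 (x : state s0) : R := \sum_k \sum_(m < n1 k)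
  expR (eta * m.+1%:R) * (x == ((0, m.+1%:Z), k))%:R.
have s1 : psummable qbd_w qbd_tgt DD fin1 by apply: psummable_sum.
have s2 : psummable qbd_w qbd_tgt DD fin2.
  apply: psummable_sum => // k _; apply: psummable_sum => // m _.
  have Dv : DD ((0, m.+1%:Z), k) by split => // -[].
  by apply: (psummable_le qw0 (c := expR (eta * m.+1%:R)) _ _ (Phi_fin Dv)).
apply: (psummable_le qw0 (c := 1) _ _ (psummableD s1 s2)) => // -[[x1 x2] k] /DDP[/= _ x20 x12].
have f10 x : 0 <= fin1 x by apply: sumr_ge0 => *; exact: tail_ge0.
have f20 x : 0 <= fin2 x.
  by apply: sumr_ge0 => *; apply: sumr_ge0 => *; rewrite mulr_ge0 ?expR_ge0.
rewrite mul1r; case: eqP => [e1|_]; last by rewrite addr_ge0.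
rewrite e1 /= in x12 *.
have -> : expo 0 eta ((0, x2), k) = expR (eta * x2%:~R) by rewrite /expo /= mul0r add0r.
have [n1x|x2n] := leP (n1 k)%:Z x2.
  apply: ler_wpDr => //; rewrite /fin1 (bigD1 k) //=.
  rewrite {1}/axis2_tail /= !eqxx n1x /= lerDl.
  by apply: sumr_ge0 => *; exact: tail_ge0.
case: x2 x20 x12 x2n => [[|m]|//] // _ _ mn.
have mn' : (m < n1 k)%N by move: mn; rewrite ltz_nat => /ltnW.
apply: ler_wpDl => //; rewrite /fin2 (bigD1 k) //= (bigD1 (Ordinal mn')) //=.
rewrite eqxx mulr1 -addrA lerDl addr_ge0 //.
  by apply: sumr_ge0 => *; rewrite mulr_ge0 ?expR_ge0.
by apply: sumr_ge0 => *; apply: sumr_ge0 => *; rewrite mulr_ge0 ?expR_ge0.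
Qed.

(** Two averages, over rows and then over columns; only the first needs [h_frequently]. The
    comparison clause of [geometric_mean_superharmonic] passes the horizontal estimates of [H] on to
    [g], so that the second average applies to [g]. *)
Lemma occ_fin_SH12 : exists th1' th2', [/\ th1 <= th1', th2 <= th2', th2' <= eta &
  SH12 A th1' th2' 1].
Proof.
have Dy0 : fibers s0 Npos y0 by [].
pose tgtY (y : int * 'I_s0) (k : branch s0) : int * 'I_s0 := (y.1 + dv k.1.1, k.2).
have hpos n y : fibers s0 Npos y -> 0 < h n y by move=> Dy; apply: H_gt0; exact: Dh.
have super n y : fibers s0 Npos y ->
    \sum_(k | tgtY y k \in fibers s0 Npos) phase_w A y.2 k * h (n + sh2 k)%N (tgtY y k) <= h n.+1 y.
  move=> Dy; apply: le_trans (Hsup (Dh n.+1 Dy)).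
  have e (k : branch s0) : n.+2%:Z + dv k.1.2 = (n + sh2 k).+1%:Z by rewrite /dv /sh2; lia.
  rewrite /kop le_eqVlt; apply/orP; left; apply/eqP; apply: eq_big => [k|k _].
    apply/idP/idP => /set_mem; last by move=> [Dk _]; exact: mem_set.
    by move=> Dk; apply: mem_set; split => //=; rewrite e.
  by rewrite qbd_w_D12 // /qbd_tgt /= e.
have harn y y' : fibers s0 Npos y -> fibers s0 Npos y' ->
    exists c, forall n, h n y' <= c * h n y.
  move=> Dy Dy'; have [c c0 Hc] := Harnack (Dh 0 Dy) (Dh 0 Dy').
  by exists c^-1 => n; rewrite ler_pdivlMl // -[n]add0n !hE; exact: Hc.
have step y : fibers s0 Npos y -> exists c, forall n, h n.+1 y <= c * h n y.
  move=> Dy; have [c c0 Hc] := Harnack (Dh 0 Dy) (Dh 1 Dy).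
  by exists c^-1 => n; rewrite ler_pdivlMl // -[n.+1]add1n -[X in _ <= h X _]add0n !hE; exact: Hc.
have mono n : expR th2 * h n y0 <= h n.+1 y0.
  have := H_shift 0 1 (Dh n Dy0); rewrite mulr0 add0r mulr1.
  by rewrite -hE addn1.
have [th2' [g [le2 le_eta [g0 sg] tr]]] := geometric_mean_superharmonic
  (fun y k => phase_w_ge0 hA y.2 k) (@sh2_le2 s0) Dy0 hpos super harn (step y0 Dy0) mono h_frequently.
have Dg n (l : 'I_s0) : fibers s0 Npos (n.+1%:Z, l) by [].
(* [tr] needs a constant valid at all levels [m]; the Harnack constant is uniform in both
   translations, which also makes it independent of the column [n]. *)
have HarnackX (n1 n2 : nat) l l' : exists2 c, 0 < c &
    forall n, c * g ((n1 + n).+1%:Z, l) <= g ((n2 + n).+1%:Z, l').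
  have [c c0 Hc] := Harnack (Dh 0 (Dg n2 l')) (Dh 0 (Dg n1 l)).
  exists c => // n; apply: tr => // m; have := Hc n m.
  by rewrite /h /translate /= -!PoszD !addSn.
have growth n : expR th1 * g (n.+1%:Z, l0) <= g (n.+2%:Z, l0).
  apply: tr => //; first exact: expR_gt0.
  move=> m; have := H_shift 1 0 (Dh m (Dg n l0)).
  by rewrite mulr0 addr0 mulr1 /h /translate /= addr0 -PoszD addn1.
pose h' n (l : 'I_s0) := g (n.+1%:Z, l).
have super' n l : setT l -> \sum_(k | phase_tgt l k \in setT)
    tilt (phase_w A) (@sh2 s0) th2' l k * h' (n + sh1 k)%N (phase_tgt l k) <= h' n.+1 l.
  move=> _; have := sg _ (Dg n.+1 l); rewrite mul1r; apply: le_trans.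
  have e (k : branch s0) : n.+2%:Z + dv k.1.1 = (n + sh1 k).+1%:Z by rewrite /dv /sh1; lia.
  rewrite /kop le_eqVlt; apply/orP; left; apply/eqP; apply: eq_big => [k|k _].
    by rewrite in_setT; apply/esym/mem_set; rewrite /fibers /= e.
  by rewrite /tilt /tgtY /= e.
have harn' l l' : setT l -> setT l' -> exists c, forall n, h' n l' <= c * h' n l.
  move=> _ _; have [c c0 Hc] := HarnackX 0%N 0%N l' l.
  by exists c^-1 => n; rewrite ler_pdivlMl // /h' -[n]add0n.
have [c c0 Hc] := HarnackX 1%N 0%N l0 l0.
have step' n : h' n.+1 l0 <= c^-1 * h' n l0 by rewrite ler_pdivlMl // /h' -[n]add0n -add1n.
have c0' : 0 < c^-1 by rewrite invr_gt0.
have [th1' [g' [le1 _ sg' _]]] := geometric_mean_superharmonic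
  (tilt_ge0 (@sh2 s0) th2' (phase_w_ge0 hA)) (@sh1_le2 s0) (I : [set: 'I_s0] l0)
  (fun n l _ => g0 _ (Dg n l)) super' harn' (ex_intro _ _ step') growth
  (geometric_growth (h := fun n => h' n l0) c0' step').
by exists th1', th2'; split => //; exists g'.
Qed.

End Interior.

(** * Plane geometry *)

Section Plane.
Variable R : realType.

Definition convex_plane (P : R -> R -> Prop) : Prop := forall s x y x' y',
  0 <= s <= 1 -> P x y -> P x' y' -> P ((1 - s) * x + s * x') ((1 - s) * y + s * y').

Lemma segment_param (u v c : R) : u <= c -> c <= v -> u < v ->
  exists2 s, 0 <= s <= 1 & (1 - s) * u + s * v = c.
Proof.
move=> uc cv uv; have vu : 0 < v - u by rewrite subr_gt0.
exists ((c - u) / (v - u)).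
  by rewrite divr_ge0 ?subr_ge0 ?(ltW uv) //= ler_pdivrMr // mul1r lerD2r.
have -> : (1 - (c - u) / (v - u)) * u + (c - u) / (v - u) * v =
    u + (c - u) / (v - u) * (v - u) by ring.
by rewrite divfK ?gt_eqF // addrC subrK.
Qed.

(** If neither given point lies in the box, the segment joining them meets the line [x = e1] at
    height [r]. Either [r <= e2], or the segment from [(a, b)] to [(p, q)] meets the same line below
    [e2], and the corner [(e1, e2)] lies between the two crossings. *)
Lemma triangle_corner (P : R -> R -> Prop) a b p q p' q' X Y e1 e2 :
  convex_plane P -> P a b -> P p q -> P p' q' ->
  a < e1 -> b < e2 -> X <= e1 -> Y <= e2 ->
  X <= p -> Y <= q -> q <= e2 -> X <= p' -> p' <= e1 -> Y <= q' ->
  exists r1 r2, [/\ X <= r1 <= e1, Y <= r2 <= e2 & P r1 r2].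
Proof.
move=> cP Pab Ppq Ppq' ae be Xe Ye Xp Yq qe Xp' p'e Yq'.
have [pe|pe] := leP p e1; first by exists p, q; rewrite Xp pe Yq qe.
have [q'e|q'e] := leP q' e2; first by exists p', q'; rewrite Xp' p'e Yq' q'e.
have [s s01 Es] := segment_param p'e (ltW pe) (le_lt_trans p'e pe).
have := cP _ _ _ _ _ s01 Ppq' Ppq; rewrite Es; set r := (X in P e1 X) => Pr.
have Yr : Y <= r by rewrite /r; nra.
have [re|re] := leP r e2; first by exists e1, r; rewrite Xe lexx Yr re.
have [t t01 Et] := segment_param (ltW ae) (ltW pe) (lt_trans ae pe).
have := cP _ _ _ _ _ t01 Pab Ppq; rewrite Et; set r' := (X in P e1 X) => Pr'.
have r'e : r' <= e2 by rewrite /r'; nra.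
have [v v01 Ev] := segment_param r'e (ltW re) (le_lt_trans r'e re).
have := cP _ _ _ _ _ v01 Pr' Pr; rewrite Ev -mulrDl subrK mul1r => Pe.
by exists e1, e2; rewrite Xe Ye !lexx.
Qed.

Section HalfLine.
Variables (F g : R -> Prop) (F' : R -> Prop) (G : R -> R -> Prop) (d d' : R).
Hypotheses (g_convex : forall s x y, 0 <= s <= 1 -> g x -> g y -> g ((1 - s) * x + s * y))
  (G_open : forall x y, G x y -> exists2 e, 0 < e & forall x' y',
     `|x' - x| < e -> `|y' - y| < e -> G x' y')
  (F_le : forall x, F x -> x <= d) (F'_lt : forall y, y < d' -> F' y)
  (boot : forall x y, g x -> G x y -> F' y -> F x).

(** If [a >= d], push [a] slightly to the right: [c] remains in [g] by convexity and in [G] by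
    openness, so [boot] puts into [F] a point beyond its bound [d]. *)
Lemma boot_lt p x' a b : g p -> p <= d -> g x' -> a < x' -> G a b -> b < d' -> a < d.
Proof.
move=> gp pd gx' ax' Gab bd'; rewrite ltNge; apply/negP => da.
have [e e0 He] := G_open Gab.
pose c := Num.min (a + e / 2) x'.
have ac : a < c by rewrite lt_min ax' andbT; lra.
have cx : c <= x' by rewrite ge_min lexx orbT.
have ce : c <= a + e / 2 by rewrite ge_min lexx.
have gc : g c.
  have pc : p <= c by lra.
  have px : p < x' by lra.
  have [s s01 <-] := segment_param pc cx px.
  exact: g_convex.
have Gc : G c b by apply: He; rewrite ?subrr ?normr0 // ger0_norm; lra.
by have := F_le (boot gc Gc (F'_lt bd')); lra.
Qed.

End HalfLine.

(** [F1], [F2], [FE] stand for finiteness of the two axis sums and of the full sum, [g1], [g2], [G]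
    for the subcritical regions, and [Gbar] for rate 1 in place of a rate below 1. *)
Variables (F1 F2 g1 g2 : R -> Prop) (FE G Gbar : R -> R -> Prop).
Hypotheses
  (F1_mono : forall x x', x' <= x -> F1 x -> F1 x')
  (F2_mono : forall x x', x' <= x -> F2 x -> F2 x')
  (FE_mono : forall x y x' y', x' <= x -> y' <= y -> FE x y -> FE x' y')
  (F1_bounded : exists B, forall x, F1 x -> x <= B)
  (F2_bounded : exists B, forall x, F2 x -> x <= B)
  (FE_F1 : forall x y, FE x y -> F1 x)
  (FE_F2 : forall x y, FE x y -> F2 y)
  (g1_convex : forall s x y, 0 <= s <= 1 -> g1 x -> g1 y -> g1 ((1 - s) * x + s * y))
  (g2_convex : forall s x y, 0 <= s <= 1 -> g2 x -> g2 y -> g2 ((1 - s) * x + s * y))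
  (Gbar_convex : convex_plane Gbar)
  (G_Gbar : forall x y, G x y -> Gbar x y)
  (G_mix : forall s x y x' y', 0 < s <= 1 -> Gbar x y -> G x' y' ->
     G ((1 - s) * x + s * x') ((1 - s) * y + s * y'))
  (G_open : forall x y, G x y -> exists2 e, 0 < e & forall x' y',
     `|x' - x| < e -> `|y' - y| < e -> G x' y')
  (F1_g1 : forall x y, x < y -> F1 y -> exists2 x', x < x' & g1 x')
  (F2_g2 : forall x y, x < y -> F2 y -> exists2 x', x < x' & g2 x')
  (boot1 : forall x y, g1 x -> G x y -> F2 y -> F1 x)
  (boot2 : forall x y, g2 y -> G x y -> F1 x -> F2 y)
  (F1_F2_FE : forall x y, G x y -> F1 x -> F2 y -> FE x y)
  (FE_Gbar2 : forall x y eta, FE x y -> ~ F2 eta ->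
     exists x' y', [/\ x <= x', y <= y', y' <= eta & Gbar x' y'])
  (FE_Gbar1 : forall x y eta, FE x y -> ~ F1 eta ->
     exists x' y', [/\ x <= x', y <= y', x' <= eta & Gbar x' y']).

(** For a set closed downwards, as all those considered, this is membership in the interior. *)
Definition inner (F : R -> Prop) (x : R) : Prop := exists2 e, 0 < e & F (x + e).

Hypotheses
  (meet1 : exists x y, [/\ g1 x, inner F2 y & G x y])
  (meet2 : exists x y, [/\ inner F1 x, g2 y & G x y]).

Lemma inner_sup (F : R -> Prop) : (forall x x', x' <= x -> F x -> F x') ->
  (exists B, forall x, F x -> x <= B) -> (exists x, inner F x) ->
  exists d, forall x, (inner F x <-> x < d) /\ (F x -> x <= d).
Proof.
move=> mono [B HB] [x0 [e0 e00 Fx0]].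
have hs : has_sup [set x | F x].
  by split; [exists (x0 + e0)|exists B => x /HB].
exists (sup [set x | F x]) => x; have ub z : F z -> z <= sup [set x | F x].
  by move=> Fz; apply: ub_le_sup => //; exact: hs.2.
split; last exact: ub.
split => [[e e_0 /ub]|xd]; first by lra.
have gap : 0 < sup [set x | F x] - x by rewrite subr_gt0.
have [z Fz xz] := sup_adherent gap hs.
by rewrite opprB addrC subrK in xz; exists (z - x); rewrite ?subr_gt0 // addrC subrK.
Qed.

(** [F1] and [F2] are half-lines with ends [d1], [d2]. A point of [G] below the half-line conditions
    but beyond both ends would be joined to [(a, b)] by a segment crossing one end first, where a
    bootstrap gives a contradiction. For [FE], points of [Gbar] barely beyond the ends are merged
    and contracted towards [(a, b)]. *)
Lemma plane_domains :
  (forall x y, (inner F1 x /\ inner F2 y /\ G x y) <->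
     ((exists2 x', x < x' & g1 x') /\ (exists2 y', y < y' & g2 y') /\ G x y)) /\
  (forall x y, (exists2 e, 0 < e & FE (x + e) (y + e)) <->
     exists x' y', [/\ x < x', y < y', inner F1 x', inner F2 y' & G x' y']).
Proof.
have [p1 [p2 [gp Fp Gp]]] := meet1; have [q1 [q2 [Fq gq Gq]]] := meet2.
have [d1 Hd1] := inner_sup F1_mono F1_bounded (ex_intro _ q1 Fq).
have [d2 Hd2] := inner_sup F2_mono F2_bounded (ex_intro _ p2 Fp).
have F1lt x : x < d1 -> F1 x.
  by move/(Hd1 x).1 => [e e0]; apply: F1_mono; rewrite lerDl ltW.
have F2lt x : x < d2 -> F2 x.
  by move/(Hd2 x).1 => [e e0]; apply: F2_mono; rewrite lerDl ltW.
have F1le x : F1 x -> x <= d1 by exact: (Hd1 x).2.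
have F2le x : F2 x -> x <= d2 by exact: (Hd2 x).2.
have {}Fp : p2 < d2 by exact: (Hd2 _).1.1.
have {}Fq : q1 < d1 by exact: (Hd1 _).1.1.
have p1d : p1 <= d1 by apply: F1le; apply: (boot1 gp Gp); exact: F2lt.
have q2d : q2 <= d2 by apply: F2le; apply: (boot2 gq Gq); exact: F1lt.
(* Each point of (A6) is strictly below one end and at most at the other, so their midpoint is
   strictly below both. *)
pose a := (1 - 1 / 2) * p1 + 1 / 2 * q1; pose b := (1 - 1 / 2) * p2 + 1 / 2 * q2.
have Gab : G a b by apply: G_mix => //; [lra|exact: G_Gbar].
have ad : a < d1 by rewrite /a; lra.
have bd : b < d2 by rewrite /b; lra.
split=> x y.
  split=> [[/(Hd1 x).1 xd [/(Hd2 y).1 yd Gxy]]|[[x' xx' gx'] [[y' yy' gy'] Gxy]]].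
    split; [|split => //].
      by apply: (F1_g1 (y := (x + d1) / 2)); [lra|apply: F1lt; lra].
    by apply: (F2_g2 (y := (y + d2) / 2)); [lra|apply: F2lt; lra].
  have K1 u v : u < x' -> G u v -> v < d2 -> u < d1.
    by move=> ux Guv; exact: (boot_lt g1_convex G_open F1le F2lt boot1 gp p1d gx' ux Guv).
  have K2 u v : v < y' -> G u v -> u < d1 -> v < d2.
    move=> vy Guv ud.
    apply: (boot_lt (G := fun y x => G x y) g2_convex _ F2le F1lt _ gq q2d gy' vy Guv ud).
      move=> x1 y1 /G_open[e e0 He]; exists e => // x2 y2 h1 h2; exact: He.
    by move=> y1 x1; exact: boot2.
  have [xd|dx] := ltP x d1.
    by split; [exact: (Hd1 _).1.2|split => //; apply: (Hd2 _).1.2; exact: K2 Gxy xd].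
  have [yd|dy] := ltP y d2.
    by have := K1 _ _ xx' Gxy yd; lra.
  have ax : a < x by lra.
  have bY : b < y by lra.
  have [s s01 Es] := segment_param (ltW ad) dx ax.
  have [t t01 Et] := segment_param (ltW bd) dy bY.
  have seg r : 0 <= r <= 1 -> G ((1 - r) * a + r * x) ((1 - r) * b + r * y).
    move=> r01; have [->|r0] := eqVneq r 0; first by rewrite subr0 !mul1r !mul0r !addr0.
    apply: G_mix => //; last exact: G_Gbar.
    by case/andP: r01 => r0' ->; rewrite lt_neqAle eq_sym r0 r0'.
  (* The smaller parameter tells which end is crossed first. Lowering the other coordinate by
     [e / 2] makes its inequality strict even when both ends are crossed together. *)
  exfalso; have [st|ts] := leP s t.
    have := seg s s01; rewrite Es; set r := (X in G d1 X) => Gr.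
    have rd : r <= d2 by rewrite -Et /r; nra.
    have [e e0 He] := G_open Gr.
    have Gr' : G d1 (r - e / 2).
      by apply: He; rewrite ?subrr ?normr0 // addrAC subrr add0r normrN ger0_norm; lra.
    by have := K1 _ _ (le_lt_trans dx xx') Gr'; lra.
  have := seg t t01; rewrite Et; set r := (X in G X d2) => Gr.
  have rd : r <= d1 by rewrite -Es /r; nra.
  have [e e0 He] := G_open Gr.
  have Gr' : G (r - e / 2) d2.
    by apply: He; rewrite ?subrr ?normr0 // addrAC subrr add0r normrN ger0_norm; lra.
  by have := K2 _ _ (le_lt_trans dy yy') Gr'; lra.
split; last first.
  move=> [x' [y' [xx' yy' /(Hd1 x').1 xd /(Hd2 y').1 yd Gxy]]].
  exists (Num.min (x' - x) (y' - y)); first by rewrite lt_min !subr_gt0 xx' yy'.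
  apply: (FE_mono _ _ (F1_F2_FE Gxy (F1lt _ xd) (F2lt _ yd))).
    by rewrite -lerBrDl ge_min lexx.
  by rewrite -lerBrDl ge_min lexx orbT.
move=> [e e0 FExy]; set X := x + e in FExy *; set Y := y + e in FExy *.
have Xd : X <= d1 by apply: F1le; exact: FE_F1 FExy.
have Yd : Y <= d2 by apply: F2le; exact: FE_F2 FExy.
pose M := 1 + `|X - a| + `|Y - b|.
have hX := ler_norm (X - a); have hY := ler_norm (Y - b).
have nX := normr_ge0 (X - a); have nY := normr_ge0 (Y - b).
(* The contraction towards [(a, b)] lowers [X] and [Y] by at most [s * M <= e / 2], so the result
   stays strictly above [(x, y)]. *)
pose s := Num.min (1 / 2) (e / (2 * M)).
have M0 : 0 < M by rewrite /M; lra.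
have s0 : 0 < s by rewrite lt_min !divr_gt0 // mulr_gt0.
have s1 : s <= 1 / 2 by rewrite ge_min lexx.
have sM : s * M <= e / 2.
  rewrite -ler_pdivlMr // (_ : e / 2 / M = e / (2 * M)); first by rewrite ge_min lexx orbT.
  by field; rewrite gt_eqF.
(* Small enough that contraction by [s] brings any point below [(d1 + eps, d2 + eps)] strictly below
   [(d1, d2)]. *)
pose eps := s * Num.min (d1 - a) (d2 - b).
have m0 : 0 < Num.min (d1 - a) (d2 - b) by rewrite lt_min !subr_gt0 ad bd.
have eps0 : 0 < eps by rewrite mulr_gt0.
have eps1 : eps <= s * (d1 - a) by rewrite ler_wpM2l ?(ltW s0) // ge_min lexx.
have eps2 : eps <= s * (d2 - b) by rewrite ler_wpM2l ?(ltW s0) // ge_min lexx orbT.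
have nF1 : ~ F1 (d1 + eps) by move/F1le; lra.
have nF2 : ~ F2 (d2 + eps) by move/F2le; lra.
have [p [q [Xp Yq qe Gpq]]] := FE_Gbar2 FExy nF2.
have [p' [q' [Xp' Yq' p'e Gpq']]] := FE_Gbar1 FExy nF1.
have [r1 [r2 [/andP[Xr1 r1e] /andP[Yr2 r2e] Gr]]] :
    exists r1 r2, [/\ X <= r1 <= d1 + eps, Y <= r2 <= d2 + eps & Gbar r1 r2].
  apply: (triangle_corner Gbar_convex (G_Gbar Gab) Gpq Gpq') => //; lra.
have sX : s * (X - a) <= s * M by rewrite ler_wpM2l ?(ltW s0) // /M; lra.
have sY : s * (Y - b) <= s * M by rewrite ler_wpM2l ?(ltW s0) // /M; lra.
exists ((1 - s) * r1 + s * a), ((1 - s) * r2 + s * b); split.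
- by rewrite /X in Xr1 sX *; nra.
- by rewrite /Y in Yr2 sY *; nra.
- by apply: (Hd1 _).1.2; nra.
- by apply: (Hd2 _).1.2; nra.
- by apply: G_mix => //; lra.
Qed.

End Plane.

(** * Convexity of the subcritical regions *)

Section Convexity.
Variables (R : realType) (s0 : nat) (A : face -> int -> int -> 'M[R]_s0).
Hypothesis hA : qbd_blocks A.

Lemma SH1_convex s a b ra rb : 0 <= s <= 1 -> SH1 A a ra -> SH1 A b rb ->
  SH1 A ((1 - s) * a + s * b) ((1 - s) * ra + s * rb).
Proof.
move=> s01 [g hg] [g' hg'].
have := superharmonic_convex (level_w_ge0 hA)
  (e0 := fun _ k => a * ((sh1 k)%:R - 1)) (e1 := fun _ k => b * ((sh1 k)%:R - 1)) s01 hg hg'.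
rewrite (_ : (fun x k => _) = tilt (level_w A) (@sh1 s0) ((1 - s) * a + s * b)).
  by move=> h; eexists; exact: h.
by apply/funext => x; apply/funext => k; congr (_ * expR _); ring.
Qed.

Lemma tilt2E th1 th2 : tilt (tilt (phase_w A) (@sh2 s0) th2) (@sh1 s0) th1 =
  fun l k => phase_w A l k * expR (th1 * ((sh1 k)%:R - 1) + th2 * ((sh2 k)%:R - 1)).
Proof.
apply/funext => l; apply/funext => k.
by rewrite /tilt expRD -mulrA [expR _ * expR _ in LHS]mulrC.
Qed.

Lemma SH12_convex s a1 a2 b1 b2 ra rb : 0 <= s <= 1 ->
  SH12 A a1 a2 ra -> SH12 A b1 b2 rb ->
  SH12 A ((1 - s) * a1 + s * b1) ((1 - s) * a2 + s * b2) ((1 - s) * ra + s * rb).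
Proof.
rewrite /SH12 !tilt2E => s01 [g hg] [g' hg'].
have := superharmonic_convex (phase_w_ge0 hA) s01 hg hg'.
rewrite (_ : (fun x k => _) = fun l k => phase_w A l k *
  expR (((1 - s) * a1 + s * b1) * ((sh1 k)%:R - 1) + ((1 - s) * a2 + s * b2) * ((sh2 k)%:R - 1))).
  by move=> h; eexists; exact: h.
by apply/funext => x; apply/funext => k; congr (_ * expR _); ring.
Qed.

Lemma SH1_le th rho rho' : rho <= rho' -> SH1 A th rho -> SH1 A th rho'.
Proof. by move=> h [g hg]; exists g; exact: superharmonic_le hg. Qed.

Lemma SH12_le th1 th2 rho rho' : rho <= rho' -> SH12 A th1 th2 rho -> SH12 A th1 th2 rho'.
Proof. by move=> h [g hg]; exists g; exact: superharmonic_le hg. Qed.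

Definition subcritical1 (th : R) : Prop := exists2 rho, rho < 1 & SH1 A th rho.
Definition subcritical12 (th1 th2 : R) : Prop := exists2 rho, rho < 1 & SH12 A th1 th2 rho.

(** Any positive share [s] of a subcritical point turns rate 1 into [(1 - s) + s * rho < 1]; this is
    how the closure points given by averaging re-enter the region. *)
Lemma subcritical1_mix s x y : 0 < s <= 1 -> SH1 A x 1 -> subcritical1 y ->
  subcritical1 ((1 - s) * x + s * y).
Proof.
move=> /andP[s_0 s1] hx [rho rho1 hy].
exists ((1 - s) * 1 + s * rho).
  by have : 0 < s * (1 - rho) by [rewrite mulr_gt0 // subr_gt0]; lra.
by apply: SH1_convex => //; rewrite (ltW s_0).
Qed.

Lemma subcritical1_convex s x y : 0 <= s <= 1 -> subcritical1 x -> subcritical1 y ->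
  subcritical1 ((1 - s) * x + s * y).
Proof.
move=> s01 [ra ra1 hx] [rb rb1 hy]; exists (Num.max ra rb); first by rewrite gt_max ra1.
rewrite (_ : Num.max ra rb = (1 - s) * Num.max ra rb + s * Num.max ra rb); last by ring.
by apply: SH1_convex => //; [apply: SH1_le hx|apply: SH1_le hy]; rewrite le_max lexx ?orbT.
Qed.

Lemma subcritical12_mix s x y x' y' : 0 < s <= 1 -> SH12 A x y 1 -> subcritical12 x' y' ->
  subcritical12 ((1 - s) * x + s * x') ((1 - s) * y + s * y').
Proof.
move=> /andP[s_0 s1] hx [rho rho1 hy].
exists ((1 - s) * 1 + s * rho).
  by have : 0 < s * (1 - rho) by [rewrite mulr_gt0 // subr_gt0]; lra.
by apply: SH12_convex => //; rewrite (ltW s_0).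
Qed.

Lemma subcritical12_open x y : subcritical12 x y -> exists2 e, 0 < e & forall x' y',
  `|x' - x| < e -> `|y' - y| < e -> subcritical12 x' y'.
Proof.
move=> [rho0 rho01]; pose rho := Num.max rho0 (1 / 2).
have rho1 : rho < 1 by rewrite gt_max rho01; lra.
have rhop : 0 < rho by rewrite lt_max; apply/orP; right; lra.
move=> /(SH12_le (_ : rho0 <= rho)) []; first by rewrite le_max lexx.
(* The same [g] works: with increments in -1, 0, 1, moving both exponents by less than [e]
   multiplies each weight by at most [expR (2 * e)]. This choice of [e] gives the new rate
   [sqrt rho]. *)
move=> g [g0 hg]; exists (- ln rho / 4); first by rewrite divr_gt0 // oppr_gt0 ln_lt0 // rhop.
move=> x' y' hx hy; pose e := - ln rho / 4.
exists (rho * expR (2 * e)).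
  have lr : ln rho < 0 by rewrite ln_lt0 // rhop.
  rewrite -[X in X * _]lnK ?posrE // -expRD -[X in _ < X]expR0 ltr_expR /e.
  by move: (ln rho) lr => L; lra.
exists g; split => // l _; have := hg l I; rewrite !tilt2E /kop => hl.
rewrite mulrAC.
apply: le_trans (_ : _ <= (\sum_(k | phase_tgt l k \in setT) phase_w A l k *
  expR (x * ((sh1 k)%:R - 1) + y * ((sh2 k)%:R - 1)) * g (phase_tgt l k)) * expR (2 * e)) _; last first.
  by rewrite ler_wpM2r ?expR_ge0.
rewrite mulr_suml; apply: ler_sum => k _; rewrite -!mulrA ler_wpM2l ?phase_w_ge0 //.
rewrite mulrCA [leLHS]mulrC ler_wpM2l ?(ltW (g0 _ I)) //.
rewrite -expRD ler_expR.
have bnd (n : nat) (a b : R) : (n <= 2)%N -> `|a - b| < e -> a * (n%:R - 1) <= b * (n%:R - 1) + e.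
  rewrite ltr_norml => + /andP[h1 h2]; clearbody e; case: n => [|[|[|//]]] _.
  - by rewrite mulr0n; lra.
  - by rewrite mulr1n; lra.
  - by rewrite mulr2n; lra.
have := bnd _ _ _ (sh1_le2 k) hx; have := bnd _ _ _ (sh2_le2 k) hy; lra.
Qed.

End Convexity.

(** * Transport of sums and paths along an isomorphism of kernels *)

Section Swap.
Variables (R : realType) (I J : choiceType) (K K' : finType).
Variables (w : I -> K -> R) (tgt : I -> K -> I) (w' : J -> K' -> R) (tgt' : J -> K' -> J).
Variables (f : I -> J) (t : K -> K') (D : set I) (D' : set J).
Hypotheses (t_bij : bijective t) (wf : forall x k, w' (f x) (t k) = w x k)
  (tgtf : forall x k, tgt' (f x) (t k) = f (tgt x k)) (Df : forall x, D' (f x) <-> D x).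

Lemma kop_iso h x : kop w' tgt' D' h (f x) = kop w tgt D (fun y => h (f y)) x.
Proof.
rewrite /kop (reindex t) /=; last exact: onW_bij.
apply: eq_big => [k|k _]; last by rewrite wf tgtf.
by rewrite tgtf; apply/idP/idP => /set_mem/Df/mem_set.
Qed.

Lemma kpsum_iso n h x : kpsum w' tgt' D' n h (f x) = kpsum w tgt D n (fun y => h (f y)) x.
Proof.
elim: n x => [|n IH] x //=; rewrite kop_iso; congr (_ + _).
by apply: kop_ext => y _; exact: IH.
Qed.

Lemma psummable_iso h : psummable w' tgt' D' h -> psummable w tgt D (fun y => h (f y)).
Proof.
move=> sh x Dx; have [C HC] := sh (f x) ((Df x).2 Dx).
by exists C => n; rewrite -kpsum_iso.
Qed.

Lemma reach_iso x y : reach w tgt D x y -> reach w' tgt' D' (f x) (f y).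
Proof.
elim=> [{}x|{}x k {}y wk Dk _ IH]; first by constructor.
apply: (@reachS _ _ _ _ _ _ _ (t k)); rewrite ?wf ?tgtf //.
exact/Df.
Qed.

End Swap.

(** * Occupation measure and convergence domains *)

Section Occupation.
Variables (R : realType) (s0 : nat) (A : face -> int -> int -> 'M[R]_s0).
Hypotheses (s0_gt0 : (0 < s0)%N) (hA : qbd_blocks A).
Hypothesis irrT : irreducible (fibers s0 ZpxZp) (flat (Tqbd A)).

Local Notation DD := (fibers s0 ZpxZp0).
Local Notation qbd_w := (qbd_w A).
Local Notation qbd_tgt := (@qbd_tgt s0).
Let qw0 := qbd_w_ge0 hA.

(** Cut a path from the origin to [v] at its last visit to the origin; the remainder runs in the
    process killed there. *)
Lemma reach_from_origin v : DD v -> exists j k,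
  [/\ 0 < qbd_w ((0, 0), j) k, DD (qbd_tgt ((0, 0), j) k) & reach qbd_w qbd_tgt DD (qbd_tgt ((0, 0), j) k) v].
Proof.
move=> Dv; set Q := exists _, _.
suff H u y : reach qbd_w qbd_tgt (fibers s0 ZpxZp) u y -> y = v -> fibers s0 ZpxZp u ->
    (DD u /\ reach qbd_w qbd_tgt DD u v) \/ Q.
  have Du : fibers s0 ZpxZp ((0, 0), Ordinal s0_gt0) by split.
  have ruv := irreducible_reach qw0 (fun x _ => @Tqbd_kernel _ _ A ZpxZp x) irrT Du (Dv.1).
  by case: (H _ _ ruv erefl Du) => [[[_ /(_ erefl)]]|].
elim=> [{}u -> Du|{}u k {}y wk Dk _ IH yv Du]; first by left; split => //; constructor.
have [[DDk rk]|] := IH yv Dk; last by right.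
have [u00|u0] := eqVneq u.1 (0, 0); last first.
  left; have Du' : DD u by split=> //; exact/eqP.
  by split => //; apply: reachS wk DDk rk.
right; exists u.2, k; have -> : ((0, 0), u.2) = u by rewrite -u00; case: (u).
by split.
Qed.

(** One statement for the three generating functions: [e] embeds the index set, the plane or an
    axis, and [g] extends the weights [c] by 0. The occupation measure is one step from the origin
    followed by the potential; finiteness after that step spreads to all states by
    [reach_from_origin]. *)
Lemma occupation_finite (J : choiceType) (P : set J) (e : J -> int * int)
    (c : J -> R) (g : state s0 -> R) :
  set_inj P e -> (forall i, P i -> ZpxZp0 (e i)) -> (forall i, P i -> 0 <= c i) ->
  (forall i k, P i -> g (e i, k) = c i) ->
  (forall u, DD u -> ~ (e @` P) u.1 -> g u = 0) ->
  (forall j k, (\esum_(i in P) ((c i)%:E * hatnu A (e i) j k) < +oo)%E) <->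
  psummable qbd_w qbd_tgt DD g.
Proof.
move=> injP eD c0 ge gN.
have g0 u : DD u -> 0 <= g u.
  move=> Du; have [[i Pi eu]|/(gN _ Du) ->//] := pselect ((e @` P) u.1).
  by rewrite (surjective_pairing u) -eu ge ?c0.
pose S (k : 'I_s0) := [set v : state s0 | (e @` P) v.1 /\ v.2 = k].
(* An entry of [hatnu] fixes the final phase, so [g] is treated phase by phase. *)
pose gk k v := if v \in S k then g v else 0.
have SD k : S k `<=` DD by move=> v [[i Pi ev] _]; rewrite /fibers /= -ev; exact: eD.
have gk0 k u : DD u -> 0 <= gk k u.
  by move=> Du; rewrite /gk; case: ifP => // _; exact: g0.
have Tk x : DD x -> row_kernel qbd_w qbd_tgt DD (flat (Tqbd A)) x by move=> _; exact: Tqbd_kernel.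
have T0 j u : DD u -> 0 <= flat (Tqbd A) ((0, 0), j) u.
  by move=> Du; rewrite (Tqbd_kernel A (D := ZpxZp0)) // sumr_ge0.
have nuE j k : (\esum_(i in P) ((c i)%:E * hatnu A (e i) j k) =
    \esum_(u in DD) ((flat (Tqbd A) ((0, 0), j) u)%:E *
      \sum_(0 <= n <oo) (iter n (kop qbd_w qbd_tgt DD) (gk k) u)%:E))%E.
  transitivity (\esum_(v in S k) ((g v)%:E * hatnu A v.1 j v.2))%E.
    rewrite (reindex_esum P (S k) (fun i => (e i, k))); last first.
      split=> [i Pi|i i' iP i'P [ee]|[x l] [/= [i Pi ex] lk]].
      - by split => //; exists i.
      - exact: injP.
      - by exists i => //; rewrite ex lk.
    by apply: eq_esum => i Pi /=; rewrite ge.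
  transitivity (\esum_(v in S k) \esum_(u in DD)
      ((flat (Tqbd A) ((0, 0), j) u)%:E * ((g v)%:E * hatPhi A u v)))%E.
    apply: eq_esum => v Sv; rewrite -ge0_esumZl; last 2 first.
    - by apply: g0; exact: SD Sv.
    - move=> u Du; rewrite mule_ge0 ?lee_fin ?T0 //.
      exact: (potential_ge0 qw0 Tk).
    by apply: eq_esum => u Du; rewrite muleCA -surjective_pairing.
  rewrite esum_exchange; last first.
    move=> v u Sv Du; rewrite !mule_ge0 ?lee_fin ?T0 ?g0 //; first exact: SD Sv.
    exact: (potential_ge0 qw0 Tk).
  apply: eq_esum => u Du; rewrite ge0_esumZl ?T0 //; last first.
    move=> v Sv; rewrite mule_ge0 ?lee_fin ?g0 //; first exact: SD Sv.
    exact: (potential_ge0 qw0 Tk).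
  congr (_ * _)%E; rewrite /hatPhi (esum_potential qw0 Tk (SD k)) //.
  by move=> v Sv; apply: g0; exact: SD Sv.
split=> [fin|sg j k]; last first.
  have sgk : psummable qbd_w qbd_tgt DD (gk k).
    apply: (psummable_le qw0 (c := 1) _ _ sg) => // u Du; rewrite mul1r /gk.
    by case: ifP => // _; exact: g0.
  rewrite nuE (eq_esum (b := fun u => (flat (Tqbd A) ((0, 0), j) u)%:E *
      (pot qbd_w qbd_tgt DD (gk k) u)%:E)%E); last first.
    by move=> u Du; rewrite (nneseries_iter_pot qw0 (gk0 k)).
  rewrite (esum_kop qw0 (@Tqbd_kernel _ _ A ZpxZp0 ((0, 0), j))) ?ltry // => u Du.
  exact: (pot_ge0 qw0 (gk0 k) sgk).
have sgk k : psummable qbd_w qbd_tgt DD (gk k).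
  move=> x Dx; have [j [b [wb Db rb]]] := reach_from_origin Dx.
  have [d d0 [m Hm]] := reach_kpsum qw0 rb Db.
  have := fin j k; rewrite nuE; set W := (\esum_(u in _) _)%E => Wfin.
  have WN N : ((qbd_w ((0, 0), j) b * kpsum qbd_w qbd_tgt DD N (gk k) (qbd_tgt ((0, 0), j) b))%:E <= W)%E.
    apply: (@le_trans _ _ (kop qbd_w qbd_tgt DD (kpsum qbd_w qbd_tgt DD N (gk k)) ((0, 0), j))%:E).
      by rewrite lee_fin; apply: kop_ge_term => // y Dy; apply: kpsum_ge0 => // z; exact: gk0.
    rewrite -(esum_kop qw0 (@Tqbd_kernel _ _ A ZpxZp0 ((0, 0), j))); last first.
      by move=> y Dy; apply: kpsum_ge0 => // z; exact: gk0.
    apply: le_esum => u Du; apply: lee_wpmul2l; first by rewrite lee_fin T0.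
    by apply: nneseries_iter_ge => // z; exact: gk0.
  have W0 : (0 <= W)%E by apply: le_trans (WN 0%N); rewrite mulr0.
  have Wf : W \is a fin_num by rewrite ge0_fin_numE.
  exists (d^-1 * ((qbd_w ((0, 0), j) b)^-1 * fine W)) => n.
  rewrite ler_pdivlMl // ; apply: le_trans (Hm _ n (gk0 k)) _.
  by rewrite ler_pdivlMl // -lee_fin fineK.
have sall : psummable qbd_w qbd_tgt DD (fun u => \sum_k gk k u) by apply: psummable_sum.
apply: (psummable_le qw0 (c := 1) _ _ sall) => // u Du; rewrite mul1r.
have [eu|nu] := pselect ((e @` P) u.1); last first.
  by rewrite gN // sumr_ge0 // => k _; exact: gk0.
rewrite (bigD1 u.2) //= {1}/gk mem_set //; rewrite lerDl sumr_ge0 // => k _; exact: gk0.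
Qed.

Lemma expR_exprz_int (th : R) (n : int) : expR th ^ n = expR (th * n%:~R).
Proof.
case: n => n; first by rewrite -exprnP -[n%:~R]/(n%:R) mulrC expRM_natl.
by rewrite NegzE -exprnN -expRM_natl -expRN mulrNz mulrN mulrC.
Qed.

Lemma hatnu_starP th1 th2 :
  (forall j k, (hatnu_star A (expR th1) (expR th2) j k < +oo)%E) <-> occ_fin A th1 th2.
Proof.
apply: (occupation_finite (e := id)) => //.
- by move=> i _; rewrite mulr_ge0 ?exprz_ge0 ?expR_ge0.
- by move=> i k _; rewrite !expR_exprz_int -expRD.
- move=> u Du nx; exfalso; apply: nx; exists u.1 => //; exact: Du.1.
Qed.

Lemma hatnu_star0P th :
  (forall j k, (hatnu_star0 A (expR th) j k < +oo)%E) <-> occ_fin1 A th.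
Proof.
apply: (occupation_finite (e := fun x => (x, 0))).
- by move=> i j _ _ [].
- move=> i /= i0; split; first by split=> //=; exact: ltW.
  by move=> [i00]; rewrite i00 ltxx in i0.
- by move=> i _; rewrite exprz_ge0 ?expR_ge0.
- by move=> i k _ /=; rewrite expR_exprz_int /expo /= mulr0 addr0.
- move=> [[x1 x2] k] /DDP[/= x10 _ x12] nx; case: eqP => // x20.
  exfalso; apply: nx; exists x1; last by rewrite x20.
  by rewrite x20 eqxx orbF in x12; rewrite /= lt_neqAle eq_sym x12.
Qed.

Lemma hatnu_0starP th :
  (forall j k, (hatnu_0star A (expR th) j k < +oo)%E) <-> occ_fin2 A th.
Proof.
apply: (occupation_finite (e := fun x => (0, x))).
- by move=> i j _ _ [].
- move=> i /= i0; split; first by split=> //=; exact: ltW.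
  by move=> [i00]; rewrite i00 ltxx in i0.
- by move=> i _; rewrite exprz_ge0 ?expR_ge0.
- by move=> i k _ /=; rewrite expR_exprz_int /expo /= mulr0 add0r.
- move=> [[x1 x2] k] /DDP[/= _ x20 x12] nx; case: eqP => // x10.
  exfalso; apply: nx; exists x2; last by rewrite x10.
  by rewrite x10 eqxx /= in x12; rewrite /= lt_neqAle eq_sym x12.
Qed.

Lemma interior_lower (P : R -> R -> Prop) (t : R * R) :
  (forall x y x' y', x' <= x -> y' <= y -> P x y -> P x' y') ->
  (interior [set t | P t.1 t.2]) t <-> exists2 e, 0 < e & P (t.1 + e) (t.2 + e).
Proof.
move=> mono; rewrite /interior /=; split.
  move=> /nbhs_ballP[e /= e0 /(_ (t.1 + e / 2, t.2 + e / 2))] H.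
  exists (e / 2); first by rewrite divr_gt0.
  apply: H; split; rewrite /ball /= opprD addNKr normrN gtr0_norm; lra.
move=> [e e0 Pe]; apply/nbhs_ballP; exists e => //= -[x y] [/= h1 h2].
apply: mono Pe.
  by move: h1; rewrite /ball /= ltr_norml => /andP[]; lra.
by move: h2; rewrite /ball /= ltr_norml => /andP[]; lra.
Qed.

End Occupation.

(** * Exchange of the two coordinates *)

Section Regular.
Variables (R : realType) (s0 : nat).
Implicit Types A : face -> int -> int -> 'M[R]_s0.

Definition connected_on A (D : set (int * int)) : Prop :=
  forall u v, fibers s0 D u -> fibers s0 D v ->
    reach (qbd_w A) (@qbd_tgt s0) (fibers s0 D) u v.

(** The assumptions in the form that is carried over to the process with exchanged coordinates. *)
Definition regular A : Prop :=
  [/\ qbd_blocks A, connected_on A NxZp, connected_on A ZpxN, connected_on A NxN &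
      forall v, fibers s0 ZpxZp0 v ->
        psummable (qbd_w A) (@qbd_tgt s0) (fibers s0 ZpxZp0) (fun u => (u == v)%:R)].

Lemma regularP A : qbd_blocks A ->
  (forall u v, fibers s0 ZpxZp0 u -> fibers s0 ZpxZp0 v -> (hatPhi A u v < +oo)%E) ->
  irreducible (fibers s0 NxZp) (flat (T1 A)) ->
  irreducible (fibers s0 ZpxN) (flat (T2 A)) ->
  irreducible (fibers s0 NxN) (flat (T12 A)) -> regular A.
Proof.
move=> hA Phi i1 i2 i12; have qw0 := qbd_w_ge0 hA; split => //.
- move=> u v Du Dv; apply: (irreducible_reach qw0 (@T1_kernel _ _ _ hA) i1 Du Dv).
- move=> u v Du Dv; apply: (irreducible_reach qw0 (@T2_kernel _ _ _ hA) i2 Du Dv).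
- move=> u v Du Dv; apply: (irreducible_reach qw0 (@T12_kernel _ _ A) i12 Du Dv).
- move=> v Dv u Du; exists (fine (hatPhi A u v)) => n.
  have Tk x : fibers s0 ZpxZp0 x ->
    row_kernel (qbd_w A) (@qbd_tgt s0) (fibers s0 ZpxZp0) (flat (Tqbd A)) x.
    by move=> _; exact: Tqbd_kernel.
  have P0 : (0 <= hatPhi A u v)%E by exact: (potential_ge0 qw0 Tk).
  rewrite -lee_fin fineK ?ge0_fin_numE ?Phi //.
  rewrite /hatPhi /potential (eq_eseriesr (fun n _ => mpowE qw0 Tk n Du Dv)).
  exact: nneseries_iter_ge.
Qed.

Definition swap_face (al : face) : face :=
  match al with F1 => F2 | F2 => F1 | F0 => F0 | F12 => F12 end.

Definition swapA A (al : face) (i1 i2 : int) : 'M[R]_s0 := A (swap_face al) i2 i1.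

Definition swap_state (u : state s0) : state s0 := ((u.1.2, u.1.1), u.2).
Definition swap_branch (k : branch s0) : branch s0 := ((k.1.2, k.1.1), k.2).

Lemma swapAK A : swapA (swapA A) = A.
Proof. by apply/funext => -[]; apply/funext => i; apply/funext. Qed.

Lemma swap_branch_bij : bijective swap_branch.
Proof. by exists swap_branch => -[[i j] l]. Qed.

Lemma qbd_w_swap A u k : qbd_w (swapA A) (swap_state u) (swap_branch k) = qbd_w A u k.
Proof.
case: u k => [[x1 x2] l] [[i j] m]; rewrite /qbd_w /swapA /= /face_of /=.
by case: (x1 == 0); case: (x2 == 0).
Qed.

Lemma qbd_tgt_swap u k : qbd_tgt (swap_state u) (swap_branch k) = swap_state (qbd_tgt u k).
Proof. by []. Qed.

Lemma swap_ZpxZp0 (u : state s0) : fibers s0 ZpxZp0 (swap_state u) <-> fibers s0 ZpxZp0 u.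
Proof.
case: u => [[x1 x2] l]; split=> -[[/= h1 h2] h]; split=> // -[e1 e2]; apply: h;
  by rewrite /= e1 e2.
Qed.

Lemma psummable_swap A h :
  psummable (qbd_w (swapA A)) (@qbd_tgt s0) (fibers s0 ZpxZp0) h ->
  psummable (qbd_w A) (@qbd_tgt s0) (fibers s0 ZpxZp0) (fun u => h (swap_state u)).
Proof.
exact: (psummable_iso swap_branch_bij (qbd_w_swap A) qbd_tgt_swap swap_ZpxZp0).
Qed.

Lemma connected_swap A D D' : (forall x, D' (x.2, x.1) <-> D x) ->
  connected_on A D -> connected_on (swapA A) D'.
Proof.
move=> DD' cD u v Du Dv.
have H : forall u, fibers s0 D' (swap_state u) <-> fibers s0 D u by move=> x; exact: DD'.
have K (x : state s0) : swap_state (swap_state x) = x by case: x => [[]].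
have := reach_iso (qbd_w_swap A) qbd_tgt_swap H (cD (swap_state u) (swap_state v) _ _).
by rewrite !K; apply; apply/H; rewrite K.
Qed.

Lemma regular_swap A : regular A -> regular (swapA A).
Proof.
move=> [hA c1 c2 c12 Phi]; split.
- case: hA => h0 [h1 h2 h3 h4]; split; first by move=> al i1 i2 H1 H2; exact: h0.
  by split => i Hi; rewrite /swapA /=; [exact: h2|exact: h1|exact: h4|exact: h3].
- by apply: connected_swap c2 => -[x1 x2]; split => -[].
- by apply: connected_swap c1 => -[x1 x2]; split => -[].
- by apply: connected_swap c12 => -[x1 x2]; split => -[].
- move=> v Dv; have := Phi (swap_state v) ((swap_ZpxZp0 v).2 Dv).
  rewrite -{1}(swapAK A) => /psummable_swap.
  rewrite (_ : (fun u => _) = (fun u => (u == v)%:R)) //; apply/funext => u.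
  by case: u v {Dv} => [[x1 x2] l] [[y1 y2] m]; rewrite /swap_state !xpair_eqE /= [(x2 == _) && _]andbC.
Qed.

Lemma expo_swap (a b : R) u : expo a b (swap_state u) = expo b a u.
Proof. by rewrite /expo addrC. Qed.

Lemma occ_fin1_swap A th : occ_fin1 (swapA A) th <-> occ_fin2 A th.
Proof.
split.
  move=> /psummable_swap; rewrite (_ : (fun u => _) =
    (fun u => if u.1.1 == 0 then expo 0 th u else 0)) //.
  by apply/funext => u; rewrite expo_swap.
rewrite -{1}(swapAK A) => /psummable_swap; rewrite (_ : (fun u => _) =
  (fun u => if u.1.2 == 0 then expo th 0 u else 0)) //.
by apply/funext => u; rewrite expo_swap.
Qed.

Lemma occ_fin2_swap A th : occ_fin2 (swapA A) th <-> occ_fin1 A th.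
Proof. by rewrite -occ_fin1_swap swapAK. Qed.

Lemma occ_fin_swap A th1 th2 : occ_fin A th1 th2 -> occ_fin (swapA A) th2 th1.
Proof.
rewrite -{1}(swapAK A) => /psummable_swap; rewrite (_ : (fun u => _) = expo th2 th1) //.
by apply/funext => u; rewrite expo_swap.
Qed.

Lemma SH12_swap A th1 th2 rho : SH12 (swapA A) th2 th1 rho -> SH12 A th1 th2 rho.
Proof.
move=> [g [g0 hg]]; exists g; split=> // l _; apply: le_trans (hg l I).
rewrite le_eqVlt; apply/orP; left; apply/eqP/esym.
apply: (kop_iso (f := id) swap_branch_bij) => //.
by move=> x k; rewrite !tilt2E /phase_w /swapA /= addrC.
Qed.

Lemma subcritical12_swap A th1 th2 :
  subcritical12 (swapA A) th2 th1 <-> subcritical12 A th1 th2.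
Proof.
split=> -[rho rho1 h]; exists rho => //; first exact: SH12_swap.
by apply: SH12_swap; rewrite swapAK.
Qed.

(** Holds by conversion: [barA2 A] unfolds to [barA1 (swapA A)], so the second half-plane shares the
    kernel of the first. *)
Lemma Gamma2_swap A (t : R * R) : Gamma2 A t <-> Gamma1 (swapA A) (t.2, t.1).
Proof. by []. Qed.

Lemma reach_map (I J : choiceType) (K : finType) (w : I -> K -> R) tgt
    (w' : J -> K -> R) tgt' (f : I -> J) (D : set I) (D' : set J) x y :
  (forall x k, 0 < w x k -> D x -> 0 < w' (f x) k) ->
  (forall x k, tgt' (f x) k = f (tgt x k)) -> (forall x, D x -> D' (f x)) ->
  reach w tgt D x y -> D x -> reach w' tgt' D' (f x) (f y).
Proof.
move=> wf tf Df; elim=> [{}x _|{}x k {}y wk Dk _ IH Dx]; first by constructor.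
apply: (@reachS _ _ _ _ _ _ _ k); rewrite ?tf; [exact: wf|exact: Df|exact: IH].
Qed.

Hypothesis s0_gt0 : (0 < s0)%N.
Let l0 : 'I_s0 := Ordinal s0_gt0.

(** Every level state reaches [(0, l0)], as [cp_superharmonic] requires: a path in [NxZp] projects
    to one between levels when its first coordinate is forgotten. *)
Lemma Gamma1P A t : regular A -> Gamma1 A t <-> subcritical1 A t.1.
Proof.
move=> [hA c1 _ _ _]; rewrite /Gamma1 /=.
have tw0 := tilt_ge0 (@sh1 s0) t.1 (level_w_ge0 hA).
have Tk u : fibers s0 Zplus u -> row_kernel (tilt (level_w A) (@sh1 s0) t.1) (@level_tgt s0)
    (fibers s0 Zplus) (flat (barA1_star A (expR t.1))) u by move=> _; exact: barA1_kernel.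
split=> [g|[rho rho1 hrho]].
  have D0 : fibers s0 Zplus ((0, l0) : int * 'I_s0) by [].
  have [|rho /andP[_ rho1] hr] := cp_superharmonic tw0 Tk g D0; last by exists rho.
  move=> [x l] Dx.
  have Du : fibers s0 NxZp ((1, x), l) by split.
  have Dv : fibers s0 NxZp ((1, 0), l0) by split.
  apply: (reach_map (f := fun u : state s0 => (u.1.2, u.2)) _ _ _ (c1 _ _ Du Dv)) => //.
  - by move=> u k wk [/= u1 _]; rewrite /tilt -qbd_w_D1 // mulr_gt0 ?expR_gt0.
  - by move=> u [].
(* [superharmonic_cp] wants a positive rate, while [rho] is only known to be below 1. *)
have rr : rho <= Num.max rho (1 / 2) by rewrite le_max lexx.
have [h] := SH1_le rr hrho.
move/(superharmonic_cp tw0 Tk); apply; first by rewrite lt_max; apply/orP; right; lra.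
by rewrite gt_max rho1; lra.
Qed.

Lemma Gamma12P A t : regular A -> Gamma12 A t <-> subcritical12 A t.1 t.2.
Proof.
move=> [hA _ _ c12 _]; rewrite /Gamma12 /=.
have tw0 := tilt_ge0 (@sh1 s0) t.1 (tilt_ge0 (@sh2 s0) t.2 (phase_w_ge0 hA)).
have Tk (u : 'I_s0) : setT u -> row_kernel (tilt (tilt (phase_w A) (@sh2 s0) t.2) (@sh1 s0) t.1)
    (@phase_tgt s0) setT (fun j k => A12_star A (expR t.1) (expR t.2) j k) u.
  by move=> _; exact: A12_kernel.
split=> [g|[rho rho1 hrho]].
  have [|rho /andP[_ rho1] hr] := cp_superharmonic tw0 Tk g (I : setT l0); last by exists rho.
  move=> l _.
  have Du : fibers s0 NxN ((1, 1), l) by split.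
  have Dv : fibers s0 NxN ((1, 1), l0) by split.
  apply: (reach_map (f := fun u : state s0 => u.2) _ _ _ (c12 _ _ Du Dv)) => //.
  by move=> u k wk Du'; rewrite /tilt -(qbd_w_D12 A _ Du') !mulr_gt0 ?expR_gt0.
have rr : rho <= Num.max rho (1 / 2) by rewrite le_max lexx.
have [h] := SH12_le rr hrho.
move/(superharmonic_cp tw0 Tk); apply; first by rewrite lt_max; apply/orP; right; lra.
by rewrite gt_max rho1; lra.
Qed.

Lemma occ_fin1_subcritical1 A x y : regular A -> (exists p, subcritical1 A p) ->
  x < y -> occ_fin1 A y -> exists2 x', x < x' & subcritical1 A x'.
Proof.
move=> [hA c1 _ _ _] [p hp] xy /(occ_fin1_SH1 s0_gt0 hA c1)[y' yy' hy'].
(* The share of [p] is so small that the combination moves from [y'] by less than half of its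
   distance to [x]. *)
pose s := Num.min 1 ((y' - x) / (2 * (1 + `|y' - p|))).
have n0 := normr_ge0 (y' - p); have n1 := ler_norm (y' - p).
have s_0 : 0 < s by rewrite lt_min ltr01 /= divr_gt0; lra.
have s_1 : s <= 1 by rewrite ge_min lexx.
have sM : s * (2 * (1 + `|y' - p|)) <= y' - x.
  by rewrite -ler_pdivlMr ?ge_min ?lexx ?orbT //; lra.
exists ((1 - s) * y' + s * p); last by apply: subcritical1_mix => //; rewrite s_0.
have : s * (y' - p) <= s * `|y' - p| by rewrite ler_wpM2l // ltW.
by nra.
Qed.

End Regular.

(** * The convergence domains in terms of finite potentials *)

Section Boundary.
Variables (R : realType) (s0 : nat) (A : face -> int -> int -> 'M[R]_s0).
Hypotheses (s0_gt0 : (0 < s0)%N) (hA : qbd_blocks A).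
Hypothesis irrT : irreducible (fibers s0 ZpxZp) (flat (Tqbd A)).

Lemma DomP (t : R * R) : Dom A t <-> exists2 e, 0 < e & occ_fin A (t.1 + e) (t.2 + e).
Proof.
rewrite /Dom (_ : [set t | _] = [set t | occ_fin A t.1 t.2]).
  by apply: (interior_lower (P := occ_fin A)) => x y x' y'; exact: occ_fin_mono.
by apply/seteqP; split => u /= /(hatnu_starP s0_gt0 hA irrT).
Qed.

Lemma Dom1P (t : R * R) : Dom1 A t <-> inner (occ_fin1 A) t.1.
Proof.
rewrite /Dom1 (_ : [set t | _] = [set t | (fun x y => occ_fin1 A x) t.1 t.2]).
  by apply: (interior_lower (P := fun x y => occ_fin1 A x)) => x y x' y' h _; exact: occ_fin1_mono.
by apply/seteqP; split => u /= /(hatnu_star0P s0_gt0 hA irrT).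
Qed.

Lemma Dom2P (t : R * R) : (forall x x', x' <= x -> occ_fin2 A x -> occ_fin2 A x') ->
  Dom2 A t <-> inner (occ_fin2 A) t.2.
Proof.
move=> mono; rewrite /Dom2 (_ : [set t | _] = [set t | (fun x y => occ_fin2 A y) t.1 t.2]).
  by apply: (interior_lower (P := fun x y => occ_fin2 A y)) => x y x' y' _; exact: mono.
by apply/seteqP; split => u /= /(hatnu_0starP s0_gt0 hA irrT).
Qed.

End Boundary.

Theorem theorem4p2 (R : realType) (s0 : nat)
    (A : face -> int -> int -> 'M[R]_s0)
    (hs0 : (0 < s0)%N)
    (hA : qbd_blocks A)
    (A1 : irreducible_aperiodic ZpxZp (Tqbd A))
    (A2 : [/\ irreducible_aperiodic ZxZp (T1 A),
              irreducible_aperiodic ZpxZ (T2 A) &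
              irreducible_aperiodic ZxZ (T12 A)])
    (A3 : forall u v, fibers s0 ZpxZp0 u -> fibers s0 ZpxZp0 v ->
            (hatPhi A u v < +oo)%E)
    (A4 : [/\ irreducible_aperiodic NxZp (T1 A),
              irreducible_aperiodic ZpxN (T2 A) &
              irreducible_aperiodic NxN (T12 A)])
    (A5 : Gamma1 A `&` Gamma2 A `&` Gamma12 A !=set0)
    (A6 : Gamma1 A `&` Dom2 A `&` Gamma12 A !=set0 /\
          Dom1 A `&` Gamma2 A `&` Gamma12 A !=set0) :
  Dom A = ex_set (Dom1 A `&` Dom2 A `&` Gamma12 A) /\
  ex_set (Dom1 A `&` Dom2 A `&` Gamma12 A) = ex_set (Gamma A).
Proof.
have regA : regular A.
  by case: A4 => -[i1 _] [i2 _] [i12 _]; exact: regularP.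
have regS := regular_swap regA.
have [_ c1 c2 c12 Phi] := regA; have [hS d1 d2 d12 PhiS] := regS.
have mono2 x x' : x' <= x -> occ_fin2 A x -> occ_fin2 A x'.
  by move=> h; rewrite -!occ_fin1_swap; exact: occ_fin1_mono.
have D1P t : Dom1 A t <-> inner (occ_fin1 A) t.1 by exact: Dom1P A1.1 t.
have D2P t : Dom2 A t <-> inner (occ_fin2 A) t.2 by exact: Dom2P A1.1 t mono2.
have DP t : Dom A t <-> exists2 e, 0 < e & occ_fin A (t.1 + e) (t.2 + e) by exact: DomP A1.1 t.
have G1P t : Gamma1 A t <-> subcritical1 A t.1 by exact: Gamma1P.
have G2P t : Gamma2 A t <-> subcritical1 (swapA A) t.2.
  by rewrite Gamma2_swap (Gamma1P hs0 _ regS).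
have G12P t : Gamma12 A t <-> subcritical12 A t.1 t.2 by exact: Gamma12P.
have [[[p1 p2] [[/G1P gp /D2P Fp] /G12P Gp]] [[q1 q2] [[/D1P Fq /G2P gq] /G12P Gq]]] := A6.
have bar12 x y : subcritical12 A x y -> SH12 A x y 1.
  by move=> [rho /ltW rho1]; exact: SH12_le.
have [innerE exE] : (forall x y, (inner (occ_fin1 A) x /\ inner (occ_fin2 A) y /\ subcritical12 A x y) <->
     ((exists2 x', x < x' & subcritical1 A x') /\
      (exists2 y', y < y' & subcritical1 (swapA A) y') /\ subcritical12 A x y)) /\
  (forall x y, (exists2 e, 0 < e & occ_fin A (x + e) (y + e)) <->
     exists x' y', [/\ x < x', y < y', inner (occ_fin1 A) x', inner (occ_fin2 A) y' &
       subcritical12 A x' y']).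
  apply: (plane_domains (Gbar := fun x y => SH12 A x y 1)) => //.
  - by move=> x x'; exact: occ_fin1_mono.
  - by move=> x y x' y'; exact: occ_fin_mono.
  - exact: (occ_fin1_bounded hs0 hA c1).
  - have [B HB] := occ_fin1_bounded hs0 hS d1.
    by exists B => x /(occ_fin1_swap A x).2; exact: HB.
  - by move=> x y; exact: occ_fin_occ_fin1.
  - by move=> x y; exact: occ_fin_occ_fin2.
  - by move=> s x y; exact: subcritical1_convex.
  - by move=> s x y; exact: subcritical1_convex.
  - move=> s x y x' y' s01 h h'; have := SH12_convex hA s01 h h'.
    by rewrite !mulr1 subrK.
  - by move=> s x y x' y'; exact: subcritical12_mix.
  - by move=> x y; exact: subcritical12_open.
  - by move=> x y; apply: occ_fin1_subcritical1 => //; exists p1.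
  - move=> x y xy /(occ_fin1_swap A y).2; apply: occ_fin1_subcritical1 => //.
    by exists q2.
  - by move=> x y [rho rho1 h] /bar12; exact: SH1_occ_fin2_occ_fin1 hA rho1 h.
  (* The bootstrap for the second axis is the one for the first axis, applied to the exchanged
     process. *)
  - move=> x y [rho rho1 h] /(subcritical12_swap A x y).2 [r r1 hr] /(occ_fin2_swap A x).2 F.
    apply/occ_fin1_swap; apply: (SH1_occ_fin2_occ_fin1 hS rho1 h _ F).
    exact: SH12_le (ltW r1) hr.
  - by move=> x y [rho rho1 h]; exact: occ_fin1_occ_fin2_occ_fin rho1 h.
  - by move=> x y eta fE nE; exact: occ_fin_SH12.
  - move=> x y eta /occ_fin_swap fE nE.
    have [|x' [y' [h1 h2 h3 h4]]] := occ_fin_SH12 hs0 hS d2 d12 PhiS fE (eta := eta).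
      by move/(occ_fin2_swap A eta).1.
    by exists y', x'; split => //; exact: SH12_swap.
  - by exists p1, p2.
  - by exists q1, q2.
have SE : Dom1 A `&` Dom2 A `&` Gamma12 A = Gamma A.
  apply/seteqP; split=> t.
    move=> [[/D1P h1 /D2P h2] /G12P h12].
    have [[x' xx' gx] [[y' yy' gy] _]] := (innerE _ _).1 (conj h1 (conj h2 h12)).
    split; last exact/G12P.
    (* [Gamma1] and [Gamma2] constrain one coordinate each, so the other one is free and only has to
       be strictly larger. *)
    split; [exists (x', t.2 + 1)|exists (t.1 + 1, y')]; rewrite ?ltrDl //.
      exact/G1P.
    exact/G2P.
  move=> [[[u /G1P gu [tu _]] [v /G2P gv [_ tv]]] /G12P h12].
  have [|h1 [h2 _]] := (innerE t.1 t.2).2; last first.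
    by split; [split; [exact/D1P|exact/D2P]|exact/G12P].
  by split; [exists u.1|split => //; exists v.2].
split; last by rewrite SE.
apply/seteqP; split=> t.
  move=> /DP/exE[x [y [tx ty h1 h2 h12]]]; exists (x, y) => //.
  by split; [split; [exact/D1P|exact/D2P]|exact/G12P].
move=> [[x y] [[/D1P h1 /D2P h2] /G12P h12] [tx ty]].
by apply/DP/exE; exists x, y.
Qed.
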